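(* Let $X$ be a real Banach space and $T,S:X\rightrightarrows X^*$ maximal monotone operators with $D_T\cap\overline{D_S}\subset D_S$. (1) If $T$ is $\mathcal C_1$-maximal, $\overline{D_S}\in\mathcal C_1(T)$, and there exists $x_0\in D_T\cap D_S$ such that $S$ is directionally inf bounded at $x_0$, then $T+S$ is maximal monotone. (2) If $T$ is $\mathcal C_0$-maximal and $D_T\cap\mathrm{int}\,D_S\ne\emptyset$, then $T+S$ is maximal monotone.
   Context: Sums are $(T+S)(x)=T(x)+S(x)$. $I_C$ is the indicator function of $C$ and $\partial I_C$ its normal cone operator. $\mathcal C_0(T)=\{C\subset X: C$ closed, convex, $D_T\cap\mathrm{int}\,C\ne\emptyset\}$; $\mathcal C_1(T)=\{C\subset X: C$ closed, convex, and $\bigcup_{\lambda>0}\lambda(\mathrm{co}\,D_T-C)$ is a closed subspace of $X\}$. $T$ is $\mathcal C_i$-maximal if $T+\partial I_C$ is maximal monotone for every $C\in\mathcal C_i(T)$. For $x\in X$, $A\subset X$, $K_{x,A}=\{(1-t)x+ta:0\le t\le1,\ a\in A\}$. A monotone $S$ is directionally inf bounded at $x\in D_S$ if for every $y\in X$ there exist $\epsilon>0$, $M>0$ such that for every $z\in K_{y,B(x,\epsilon)}\cap D_S$ there is $z^*\in S(z)$ with $\langle z^*,z-y\rangle\le M\|z-y\|$. *)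

(* Defs.v *)
From Stdlib Require Import Reals.
Open Scope R_scope.

Record Banach : Type := {
  car :> Type;
  vadd : car -> car -> car;
  vopp : car -> car;
  vzero : car;
  vscal : R -> car -> car;
  vnorm : car -> R;
  vadd_assoc : forall x y z, vadd x (vadd y z) = vadd (vadd x y) z;
  vadd_comm : forall x y, vadd x y = vadd y x;
  vadd_0 : forall x, vadd x vzero = x;
  vadd_opp : forall x, vadd x (vopp x) = vzero;
  vscal_assoc : forall a b x, vscal a (vscal b x) = vscal (a * b) x;
  vscal_1 : forall x, vscal 1 x = x;
  vscal_addr : forall a x y, vscal a (vadd x y) = vadd (vscal a x) (vscal a y);
  vscal_addl : forall a b x, vscal (a + b) x = vadd (vscal a x) (vscal b x);
  vnorm_nonneg : forall x, 0 <= vnorm x;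
  vnorm_eq0 : forall x, vnorm x = 0 -> x = vzero;
  vnorm_scal : forall a x, vnorm (vscal a x) = Rabs a * vnorm x;
  vnorm_triangle : forall x y, vnorm (vadd x y) <= vnorm x + vnorm y;
  vcomplete : forall u : nat -> car,
    (forall eps, eps > 0 -> exists N, forall m n, (m >= N)%nat -> (n >= N)%nat ->
        vnorm (vadd (u m) (vopp (u n))) < eps) ->
    exists l, forall eps, eps > 0 -> exists N, forall n, (n >= N)%nat ->
        vnorm (vadd (u n) (vopp l)) < eps
}.

Section Defs.
Variable X : Banach.

Definition vsub (x y : X) : X := vadd X x (vopp X y).

Definition is_dual (f : X -> R) : Prop :=
  (forall x y, f (vadd X x y) = f x + f y) /\
  (forall a x, f (vscal X a x) = a * f x) /\
  (exists M, forall x, Rabs (f x) <= M * vnorm X x).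

(* Set-valued operators X ⇉ X^*, given by their graph. *)
Definition operator := X -> (X -> R) -> Prop.

Definition dom (T : operator) : X -> Prop := fun x => exists f, T x f.

Definition monotone (T : operator) : Prop :=
  (forall x f, T x f -> is_dual f) /\
  (forall x y f g, T x f -> T y g -> 0 <= f (vsub x y) - g (vsub x y)).

Definition maximal_monotone (T : operator) : Prop :=
  monotone T /\
  (forall x f, is_dual f ->
     (forall y g, T y g -> 0 <= f (vsub x y) - g (vsub x y)) -> T x f).

Definition op_add (T S : operator) : operator :=
  fun x h => exists f g, T x f /\ S x g /\ forall y, h y = f y + g y.

Definition bball (x : X) (eps : R) : X -> Prop := fun y => vnorm X (vsub y x) < eps.

Definition bclosure (A : X -> Prop) : X -> Prop :=
  fun x => forall eps, eps > 0 -> exists a, A a /\ vnorm X (vsub a x) < eps.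

Definition binterior (A : X -> Prop) : X -> Prop :=
  fun x => exists eps, eps > 0 /\ forall y, bball x eps y -> A y.

Definition bclosed (A : X -> Prop) : Prop := forall x, bclosure A x -> A x.

Definition bconvex (A : X -> Prop) : Prop :=
  forall x y t, A x -> A y -> 0 <= t <= 1 ->
    A (vadd X (vscal X (1 - t) x) (vscal X t y)).

Definition co (A : X -> Prop) : X -> Prop :=
  fun x => forall C, bconvex C -> (forall a, A a -> C a) -> C x.

Definition closed_subspace (V : X -> Prop) : Prop :=
  V (vzero X) /\ (forall x y, V x -> V y -> V (vadd X x y)) /\
  (forall a x, V x -> V (vscal X a x)) /\ bclosed V.

Definition normal_cone (C : X -> Prop) : operator :=
  fun x f => C x /\ is_dual f /\ forall c, C c -> f (vsub c x) <= 0.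

Definition calC0 (T : operator) (C : X -> Prop) : Prop :=
  bclosed C /\ bconvex C /\ exists x, dom T x /\ binterior C x.

Definition cone_diff (T : operator) (C : X -> Prop) : X -> Prop :=
  fun z => exists lam a c, lam > 0 /\ co (dom T) a /\ C c /\
             z = vscal X lam (vsub a c).

Definition calC1 (T : operator) (C : X -> Prop) : Prop :=
  bclosed C /\ bconvex C /\ closed_subspace (cone_diff T C).

Definition C0_maximal (T : operator) : Prop :=
  forall C, calC0 T C -> maximal_monotone (op_add T (normal_cone C)).

Definition C1_maximal (T : operator) : Prop :=
  forall C, calC1 T C -> maximal_monotone (op_add T (normal_cone C)).

Definition Kset (x : X) (A : X -> Prop) : X -> Prop :=
  fun z => exists t a, 0 <= t <= 1 /\ A a /\
             z = vadd X (vscal X (1 - t) x) (vscal X t a).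

Definition dir_inf_bounded (S : operator) (x : X) : Prop :=
  dom S x /\
  forall y, exists eps M, eps > 0 /\ M > 0 /\
    forall z, Kset y (bball x eps) z -> dom S z ->
      exists zs, S z zs /\ zs (vsub z y) <= M * vnorm X (vsub z y).

End Defs.

(* Main.v *)
Require Import Defs.
From Stdlib Require Import Reals.
From Stdlib Require Import ZArith Lra Lia List Classical ClassicalEpsilon.
From mathcomp Require classical_sets.
Import ListNotations.
Open Scope R_scope.

(* Let (x, xh) be monotonically related to T + S and C = cl D_S.  Since T + N_(C /\ K) is
   maximal for convex cones K with apex x around x0, and S is directionally inf bounded at x0,
   the point (x, xh - N f) belongs to its graph for a functional f that is large on K; so x lies
   in D_T and D_S.  A splitting xh = (xh + u) + (-u) with xh + u in T(x) and -u in S(x) is a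
   linear minorant of the infimal convolution p of the (conic) Fitzpatrick functions of T and S
   at x, so by Hahn-Banach it suffices that p(v) >= -N |v|.  If not, the open mapping argument
   for the closed subspace generated by co D_T - C produces a point y on the T-side that is, on
   the S-side, only an infinite combination of points d_i of D_S tending to x0, and whose cost
   is negative.  Testing at x + tau y for every tail of the combination gives pairs (z, s) in S
   on which s(d_i - z) is huge for some large i, and a gliding hump turns these z into a point
   zb with inf { s(d_i - zb) : s in S(d_i) } unbounded along a subsequence, against directional
   inf boundedness at x0 in the direction of zb.
   Part (2) reduces to the same situation: if x0 is interior to D_S, then S is locally bounded
   there, hence directionally inf bounded, cl D_S is convex and co D_T - C absorbs X. *)

(* Directional inf boundedness gives, for each direction separately, a one-sided bound on some s in
   S(z); it controls neither the norm of s nor the dependence on the direction. This makes the two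
   sides of the open mapping argument unequal. On the T-side the k-th correction carries a
   functional of norm at most N_k, the weights 2^-k / N_k make these summable, and the limit is
   again a Fitzpatrick bound. On the S-side only s(d_k - x) <= M is known, so the infinite
   combination has no limiting functional: it is cut at every n and its tail is reached through the
   values s(d_i - z). The constants for a direction zb are fixed only after zb, so one zb has to
   defeat all of them at once. The Fitzpatrick functions are homogenised, with a weight as extra
   coordinate, so that weighted series add up without renormalisation. Maximality of T enters only
   through sets C /\ K with x0 interior to K: such a localisation changes neither the cone generated
   by co D_T - C nor the interiority of x0, so both notions of maximality provide it. *)
Declare Scope vec_scope.
Delimit Scope vec_scope with V.
Notation "x [+] y" := (vadd _ x y) (at level 50, left associativity) : vec_scope.
Notation "x [-] y" := (vsub _ x y) (at level 50, left associativity) : vec_scope.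
Notation "a [*] x" := (vscal _ a x) (at level 40, left associativity) : vec_scope.
Notation "[0]" := (vzero _) : vec_scope.
Notation norm := (vnorm _).
Open Scope vec_scope.

(** * Vector identities, duals and norms *)

Section Vec.
Variable X : Banach.

Lemma vadd_0l (x : X) : [0] [+] x = x.
Proof. rewrite vadd_comm. apply vadd_0. Qed.

Lemma vadd_cancel (x y z : X) : x [+] z = y [+] z -> x = y.
Proof.
  intros H. rewrite <- (vadd_0 _ x), <- (vadd_0 _ y), <- (vadd_opp _ z), !vadd_assoc, H.
  reflexivity.
Qed.

Lemma vscal_0l (x : X) : 0 [*] x = [0].
Proof.
  apply (vadd_cancel _ _ (0 [*] x)). rewrite vadd_0l, <- vscal_addl. f_equal. ring.
Qed.

Lemma vscal_0r (a : R) : a [*] [0] = ([0] : X).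
Proof. rewrite <- (vscal_0l [0]), vscal_assoc, Rmult_0_r. reflexivity. Qed.

Lemma vopp_scal (x : X) : vopp X x = (-1) [*] x.
Proof.
  apply (vadd_cancel _ _ x). rewrite vadd_comm, vadd_opp.
  rewrite <- (vscal_1 _ x) at 2. rewrite <- vscal_addl.
  replace (-1 + 1) with 0 by ring. now rewrite vscal_0l.
Qed.

(** * Linear vector identities by reflection *)

Inductive vexp : Type :=
  | VVar (n : nat) | VZero | VAdd (a b : vexp) | VSub (a b : vexp)
  | VOpp (a : vexp) | VScal (c : R) (a : vexp).

Fixpoint veval (env : list X) (e : vexp) : X :=
  match e with
  | VVar n => nth n env [0]
  | VZero => [0]
  | VAdd a b => veval env a [+] veval env b
  | VSub a b => veval env a [-] veval env b
  | VOpp a => vopp X (veval env a)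
  | VScal c a => c [*] veval env a
  end.

Fixpoint vcoef (e : vexp) (i : nat) : R :=
  match e with
  | VVar n => if Nat.eqb n i then 1 else 0
  | VZero => 0
  | VAdd a b => vcoef a i + vcoef b i
  | VSub a b => vcoef a i - vcoef b i
  | VOpp a => - vcoef a i
  | VScal c a => c * vcoef a i
  end.

Fixpoint vlin (env : list X) (k : nat) (f : nat -> R) : X :=
  match env with
  | nil => [0]
  | x :: l => f k [*] x [+] vlin l (S k) f
  end.

(** The combined form f + a g serves sums, differences, opposites and multiples alike. *)
Lemma vlin_add (env : list X) (k : nat) (f g : nat -> R) (a : R) :
  vlin env k (fun i => f i + a * g i) = vlin env k f [+] a [*] vlin env k g.
Proof.
  revert k; induction env as [|x l IH]; intros k; simpl.
  - now rewrite vscal_0r, vadd_0.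
  - rewrite IH, vscal_addr, vscal_addl, vscal_assoc, !vadd_assoc. f_equal.
    rewrite <- !vadd_assoc. f_equal. apply vadd_comm.
Qed.

Lemma vlin_ext (env : list X) (k : nat) (f g : nat -> R) :
  (forall i, (k <= i < k + length env)%nat -> f i = g i) -> vlin env k f = vlin env k g.
Proof.
  revert k; induction env as [|x l IH]; intros k H; simpl; auto.
  f_equal.
  - f_equal. apply H. simpl. lia.
  - apply IH. intros i Hi. apply H. simpl. lia.
Qed.

Lemma vlin_zero (env : list X) (k : nat) : vlin env k (fun _ => 0) = [0].
Proof.
  revert k; induction env as [|x l IH]; intros k; simpl; auto.
  now rewrite IH, vscal_0l, vadd_0.
Qed.

Lemma vlin_var (env : list X) (k n : nat) :
  vlin env k (fun i => if Nat.eqb (k + n) i then 1 else 0) = nth n env [0].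
Proof.
  revert k n; induction env as [|x l IH]; intros k n; simpl.
  - now destruct n.
  - destruct n as [|n].
    + rewrite Nat.add_0_r, Nat.eqb_refl, vscal_1.
      rewrite (vlin_ext _ _ _ (fun _ => 0)), vlin_zero, vadd_0; auto.
      intros i Hi. destruct (Nat.eqb_spec k i); auto; lia.
    + destruct (Nat.eqb_spec (k + S n) k) as [E|_]; [lia|].
      rewrite vscal_0l, vadd_0l, <- (IH (S k) n).
      apply vlin_ext. intros i _. rewrite Nat.add_succ_r. reflexivity.
Qed.

Lemma veval_vlin (env : list X) (e : vexp) : veval env e = vlin env 0 (vcoef e).
Proof.
  induction e as [n| |a IHa b IHb|a IHa b IHb|a IHa|c a IHa]; simpl.
  - symmetry. apply (vlin_var env 0 n).
  - symmetry. apply (vlin_zero env 0).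
  - rewrite IHa, IHb. transitivity (vlin env 0 (fun i => vcoef a i + 1 * vcoef b i)).
    + now rewrite vlin_add, vscal_1.
    + apply vlin_ext. intros; simpl; ring.
  - unfold vsub. rewrite vopp_scal, IHa, IHb, <- vlin_add.
    apply vlin_ext. intros; simpl; ring.
  - rewrite vopp_scal, IHa, <- (vadd_0l (_ [*] _)), <- (vlin_zero env 0), <- vlin_add.
    apply vlin_ext. intros; simpl; ring.
  - rewrite IHa, <- (vadd_0l (_ [*] _)), <- (vlin_zero env 0), <- vlin_add.
    apply vlin_ext. intros; simpl; ring.
Qed.

(** A recursive conjunction instead of a quantifier over indices, so that [cbn] turns it into
    finitely many real equations, one for each atom. *)
Fixpoint vcoef_eq (n : nat) (a b : vexp) : Prop :=
  match n with
  | O => True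
  | S n => vcoef a n = vcoef b n /\ vcoef_eq n a b
  end.

Lemma vec_reflect (env : list X) (a b : vexp) :
  vcoef_eq (length env) a b -> veval env a = veval env b.
Proof.
  intros H. rewrite !veval_vlin. apply vlin_ext. simpl. intros i Hi.
  revert H Hi. generalize (length env). intros n; induction n as [|n IH]; simpl; [lia|].
  intros [E H] Hi. destruct (Nat.eq_dec i n) as [->|Hn]; auto. apply IH; auto; lia.
Qed.
End Vec.

Ltac vec_mem x l :=
  match l with
  | nil => constr:(false)
  | x :: _ => constr:(true)
  | _ :: ?l' => vec_mem x l'
  end.
Ltac vec_idx x l :=
  match l with
  | x :: _ => constr:(O)
  | _ :: ?l' => let n := vec_idx x l' in constr:(S n)
  end.
Ltac vec_env t l :=
  match t with
  | vadd _ ?a ?b => let l1 := vec_env a l in vec_env b l1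
  | vsub _ ?a ?b => let l1 := vec_env a l in vec_env b l1
  | vopp _ ?a => vec_env a l
  | vscal _ _ ?a => vec_env a l
  | vzero _ => l
  | ?x => match vec_mem x l with true => l | false => constr:(x :: l) end
  end.
Ltac vec_reify t l :=
  match t with
  | vadd _ ?a ?b => let a' := vec_reify a l in let b' := vec_reify b l in constr:(VAdd a' b')
  | vsub _ ?a ?b => let a' := vec_reify a l in let b' := vec_reify b l in constr:(VSub a' b')
  | vopp _ ?a => let a' := vec_reify a l in constr:(VOpp a')
  | vscal _ ?c ?a => let a' := vec_reify a l in constr:(VScal c a')
  | vzero _ => constr:(VZero)
  | ?x => let n := vec_idx x l in constr:(VVar n)
  end.
Ltac vec_goal :=
  lazymatch goal with
  | |- @eq (car ?X) ?a ?b =>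
      let l0 := vec_env a (@nil (car X)) in
      let l := vec_env b l0 in
      let ea := vec_reify a l in
      let eb := vec_reify b l in
      change (veval X l ea = veval X l eb);
      apply vec_reflect; cbn [vcoef_eq vcoef length Nat.eqb]; repeat split
  end.
Ltac vec := vec_goal; try ring.
(** For coefficients with denominators; the nonvanishing conditions that [auto] cannot settle remain
    as goals. *)
Ltac vecf := vec_goal; try (field; auto).

Section Dual.
Variable X : Banach.

Lemma dual_add (f : X -> R) (x y : X) : is_dual X f -> f (x [+] y) = f x + f y.
Proof. intros [H _]; apply H. Qed.
Lemma dual_scal (f : X -> R) (a : R) (x : X) : is_dual X f -> f (a [*] x) = a * f x.
Proof. intros (_ & H & _); apply H. Qed.
Lemma dual_opp (f : X -> R) (x : X) : is_dual X f -> f (vopp X x) = - f x.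
Proof. intros H. rewrite vopp_scal, dual_scal by assumption. ring. Qed.
Lemma dual_sub (f : X -> R) (x y : X) : is_dual X f -> f (x [-] y) = f x - f y.
Proof. intros H. unfold vsub. rewrite dual_add, dual_opp by assumption. ring. Qed.
Lemma dual_zero (f : X -> R) : is_dual X f -> f [0] = 0.
Proof. intros H. rewrite <- (vscal_0l X [0]), dual_scal by assumption. ring. Qed.

Lemma dual_bound (f : X -> R) :
  is_dual X f -> exists N, 0 <= N /\ forall v, Rabs (f v) <= N * norm v.
Proof.
  intros (_ & _ & N & H). exists (Rabs N). split; [apply Rabs_pos|].
  intros v. eapply Rle_trans; [apply H|].
  apply Rmult_le_compat_r; [apply vnorm_nonneg|apply Rle_abs].
Qed.

Lemma is_dual_comb (f g : X -> R) (a b : R) :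
  is_dual X f -> is_dual X g -> is_dual X (fun v => a * f v + b * g v).
Proof.
  intros Hf Hg. repeat split.
  - intros x y. rewrite !dual_add by assumption. ring.
  - intros c x. rewrite !dual_scal by assumption. ring.
  - destruct (dual_bound f Hf) as (M & _ & HM), (dual_bound g Hg) as (N & _ & HN).
    exists (Rabs a * M + Rabs b * N). intros x.
    eapply Rle_trans; [apply Rabs_triang|]. rewrite !Rabs_mult.
    pose proof (Rabs_pos a); pose proof (Rabs_pos b).
    specialize (HM x); specialize (HN x).
    pose proof (vnorm_nonneg X x).
    assert (Rabs a * Rabs (f x) <= Rabs a * (M * norm x)) by (apply Rmult_le_compat_l; auto).
    assert (Rabs b * Rabs (g x) <= Rabs b * (N * norm x)) by (apply Rmult_le_compat_l; auto).
    lra.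
Qed.

Lemma is_dual_ext (f g : X -> R) : (forall v, f v = g v) -> is_dual X f -> is_dual X g.
Proof.
  intros E (H1 & H2 & N & H3). repeat split.
  - intros x y. rewrite <- !E. apply H1.
  - intros c x. rewrite <- !E. apply H2.
  - exists N. intros x. rewrite <- E. apply H3.
Qed.

Lemma is_dual_zero : is_dual X (fun _ => 0).
Proof.
  repeat split; try (intros; ring). exists 0. intros v. rewrite Rabs_R0. lra.
Qed.

Lemma norm_zero : norm ([0] : X) = 0.
Proof. rewrite <- (vscal_0l X [0]), vnorm_scal, Rabs_R0. ring. Qed.

Lemma norm_opp (x : X) : norm (vopp X x) = norm x.
Proof. rewrite vopp_scal, vnorm_scal, Rabs_left by lra. ring. Qed.

Lemma norm_scal_pos (a : R) (x : X) : 0 <= a -> norm (a [*] x) = a * norm x.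
Proof. intros H. now rewrite vnorm_scal, Rabs_pos_eq. Qed.

Lemma norm_sub_sym (x y : X) : norm (x [-] y) = norm (y [-] x).
Proof. rewrite <- norm_opp. f_equal. vec. Qed.

Lemma norm_sub_triangle (x y z : X) : norm (x [-] z) <= norm (x [-] y) + norm (y [-] z).
Proof. replace (x [-] z) with ((x [-] y) [+] (y [-] z)) by vec. apply vnorm_triangle. Qed.

Lemma norm_add_le (x y : X) (a b : R) : norm x <= a -> norm y <= b -> norm (x [+] y) <= a + b.
Proof. intros. pose proof (vnorm_triangle X x y). lra. Qed.

Lemma norm_sub_le (x y : X) : norm (x [-] y) <= norm x + norm y.
Proof. unfold vsub. rewrite <- (norm_opp y). apply vnorm_triangle. Qed.

Lemma sub_diag (x : X) : x [-] x = [0].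
Proof. vec. Qed.

Lemma norm_sub_diag (x : X) : norm (x [-] x) = 0.
Proof. rewrite sub_diag. apply norm_zero. Qed.

Lemma norm_sub_eq0 (x y : X) : norm (x [-] y) = 0 -> x = y.
Proof.
  intros H. apply vnorm_eq0 in H. replace x with ((x [-] y) [+] y) by vec. rewrite H. vec.
Qed.

Lemma linear_bound (f : X -> R) (N : R) :
  (forall x y, f (x [+] y) = f x + f y) -> (forall a x, f (a [*] x) = a * f x) ->
  (forall v, f v <= N * norm v) -> is_dual X f.
Proof.
  intros H1 H2 H3. repeat split; auto. exists N. intros x.
  assert (E : f ((-1) [*] x) <= N * norm ((-1) [*] x)) by apply H3.
  rewrite H2, vnorm_scal, (Rabs_left (-1)) in E by lra. specialize (H3 x).
  unfold Rabs. destruct (Rcase_abs (f x)); lra.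
Qed.
End Dual.

Ltac dsimp_step f H :=
  first [ rewrite (dual_add _ f _ _ H) | rewrite (dual_sub _ f _ _ H)
        | rewrite (dual_scal _ f _ _ H) | rewrite (dual_opp _ f _ H)
        | rewrite (dual_zero _ f H) ].
Ltac dsimp_step_in f H E :=
  first [ rewrite (dual_add _ f _ _ H) in E | rewrite (dual_sub _ f _ _ H) in E
        | rewrite (dual_scal _ f _ _ H) in E | rewrite (dual_opp _ f _ H) in E
        | rewrite (dual_zero _ f H) in E ].
Ltac dsimp := repeat match goal with H : is_dual _ ?f |- _ => dsimp_step f H end.
Tactic Notation "dsimp" "in" hyp(E) :=
  repeat match goal with H : is_dual _ ?f |- _ => dsimp_step_in f H E end.

(** * Hahn-Banach *)

Section HahnBanach.
Variable X : Banach.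

(** A convex cone in X x R, thought of as generating the epigraph of a sublinear function whose
    value at v is the infimum of the r with [G v r]. *)
Definition epi_cone (G : X -> R -> Prop) : Prop :=
  (forall v w r s, G v r -> G w s -> G (v [+] w) (r + s)) /\
  (forall a v r, 0 < a -> G v r -> G (a [*] v) (a * r)).

(** The last clause keeps the sublinear function from taking the value minus infinity at 0; being a
    condition on single elements, it passes to unions of chains. *)
Definition good_cone (G0 G : X -> R -> Prop) : Prop :=
  (forall v r, G0 v r -> G v r) /\ epi_cone G /\ (forall r, G [0] r -> 0 <= r).

Lemma maximal_cone (G0 : X -> R -> Prop) :
  (exists v r, G0 v r) -> good_cone G0 G0 ->
  exists G, good_cone G0 G /\
    forall G', good_cone G0 G' -> (forall v r, G v r -> G' v r) -> forall v r, G' v r -> G v r.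
Proof.
  intros (v0 & r0 & H0) HG0.
  pose (un := fun (A : X * R -> Prop) v r => A (v, r)).
  pose (P := fun A : X * R -> Prop => (forall p, ~ A p) \/ good_cone G0 (un A)).
  destruct (classical_sets.Zorn_bigcup (P := P)) as (A & PA & Amax).
  - intros F HF Ftot.
    assert (Hgood : forall A p, F A -> A p -> good_cone G0 (un A)).
    { intros A p HA Hp. destruct (HF A HA) as [E|E]; [destruct (E p Hp)|exact E]. }
    destruct (classic (exists A p, F A /\ A p)) as [(A & p & HA & Hp)|Hn].
    + right. split; [|split; [split|]].
      * intros v r H. exists A; [exact HA|].
        destruct (Hgood A p HA Hp) as (Hsub & _). apply Hsub, H.
      * intros v w r s [B HB Hv] [D HD Hw].
        destruct (Ftot B D HB HD) as [HBD|HBD].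
        -- exists D; [exact HD|]. destruct (Hgood D _ HD Hw) as (_ & (Ha & _) & _).
           apply (Ha v w r s); [apply HBD, Hv|exact Hw].
        -- exists B; [exact HB|]. destruct (Hgood B _ HB Hv) as (_ & (Ha & _) & _).
           apply (Ha v w r s); [exact Hv|apply HBD, Hw].
      * intros a v r Ha [B HB Hv]. exists B; [exact HB|].
        destruct (Hgood B _ HB Hv) as (_ & (_ & Hs) & _). apply (Hs a v r Ha Hv).
      * intros r [B HB Hv]. destruct (Hgood B _ HB Hv) as (_ & _ & Hz). apply Hz, Hv.
    + left. intros p [B HB Hp]. apply Hn. now exists B, p.
  - assert (Hext : forall G', good_cone G0 G' -> (forall v r, A (v, r) -> G' v r) ->
                     forall v r, G' v r -> A (v, r)).
    { intros G' HG' Hsub v r Hv. apply NNPP; intros Hn.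
      apply (Amax (fun p => G' (fst p) (snd p))).
      - split.
        + intros [w s] Hw. apply Hsub, Hw.
        + intros H. apply Hn. apply (H (v, r)), Hv.
      - right. exact HG'. }
    destruct PA as [PA|PA].
    + exfalso. apply (PA (v0, r0)). apply (Hext G0 HG0); auto.
      intros v r Hv. destruct (PA _ Hv).
    + exists (un A). split; [exact PA|]. exact Hext.
Qed.

Lemma half_line_inf (E : R -> Prop) (m : R) :
  (exists r, E r) -> (forall r, E r -> m <= r) ->
  exists a, (forall r, E r -> a <= r) /\ (forall b, (forall r, E r -> b <= r) -> b <= a).
Proof.
  intros (r0 & Hr0) Hm.
  destruct (completeness (fun t => E (- t))) as (l & Hub & Hl).
  - exists (- m). intros t Ht. specialize (Hm _ Ht). lra.
  - exists (- r0). now rewrite Ropp_involutive.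
  - exists (- l). split.
    + intros r Hr. assert (- r <= l) by (apply Hub; now rewrite Ropp_involutive). lra.
    + intros b Hb. assert (l <= - b) by (apply Hl; intros t Ht; specialize (Hb _ Ht); lra). lra.
Qed.

(* The graph of a maximal cone is that of a linear functional: were the lower
   boundary point a over v such that (-v, -a) is missing, this ray could be added. *)
Theorem hahn_banach_cone (G : X -> R -> Prop) (N : R) :
  0 <= N -> epi_cone G -> (forall v r, G v r -> - (N * norm v) <= r) ->
  exists u, is_dual X u /\ forall v r, G v r -> u v <= r.
Proof.
  intros HN (Gadd & Gscal) Glow.
  (* Infimal convolution of [G], with the origin adjoined, and N|.|. It contains the graph of N|.|,
     so there is a value over every v, and the lower bound on [G] is exactly what keeps its values
     over 0 nonnegative. *)
  pose (G0 := fun v r => exists v1 r1, ((v1 = [0] /\ r1 = 0) \/ G v1 r1) /\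
                          r1 + N * norm (v [-] v1) <= r).
  assert (G0low : forall v1 r1, (v1 = [0] /\ r1 = 0) \/ G v1 r1 -> - (N * norm v1) <= r1).
  { intros v1 r1 [[-> ->]|H]; auto. rewrite norm_zero. lra. }
  assert (HG0 : good_cone G0 G0).
  { split; [auto|split; [split|]].
    - intros v w r s (v1 & r1 & H1 & L1) (v2 & r2 & H2 & L2).
      assert (HH : N * norm ((v [+] w) [-] (v1 [+] v2)) <=
                   N * norm (v [-] v1) + N * norm (w [-] v2)).
      { rewrite <- Rmult_plus_distr_l. apply Rmult_le_compat_l; auto.
        replace ((v [+] w) [-] (v1 [+] v2)) with ((v [-] v1) [+] (w [-] v2)) by vec.
        apply vnorm_triangle. }
      exists (v1 [+] v2), (r1 + r2). split; [|lra].
      destruct H1 as [[-> ->]|H1], H2 as [[-> ->]|H2].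
      + left. rewrite vadd_0. split; auto; ring.
      + right. now rewrite vadd_0l, Rplus_0_l.
      + right. now rewrite vadd_0, Rplus_0_r.
      + right. auto.
    - intros a v r Ha (v1 & r1 & H1 & L1).
      exists (a [*] v1), (a * r1). split.
      + destruct H1 as [[-> ->]|H1]; [left|right; auto]. rewrite vscal_0r. split; auto; ring.
      + replace (a [*] v [-] a [*] v1) with (a [*] (v [-] v1)) by vec.
        rewrite norm_scal_pos by lra. nra.
    - intros r (v1 & r1 & H1 & L1). apply G0low in H1.
      replace (norm ([0] [-] v1)) with (norm v1) in L1; [lra|].
      rewrite <- norm_opp. f_equal. vec. }
  assert (G0N : forall v, G0 v (N * norm v)).
  { intros v. exists [0], 0. split; [auto|]. replace (v [-] [0]) with v by vec. lra. }
  destruct (maximal_cone G0) as (H & (Hsub & (Hadd & Hscal) & Hzero) & Hmax); auto.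
  { exists [0], (N * norm ([0] : X)). apply G0N. }
  assert (Hpair : forall v r s, H v r -> H (vopp X v) s -> 0 <= r + s).
  { intros v r s Hv Hw. apply Hzero. rewrite <- (vadd_opp X v). auto. }
  assert (HN' : forall v, H v (N * norm v)) by (intros; apply Hsub, G0N).
  assert (Hlow : forall v r, H v r -> - (N * norm v) <= r).
  { intros v r Hv. pose proof (Hpair v r _ Hv (HN' _)) as E. rewrite norm_opp in E. lra. }
  assert (Hval : forall v, exists a, ((forall r, H v r -> a <= r) /\
      (forall b, (forall r, H v r -> b <= r) -> b <= a)) /\ H (vopp X v) (- a)).
  { intros v.
    destruct (half_line_inf (H v) (- (N * norm v))) as (a & Ha & Hinf).
    { eexists; apply HN'. }
    { apply Hlow. }
    exists a. split; [split; [exact Ha|exact Hinf]|].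
    pose (H' := fun w r => exists w1 r1 l, H w1 r1 /\ 0 <= l /\
                   w = w1 [-] l [*] v /\ r = r1 - l * a).
    apply (Hmax H').
    - split; [|split; [split|]].
      + intros w r Hw. exists w, r, 0. repeat split; auto; try lra. vec.
      + intros w1 w2 r1 r2 (x1 & s1 & l1 & K1 & L1 & -> & ->) (x2 & s2 & l2 & K2 & L2 & -> & ->).
        exists (x1 [+] x2), (s1 + s2), (l1 + l2). repeat split; auto; try lra; try ring. vec.
      + intros c w r Hc (x1 & s1 & l1 & K1 & L1 & -> & ->).
        exists (c [*] x1), (c * s1), (c * l1). repeat split; auto; try nra. vec.
      + intros r (x1 & s1 & l & K1 & L1 & E & ->).
        assert (Ex : x1 = l [*] v).
        { replace x1 with ((x1 [-] l [*] v) [+] l [*] v) by vec. rewrite <- E. vec. }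
        subst x1. destruct (Req_dec l 0) as [->|Hl].
        * rewrite vscal_0l in K1. apply Hzero in K1. lra.
        * assert (0 < l) by lra.
          assert (Hi : 0 < / l) by now apply Rinv_0_lt_compat.
          pose proof (Hscal (/ l) _ _ Hi K1) as K2. rewrite vscal_assoc, Rinv_l, vscal_1 in K2 by auto.
          apply Ha in K2. apply (Rmult_le_compat_l l) in K2; [|lra].
          rewrite <- Rmult_assoc, Rinv_r in K2 by auto. lra.
    - intros w r Hw. exists w, r, 0. repeat split; auto; try lra. vec.
    - exists [0], 0, 1. repeat split; try lra; [|vec].
      apply Hsub. exists [0], 0. split; [auto|]. rewrite norm_sub_diag. lra. }
  assert (Hu : exists u : X -> R, forall v, ((forall r, H v r -> u v <= r) /\
      (forall b, (forall r, H v r -> b <= r) -> b <= u v)) /\ H (vopp X v) (- u v)).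
  { exists (fun v => proj1_sig (constructive_indefinite_description _ (Hval v))).
    intros v. exact (proj2_sig (constructive_indefinite_description _ (Hval v))). }
  destruct Hu as (u & Hu).
  assert (Hge : forall v r, H (vopp X v) (- r) -> r <= u v).
  { intros v r Hr. apply (Hu v). intros s Hs. pose proof (Hpair _ _ _ Hs Hr). lra. }
  assert (Hopp : forall v, u (vopp X v) = - u v).
  { intros v. destruct (Hu v) as ((Hu1 & _) & Hu2).
    pose proof (proj1 (proj1 (Hu (vopp X v))) _ Hu2).
    assert (- u v <= u (vopp X v)); [|lra].
    apply (Hu (vopp X v)). intros t Ht. pose proof (Hge v (- t)) as E.
    rewrite Ropp_involutive in E. specialize (E Ht). lra. }
  assert (Hself : forall v, H v (u v)).
  { intros v. destruct (Hu (vopp X v)) as (_ & E).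
    replace (vopp X (vopp X v)) with v in E by vec. rewrite Hopp in E.
    now rewrite Ropp_involutive in E. }
  assert (Hadd' : forall v w, u (v [+] w) = u v + u w).
  { intros v w. apply Rle_antisym.
    - apply (Hu (v [+] w)). apply Hadd; apply Hself.
    - apply Hge. replace (vopp X (v [+] w)) with (vopp X v [+] vopp X w) by vec.
      replace (- (u v + u w)) with (- u v + - u w) by ring. apply Hadd; apply Hu. }
  assert (Hpos : forall a v, 0 < a -> u (a [*] v) = a * u v).
  { intros a v Ha. apply Rle_antisym.
    - apply (Hu (a [*] v)). apply Hscal; auto.
    - apply Hge. replace (vopp X (a [*] v)) with (a [*] vopp X v) by vec.
      replace (- (a * u v)) with (a * - u v) by ring. apply Hscal; auto. apply Hu. }
  assert (Hz : u [0] = 0).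
  { pose proof (Hadd' [0] [0]) as E. rewrite vadd_0 in E. lra. }
  exists u. split.
  - apply (linear_bound X u N); auto.
    + intros a v. destruct (Rtotal_order a 0) as [Ha|[->|Ha]]; auto.
      * replace (a [*] v) with (vopp X ((- a) [*] v)) by vec.
        rewrite Hopp, Hpos by lra. ring.
      * rewrite vscal_0l, Hz. ring.
    + intros v. apply (Hu v), HN'.
  - intros v r Hv. apply (Hu v), Hsub. exists v, r. split; [auto|]. rewrite norm_sub_diag. lra.
Qed.

(** Hahn-Banach for the function l e |-> l on the line through e: as both e and -e lie on that line,
    the two inequalities force f(e) = 1. *)
Lemma dual_norming (e : X) : e <> [0] -> exists f, is_dual X f /\ f e = 1.
Proof.
  intros He.
  assert (Hn : 0 < norm e).
  { destruct (vnorm_nonneg X e) as [H|H]; auto. destruct He. now apply vnorm_eq0. }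
  assert (Hi : 0 < / norm e) by now apply Rinv_0_lt_compat.
  destruct (hahn_banach_cone (fun v r => exists l, v = l [*] e /\ l <= r) (/ norm e))
    as (f & Hf & Hle).
  - lra.
  - split.
    + intros v w r s (l & -> & Hl) (m & -> & Hm). exists (l + m). split; [vec|lra].
    + intros a v r Ha (l & -> & Hl). exists (a * l). split; [vec|nra].
  - intros v r (l & -> & Hl). rewrite vnorm_scal.
    replace (/ norm e * (Rabs l * norm e)) with (Rabs l) by (field; lra).
    pose proof (Rle_abs (- l)) as E. rewrite Rabs_Ropp in E. lra.
  - exists f. split; auto.
    assert (f e <= 1) by (apply Hle; exists 1; split; [vec|lra]).
    assert (E : f ((-1) [*] e) <= -1) by (apply Hle; exists (-1); split; [vec|lra]).
    dsimp in E. lra.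
Qed.
End HahnBanach.

(** * Convex sets and normal cones *)

Section Convex.
Variable X : Banach.

Lemma bclosed_sublevel (g : X -> R) (L : R) :
  0 <= L -> (forall z z', g z <= g z' + L * norm (z [-] z')) -> bclosed X (fun z => g z <= 0).
Proof.
  intros HL Hg x Hx. apply Rnot_lt_le. intros Hpos.
  assert (He : 0 < g x / (L + 1)) by (apply Rdiv_lt_0_compat; lra).
  destruct (Hx _ He) as (a & Ha & Hd). specialize (Hg x a). rewrite norm_sub_sym in Hg.
  assert (E : L * norm (a [-] x) <= L * (g x / (L + 1))) by (apply Rmult_le_compat_l; lra).
  assert (E2 : L * (g x / (L + 1)) = g x - g x / (L + 1)) by (field; lra).
  lra.
Qed.

Lemma bclosed_and (A B : X -> Prop) :
  bclosed X A -> bclosed X B -> bclosed X (fun z => A z /\ B z).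
Proof.
  intros HA HB x Hx. split.
  - apply HA. intros e He. destruct (Hx e He) as (a & [Ha _] & Hd). eauto.
  - apply HB. intros e He. destruct (Hx e He) as (a & [_ Ha] & Hd). eauto.
Qed.

Lemma bconvex_and (A B : X -> Prop) :
  bconvex X A -> bconvex X B -> bconvex X (fun z => A z /\ B z).
Proof. intros HA HB x y t [Hx1 Hx2] [Hy1 Hy2] Ht. split; auto. Qed.

Lemma bclosure_subset (A : X -> Prop) (x : X) : A x -> bclosure X A x.
Proof. intros H e He. exists x. rewrite norm_sub_diag. auto. Qed.

Lemma bclosure_closed (A : X -> Prop) : bclosed X (bclosure X A).
Proof.
  intros x Hx e He. destruct (Hx (e / 2)) as (a & Ha & Hd); [lra|].
  destruct (Ha (e / 2)) as (b & Hb & Hd'); [lra|]. exists b. split; auto.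
  pose proof (norm_sub_triangle X b a x). lra.
Qed.

Lemma convex_cone_add (A : X -> Prop) (z k k' : X) (a b : R) :
  bconvex X A -> A k -> A k' -> 0 <= a -> 0 <= b ->
  exists k2, A k2 /\ a [*] (k [-] z) [+] b [*] (k' [-] z) = (a + b) [*] (k2 [-] z).
Proof.
  intros HA Hk Hk' Ha Hb. destruct (Req_dec (a + b) 0) as [E|E].
  - exists k. split; auto. replace a with 0 by lra. replace b with 0 by lra. vec.
  - exists ((1 - b / (a + b)) [*] k [+] (b / (a + b)) [*] k'). split.
    + apply HA; auto. split.
      * apply Rmult_le_pos; auto. left. apply Rinv_0_lt_compat. lra.
      * apply (Rmult_le_reg_r (a + b)); [lra|]. unfold Rdiv.
        rewrite Rmult_assoc, Rinv_l by auto. lra.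
    + vecf.
Qed.

(** Sum rule for normal cones under the qualification that x0 lies in C and in the interior of K. A
    linear minorant u of the cone [G], which assigns -n(a(k - z)) to a(k - z) - b(c - z), satisfies
    u <= -n on K - z and u >= 0 on C - z; hence -u is normal to C and n + u is normal to K. *)
Lemma normal_cone_split (C K : X -> Prop) (x0 z : X) (n : X -> R) :
  bconvex X C -> bconvex X K -> C x0 -> binterior X K x0 ->
  normal_cone X (fun v => C v /\ K v) z n ->
  exists m, normal_cone X C z m /\ normal_cone X K z (fun v => n v - m v).
Proof.
  intros HC HK HCx0 (rho & Hrho & Hball) ((Cz & Kz) & Hn & Hnc).
  assert (Kx0 : K x0) by (apply Hball; unfold bball; rewrite norm_sub_diag; lra).
  destruct (dual_bound X n Hn) as (Bn & HBn & Hbn).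
  (* A direction that points from z into both C and K: after scaling by 1/(1 + a + b) its endpoint
     lies in both sets, where n is known to be nonpositive. *)
  assert (Hkey : forall a b k c, 0 <= a -> 0 <= b -> K k -> C c ->
            a [*] (k [-] z) = b [*] (c [-] z) -> n (a [*] (k [-] z)) <= 0).
  { intros a b k c Ha Hb Hk Hc E.
    assert (Hg : 0 < / (1 + a + b)) by (apply Rinv_0_lt_compat; lra).
    set (g := / (1 + a + b)) in *.
    assert (Hga : 0 <= g * a <= 1).
    { split; [nra|]. apply (Rmult_le_reg_l (1 + a + b)); [lra|].
      rewrite <- Rmult_assoc. unfold g. rewrite Rinv_r; lra. }
    assert (Hgb : 0 <= g * b <= 1).
    { split; [nra|]. apply (Rmult_le_reg_l (1 + a + b)); [lra|].
      rewrite <- Rmult_assoc. unfold g. rewrite Rinv_r; lra. }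
    assert (Hp : n ((z [+] g [*] (a [*] (k [-] z))) [-] z) <= 0).
    { apply Hnc. split.
      - rewrite E. replace (z [+] g [*] (b [*] (c [-] z)))
          with ((1 - g * b) [*] z [+] (g * b) [*] c) by vec. apply HC; auto.
      - replace (z [+] g [*] (a [*] (k [-] z)))
          with ((1 - g * a) [*] z [+] (g * a) [*] k) by vec. apply HK; auto. }
    replace ((z [+] g [*] (a [*] (k [-] z))) [-] z) with (g [*] (a [*] (k [-] z))) in Hp by vec.
    rewrite (dual_scal X n g) in Hp by auto. apply (Rmult_le_reg_l g); lra. }
  pose (G := fun v r => exists a b k c, 0 <= a /\ 0 <= b /\ K k /\ C c /\
               v = a [*] (k [-] z) [-] b [*] (c [-] z) /\ - n (a [*] (k [-] z)) <= r).
  destruct (hahn_banach_cone X G (2 / rho * (Bn * (norm (x0 [-] z) + rho)))) as (u & Hu & HuG).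
  - apply Rmult_le_pos; [apply Rlt_le, Rdiv_lt_0_compat; lra|].
    pose proof (vnorm_nonneg X (x0 [-] z)). apply Rmult_le_pos; lra.
  - split.
    + intros v w r s (a & b & k & c & Ha & Hb & Hk & Hc & -> & Hr)
        (a' & b' & k' & c' & Ha' & Hb' & Hk' & Hc' & -> & Hs).
      destruct (convex_cone_add K z k k' a a') as (k2 & Hk2 & E2); auto.
      destruct (convex_cone_add C z c c' b b') as (c2 & Hc2 & E3); auto.
      exists (a + a'), (b + b'), k2, c2. repeat split; auto; try lra.
      * rewrite <- E2, <- E3. vec.
      * rewrite <- E2, (dual_add X n) by auto. lra.
    + intros t v r Ht (a & b & k & c & Ha & Hb & Hk & Hc & -> & Hr).
      exists (t * a), (t * b), k, c. repeat split; auto; try nra.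
      * vec.
      * replace ((t * a) [*] (k [-] z)) with (t [*] (a [*] (k [-] z))) by vec.
        rewrite (dual_scal X n t) by auto. nra.
  - intros v r (a & b & k & c & Ha & Hb & Hk & Hc & Ev & Hr).
    pose proof (vnorm_nonneg X v) as Hnv.
    (* The vector v is cancelled by q(k' - x0) = -v with k' in the ball of K around x0, and x0 in C
       compensates for the shift. [Hkey] then applies, and the price is q times a bound for |n(k' -
       z)|, which is the constant passed to Hahn-Banach. *)
    set (q := 2 / rho * norm v).
    assert (Hq : 0 <= q).
    { apply Rmult_le_pos; auto. apply Rlt_le, Rdiv_lt_0_compat; lra. }
    assert (Hk' : exists k', K k' /\ q [*] (k' [-] x0) = vopp X v /\ norm (k' [-] x0) <= rho).
    { destruct (Req_dec (norm v) 0) as [E|E].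
      - apply vnorm_eq0 in E. exists x0. split; auto. split; [|rewrite norm_sub_diag; lra].
        unfold q. rewrite E, norm_zero. vec.
      - assert (Eq : / q = rho / 2 / norm v) by (unfold q; field; lra).
        assert (Hq' : 0 < q).
        { unfold q. apply Rmult_lt_0_compat; [apply Rdiv_lt_0_compat|]; lra. }
        assert (Enorm : norm ((x0 [-] / q [*] v) [-] x0) = rho / 2).
        { replace ((x0 [-] / q [*] v) [-] x0) with (vopp X (/ q [*] v)) by vec.
          rewrite norm_opp, norm_scal_pos by (apply Rlt_le, Rinv_0_lt_compat; auto).
          rewrite Eq. field. auto. }
        exists (x0 [-] / q [*] v). split; [|split].
        + apply Hball. unfold bball. lra.
        + vecf; lra.
        + lra. }
    destruct Hk' as (k' & HKk' & Ek' & Nk').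
    destruct (convex_cone_add K z k k' a q) as (k2 & Hk2 & E2); auto.
    destruct (convex_cone_add C z c x0 b q) as (c2 & Hc2 & E3); auto.
    assert (E4 : (a + q) [*] (k2 [-] z) = (b + q) [*] (c2 [-] z)).
    { rewrite <- E2, <- E3.
      replace (q [*] (k' [-] z)) with (q [*] (k' [-] x0) [+] q [*] (x0 [-] z)) by vec.
      rewrite Ek', Ev. vec. }
    pose proof (Hkey (a + q) (b + q) k2 c2 ltac:(lra) ltac:(lra) Hk2 Hc2 E4) as Hle.
    rewrite <- E2, (dual_add X n), (dual_scal X n q) in Hle by auto.
    assert (Hb' : n (k' [-] z) >= - (Bn * (norm (x0 [-] z) + rho))).
    { pose proof (Hbn (k' [-] z)) as E5.
      assert (norm (k' [-] z) <= norm (x0 [-] z) + rho).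
      { pose proof (norm_sub_triangle X k' x0 z). lra. }
      assert (Bn * norm (k' [-] z) <= Bn * (norm (x0 [-] z) + rho))
        by (apply Rmult_le_compat_l; auto).
      pose proof (Rle_abs (- n (k' [-] z))) as E6. rewrite Rabs_Ropp in E6. lra. }
    assert (q * n (k' [-] z) >= q * - (Bn * (norm (x0 [-] z) + rho))) by nra.
    replace (2 / rho * (Bn * (norm (x0 [-] z) + rho)) * norm v)
      with (q * (Bn * (norm (x0 [-] z) + rho))) by (unfold q; ring).
    lra.
  - exists (fun v => - u v). split.
    + split; [auto|split].
      * apply (is_dual_ext X (fun v => -1 * u v + 0 * u v)); [intros; ring|].
        apply is_dual_comb; auto.
      * intros c Hc.
        assert (E : u ((-1) [*] (c [-] z)) <= 0).
        { apply HuG. exists 0, 1, x0, c. repeat split; auto; try lra; [vec|].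
          rewrite (dual_scal X n) by auto. lra. }
        rewrite (dual_scal X u) in E by auto. lra.
    + split; [auto|split].
      * apply (is_dual_ext X (fun v => 1 * n v + 1 * u v)); [intros; ring|].
        apply is_dual_comb; auto.
      * intros k Hk.
        assert (E : u (k [-] z) <= - n (k [-] z)).
        { apply HuG. exists 1, 0, k, x0. repeat split; auto; try lra; [vec|].
          rewrite (dual_scal X n) by auto. lra. }
        lra.
Qed.

(** The common consequence of the two maximality notions on which the rest of the proof runs. *)
Definition restriction_maximal (T : operator X) (C : X -> Prop) (x0 : X) : Prop :=
  forall K, bclosed X K -> bconvex X K -> binterior X K x0 ->
    maximal_monotone X (op_add X T (normal_cone X (fun z => C z /\ K z))).

(* A closed convex K with x0 in its interior and apex y0: around x0 - y0 it is the cone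
   |v - f(v)(x0 - y0)| <= d f(v).  On K a large multiple of -f dominates R|z - y0|, so
   (y0, q - N f) is monotonically related to T + N_(C /\ K). *)
Lemma domain_criterion (T : operator X) (C : X -> Prop) (x0 y0 : X) (q : X -> R) (rad delta : R) :
  bconvex X C -> restriction_maximal T C x0 -> dom X T x0 -> C x0 ->
  is_dual X q -> 0 <= rad -> 0 < delta ->
  (forall z t, T z t -> C z -> Kset X y0 (bball X x0 delta) z ->
     - (rad * norm (z [-] y0)) <= t (z [-] y0) - q (z [-] y0)) ->
  (forall z n, dom X T z -> normal_cone X C z n -> 0 <= n (z [-] y0)) ->
  dom X T y0 /\ C y0.
Proof.
  intros HC Hmax HTx0 HCx0 Hq Hrad Hdel Hest Hnor.
  destruct (classic (x0 [-] y0 = [0])) as [E|E].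
  { replace y0 with x0; auto. apply norm_sub_eq0. rewrite E. apply norm_zero. }
  destruct (dual_norming X _ E) as (f & Hf & Hf1).
  set (e := x0 [-] y0) in *.
  destruct (dual_bound X f Hf) as (B & HB & Hfb).
  pose proof (vnorm_nonneg X e) as Hne.
  (* d is the aperture of the cone and eta its overshoot beyond the level of x0. Points of level t
     <= 1 are then on segments from y0 to the d-ball around x0, and points of level between 1 and 1
     + eta are within 2d + eta|e| <= 3d < delta of x0. *)
  set (d := delta / 4). set (eta := Rmin 1 (delta / (4 * (norm e + 1)))).
  assert (Heta : 0 < eta <= 1 /\ eta * norm e <= d).
  { assert (0 < delta / (4 * (norm e + 1))) by (apply Rdiv_lt_0_compat; lra).
    pose proof (Rmin_l 1 (delta / (4 * (norm e + 1)))).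
    pose proof (Rmin_r 1 (delta / (4 * (norm e + 1)))).
    assert (0 < eta) by (unfold eta; apply Rmin_glb_lt; lra).
    fold eta in H0, H1. repeat split; auto.
    apply Rle_trans with (delta / (4 * (norm e + 1)) * (norm e + 1)); [nra|].
    right. unfold d. field. lra. }
  destruct Heta as ((Heta0 & Heta1) & Heta2).
  assert (Hd : 0 < d) by (unfold d; lra).
  pose (g := fun z => norm ((z [-] y0) [-] f (z [-] y0) [*] e) - d * f (z [-] y0)).
  (* The truncation keeps the cone inside the [Kset]; since f(x0 - y0) = 1 lies strictly below 1 +
     eta, x0 stays interior. *)
  pose (K := fun z => g z <= 0 /\ f (z [-] y0) - (1 + eta) <= 0).
  assert (Hfl : forall z z', Rabs (f (z [-] z')) <= B * norm (z [-] z')) by (intros; apply Hfb).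
  assert (Kcl : bclosed X K).
  { apply bclosed_and.
    - apply (bclosed_sublevel _ (1 + B * norm e + d * B)).
      { assert (0 <= B * norm e) by (apply Rmult_le_pos; auto).
        assert (0 <= d * B) by (apply Rmult_le_pos; lra). lra. }
      intros z z'. unfold g.
      replace ((z [-] y0) [-] f (z [-] y0) [*] e) with
        (((z' [-] y0) [-] f (z' [-] y0) [*] e) [+] ((z [-] z') [-] f (z [-] z') [*] e))
        by (dsimp; vec).
      replace (f (z [-] y0)) with (f (z' [-] y0) + f (z [-] z')) by (dsimp; ring).
      pose proof (vnorm_triangle X ((z' [-] y0) [-] f (z' [-] y0) [*] e)
                    ((z [-] z') [-] f (z [-] z') [*] e)).
      pose proof (norm_sub_le X (z [-] z') (f (z [-] z') [*] e)) as H1.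
      rewrite vnorm_scal in H1. specialize (Hfl z z').
      assert (Rabs (f (z [-] z')) * norm e <= B * norm (z [-] z') * norm e)
        by (apply Rmult_le_compat_r; auto).
      pose proof (Rle_abs (- f (z [-] z'))) as H3. rewrite Rabs_Ropp in H3.
      assert (d * - f (z [-] z') <= d * (B * norm (z [-] z')))
        by (apply Rmult_le_compat_l; lra).
      lra.
    - apply (bclosed_sublevel (fun z => f (z [-] y0) - (1 + eta)) B); auto.
      intros z z'. specialize (Hfl z z'). pose proof (Rle_abs (f (z [-] z'))).
      replace (f (z [-] y0)) with (f (z' [-] y0) + f (z [-] z')) by (dsimp; ring). lra. }
  assert (Kcv : bconvex X K).
  { intros z z' t [Hz1 Hz2] [Hz3 Hz4] Ht.
    assert (Ef : f (((1 - t) [*] z [+] t [*] z') [-] y0) =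
                 (1 - t) * f (z [-] y0) + t * f (z' [-] y0)) by (dsimp; ring).
    split.
    - unfold g in *. rewrite Ef.
      replace ((((1 - t) [*] z [+] t [*] z') [-] y0) [-]
                 ((1 - t) * f (z [-] y0) + t * f (z' [-] y0)) [*] e) with
        ((1 - t) [*] ((z [-] y0) [-] f (z [-] y0) [*] e) [+]
           t [*] ((z' [-] y0) [-] f (z' [-] y0) [*] e)) by vec.
      pose proof (vnorm_triangle X ((1 - t) [*] ((z [-] y0) [-] f (z [-] y0) [*] e))
           (t [*] ((z' [-] y0) [-] f (z' [-] y0) [*] e))) as H1.
      rewrite !norm_scal_pos in H1 by lra. nra.
    - rewrite Ef. nra. }
  assert (Kint : binterior X K x0).
  { set (L := 1 + B * norm e + B).
    assert (HBe : 0 <= B * norm e) by (apply Rmult_le_pos; auto).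
    assert (HL : 1 <= L) by (unfold L; lra).
    set (r0 := Rmin (d / 2) (Rmin (1 / 2) eta)).
    assert (Hr0 : 0 < r0) by (unfold r0; apply Rmin_glb_lt; [|apply Rmin_glb_lt]; lra).
    assert (Hr1 : r0 <= d / 2) by apply Rmin_l.
    assert (Hr2 : r0 <= 1 / 2) by (eapply Rle_trans; [apply Rmin_r|apply Rmin_l]).
    assert (Hr3 : r0 <= eta) by (eapply Rle_trans; [apply Rmin_r|apply Rmin_r]).
    exists (r0 / L). split; [apply Rdiv_lt_0_compat; lra|].
    intros z Hz. unfold bball in Hz.
    assert (Hz' : L * norm (z [-] x0) < r0).
    { apply (Rmult_lt_compat_l L) in Hz; [|lra].
      replace (L * (r0 / L)) with r0 in Hz by (field; lra). lra. }
    pose proof (vnorm_nonneg X (z [-] x0)) as Hnz.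
    assert (E1 : f (z [-] y0) = 1 + f (z [-] x0)).
    { rewrite <- Hf1. unfold e. dsimp. ring. }
    specialize (Hfl z x0).
    assert (B * norm (z [-] x0) <= L * norm (z [-] x0))
      by (apply Rmult_le_compat_r; unfold L; lra).
    pose proof (Rle_abs (f (z [-] x0))).
    pose proof (Rle_abs (- f (z [-] x0))) as H3. rewrite Rabs_Ropp in H3.
    split; [|lra].
    unfold g. rewrite E1.
    replace ((z [-] y0) [-] (1 + f (z [-] x0)) [*] e) with
      ((z [-] x0) [-] f (z [-] x0) [*] e) by (unfold e; vec).
    pose proof (norm_sub_le X (z [-] x0) (f (z [-] x0) [*] e)) as H4. rewrite vnorm_scal in H4.
    assert (Rabs (f (z [-] x0)) * norm e <= B * norm (z [-] x0) * norm e)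
      by (apply Rmult_le_compat_r; auto).
    assert ((1 + B * norm e) * norm (z [-] x0) <= L * norm (z [-] x0))
      by (apply Rmult_le_compat_r; unfold L; lra).
    assert (d * (1 / 2) <= d * (1 + f (z [-] x0))) by (apply Rmult_le_compat_l; lra).
    lra. }
  assert (Ky0 : K y0).
  { split.
    - unfold g. rewrite sub_diag. dsimp.
      replace ([0] [-] 0 [*] e) with ([0] : X) by vec. rewrite norm_zero. lra.
    - rewrite sub_diag. dsimp. lra. }
  assert (Kf : forall z, K z -> 0 <= f (z [-] y0) /\
                 norm (z [-] y0) <= (norm e + d) * f (z [-] y0)).
  { intros z [Hz1 Hz2]. unfold g in Hz1.
    pose proof (vnorm_nonneg X ((z [-] y0) [-] f (z [-] y0) [*] e)) as H1.
    assert (H2 : 0 <= f (z [-] y0)) by nra. split; auto.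
    pose proof (vnorm_triangle X ((z [-] y0) [-] f (z [-] y0) [*] e) (f (z [-] y0) [*] e)) as H3.
    rewrite norm_scal_pos in H3 by auto.
    replace (((z [-] y0) [-] f (z [-] y0) [*] e) [+] f (z [-] y0) [*] e) with (z [-] y0)
      in H3 by vec. lra. }
  assert (KK : forall z, K z -> Kset X y0 (bball X x0 delta) z).
  { intros z Kz. destruct (Kf z Kz) as (Ht & Hn). destruct Kz as [Hz1 Hz2].
    unfold g in Hz1. set (t := f (z [-] y0)) in *.
    destruct (Rle_lt_dec t 1) as [H1|H1].
    - destruct (Req_dec t 0) as [E0|E0].
      + rewrite E0, Rmult_0_r in Hn.
        assert (Ez : z = y0).
        { apply norm_sub_eq0. pose proof (vnorm_nonneg X (z [-] y0)). lra. }
        exists 0, x0. split; [lra|]. split; [unfold bball; rewrite norm_sub_diag; auto|].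
        rewrite Ez. vec.
      + assert (Ht0 : 0 < t) by lra.
        exists t, (x0 [+] / t [*] ((z [-] y0) [-] t [*] e)). split; [lra|]. split.
        * unfold bball.
          replace ((x0 [+] / t [*] ((z [-] y0) [-] t [*] e)) [-] x0)
            with (/ t [*] ((z [-] y0) [-] t [*] e)) by vec.
          rewrite norm_scal_pos by (left; now apply Rinv_0_lt_compat).
          apply Rle_lt_trans with (/ t * (d * t)).
          -- apply Rmult_le_compat_l; [left; now apply Rinv_0_lt_compat|lra].
          -- replace (/ t * (d * t)) with d by (field; lra). unfold d. lra.
        * unfold e. vecf.
    - exists 1, z. split; [lra|]. split; [|vec].
      unfold bball.
      replace (z [-] x0) with (((z [-] y0) [-] t [*] e) [+] (t - 1) [*] e) by (unfold e; vec).
      pose proof (vnorm_triangle X ((z [-] y0) [-] t [*] e) ((t - 1) [*] e)) as H2.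
      rewrite (norm_scal_pos X (t - 1)) in H2 by lra.
      assert ((t - 1) * norm e <= eta * norm e) by (apply Rmult_le_compat_r; lra).
      assert (d * t <= d * 2) by (apply Rmult_le_compat_l; lra).
      unfold d in *. lra. }
  set (N := rad * (norm e + d)).
  assert (HN : 0 <= N) by (apply Rmult_le_pos; lra).
  destruct (Hmax K Kcl Kcv Kint) as (_ & Hmx).
  destruct (Hmx y0 (fun v => 1 * q v + (- N) * f v)) as (t & n & Ht & (Cy & _) & _).
  - apply is_dual_comb; auto.
  - intros z h (t & n & Ht & Hn & Eh).
    (* Both parts of n are nonnegative on z - y0: the K-part because y0 lies in K, the C-part by
       hypothesis. So n may be dropped from the estimate. *)
    destruct (normal_cone_split C K x0 z n HC Kcv HCx0 Kint Hn) as (m & Hm & (Kz & Hk & Hkk)).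
    specialize (Hkk y0 Ky0).
    assert (Tz : dom X T z) by now exists t.
    pose proof (Hnor z m Tz Hm) as Hm0.
    pose proof (Hest z t Ht (proj1 Hm) (KK z Kz)) as Ht0.
    destruct (Kf z Kz) as (Hf0 & Hf2).
    apply (Rmult_le_compat_l rad) in Hf2; auto.
    rewrite Eh.
    assert (Et : forall p : X -> R, is_dual X p -> p (y0 [-] z) = - p (z [-] y0))
      by (intros; dsimp; ring).
    destruct Hm as (_ & Hm & _).
    assert (Htd : t (y0 [-] z) = - t (z [-] y0)).
    { destruct (Hmax K Kcl Kcv Kint) as ((Hd1 & _) & _).
      assert (Hh : is_dual X h) by (apply (Hd1 z); exists t, n; auto).
      assert (Hnd : is_dual X n) by apply Hn.
      pose proof (Et h Hh) as E1. pose proof (Et n Hnd). rewrite !Eh in E1. lra. }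
    destruct Hn as (_ & Hn & _).
    rewrite Htd, (Et q), (Et f), (Et n) by auto.
    rewrite (Et n), (Et m) in Hkk by auto. unfold N. lra.
  - split; [now exists t|apply Cy].
Qed.
End Convex.

(** * Completeness and the Baire category theorem *)

Lemma dependent_choice (A : Type) (Inv : A -> Prop) (Rel : nat -> A -> A -> Prop) (a0 : A) :
  Inv a0 -> (forall k a, Inv a -> exists b, Inv b /\ Rel k a b) ->
  exists f, f O = a0 /\ forall k, Inv (f k) /\ Rel k (f k) (f (S k)).
Proof.
  intros H0 Hstep.
  pose (next := fun k (a : {a | Inv a}) =>
    constructive_indefinite_description _ (Hstep k (proj1_sig a) (proj2_sig a))).
  pose (g := fix g k : {a | Inv a} :=
    match k with
    | O => exist _ a0 H0
    | S k => exist _ (proj1_sig (next k (g k))) (proj1 (proj2_sig (next k (g k))))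
    end).
  exists (fun k => proj1_sig (g k)). split; [reflexivity|].
  intros k. split; [apply (proj2_sig (g k))|].
  exact (proj2 (proj2_sig (next k (g k)))).
Qed.

Lemma half_pow_pos (n : nat) : 0 < (1 / 2) ^ n.
Proof. apply pow_lt. lra. Qed.

Lemma half_pow_small (e : R) : 0 < e -> exists n, (1 / 2) ^ n < e.
Proof.
  intros He. destruct (pow_lt_1_zero (1 / 2)) with (y := e) as (N & HN); auto.
  { rewrite Rabs_pos_eq; lra. }
  exists N. specialize (HN N (Nat.le_refl N)).
  rewrite Rabs_pos_eq in HN; auto. left. apply half_pow_pos.
Qed.

Lemma half_pow_antitone (m n : nat) : (n <= m)%nat -> (1 / 2) ^ m <= (1 / 2) ^ n.
Proof.
  induction 1 as [|m Hm IH]; [lra|]. simpl. pose proof (half_pow_pos m). lra.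
Qed.

(** Makes the geometric convergence criterion available for real series. It is closed transparently
    so that carrier, addition and norm reduce to those of the reals. *)
Definition R_banach : Banach.
Proof.
  refine {| car := R; vadd := Rplus; vopp := Ropp; vzero := 0; vscal := Rmult; vnorm := Rabs |};
    try (intros; ring).
  - apply Rabs_pos.
  - intros x Hx. apply NNPP. intros H. now apply Rabs_no_R0 in H.
  - intros. apply Rabs_mult.
  - apply Rabs_triang.
  - intros u Hu. destruct (R_complete u) as (l & Hl).
    + intros e He. destruct (Hu e He) as (N & HN). exists N. intros. apply HN; auto.
    + exists l. exact Hl.
Defined.

Section Convergence.
Variable X : Banach.

Definition cvg (u : nat -> X) (l : X) : Prop :=
  forall eps, eps > 0 -> exists N, forall n, (n >= N)%nat -> norm (u n [-] l) < eps.

Lemma geometric_dist (u : nat -> X) (K : R) :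
  (forall n, norm (u (S n) [-] u n) <= K * (1 / 2) ^ n) ->
  forall n m, (n <= m)%nat -> norm (u m [-] u n) <= 2 * K * (1 / 2) ^ n - 2 * K * (1 / 2) ^ m.
Proof.
  intros H n m Hm. induction Hm as [|m Hm IH].
  - rewrite norm_sub_diag. lra.
  - pose proof (norm_sub_triangle X (u (S m)) (u m) (u n)). specialize (H m). simpl. lra.
Qed.

Lemma geometric_cvg (u : nat -> X) (K : R) :
  (forall n, norm (u (S n) [-] u n) <= K * (1 / 2) ^ n) -> exists l, cvg u l.
Proof.
  intros H.
  assert (HK : 0 <= K).
  { specialize (H O). simpl in H. pose proof (vnorm_nonneg X (u 1%nat [-] u O)). lra. }
  destruct (vcomplete X u) as (l & Hl).
  - intros e He.
    destruct (half_pow_small (e / (2 * (2 * K + 1)))) as (N & HN).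
    { apply Rdiv_lt_0_compat; lra. }
    assert (HN' : 2 * K * (1 / 2) ^ N < e / 2).
    { apply Rle_lt_trans with ((2 * K + 1) * (1 / 2) ^ N).
      - pose proof (half_pow_pos N). lra.
      - apply (Rmult_lt_compat_l (2 * K + 1)) in HN; [|lra].
        replace ((2 * K + 1) * (e / (2 * (2 * K + 1)))) with (e / 2) in HN by (field; lra).
        exact HN. }
    exists N. intros m n Hm Hn.
    pose proof (geometric_dist u K H N m Hm) as H1.
    pose proof (geometric_dist u K H N n Hn) as H2.
    assert (0 <= 2 * K * (1 / 2) ^ m) by (pose proof (half_pow_pos m); nra).
    assert (0 <= 2 * K * (1 / 2) ^ n) by (pose proof (half_pow_pos n); nra).
    rewrite norm_sub_sym in H2.
    pose proof (norm_sub_triangle X (u m) (u N) (u n)).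
    change (vadd X (u m) (vopp X (u n))) with (u m [-] u n). lra.
  - exists l. exact Hl.
Qed.

Lemma cvg_norm_le (u : nat -> X) (l v : X) (r : R) (n : nat) :
  cvg u l -> (forall m, (n <= m)%nat -> norm (u m [-] v) <= r) -> norm (l [-] v) <= r.
Proof.
  intros Hu Hr. apply Rnot_lt_le. intros Hlt.
  destruct (Hu (norm (l [-] v) - r)) as (N & HN); [lra|].
  specialize (HN (max N n) (Nat.le_max_l _ _)). specialize (Hr (max N n) (Nat.le_max_r _ _)).
  rewrite norm_sub_sym in HN. pose proof (norm_sub_triangle X l (u (max N n)) v). lra.
Qed.

Lemma cvg_closed (A : X -> Prop) (u : nat -> X) (l : X) :
  bclosed X A -> cvg u l -> (forall n, A (u n)) -> A l.
Proof.
  intros HA Hu Hn. apply HA. intros e He. destruct (Hu e He) as (N & HN).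
  exists (u N). split; auto.
Qed.

Lemma cvg_dual_le (f : X -> R) (u : nat -> X) (l : X) (a : R) (n : nat) :
  is_dual X f -> cvg u l -> (forall m, (n <= m)%nat -> f (u m) <= a) -> f l <= a.
Proof.
  intros Hf Hu Ha. destruct (dual_bound X f Hf) as (B & HB & Hb).
  apply Rnot_lt_le. intros Hlt.
  destruct (Hu ((f l - a) / (B + 1))) as (N & HN); [apply Rdiv_lt_0_compat; lra|].
  specialize (HN (max N n) (Nat.le_max_l _ _)). specialize (Ha (max N n) (Nat.le_max_r _ _)).
  specialize (Hb (u (max N n) [-] l)).
  pose proof (Rle_abs (- f (u (max N n) [-] l))) as H1. rewrite Rabs_Ropp in H1.
  assert (H2 : B * norm (u (max N n) [-] l) <= B * ((f l - a) / (B + 1)))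
    by (apply Rmult_le_compat_l; lra).
  assert (H3 : B * ((f l - a) / (B + 1)) < f l - a).
  { apply (Rmult_lt_reg_r (B + 1)); [lra|]. unfold Rdiv.
    replace (B * ((f l - a) * / (B + 1)) * (B + 1)) with (B * (f l - a)) by (field; lra). nra. }
  dsimp in H1. dsimp in Hb. lra.
Qed.

Fixpoint psum (u : nat -> X) (n : nat) : X :=
  match n with O => [0] | S n => psum u n [+] u n end.

Lemma dual_cvg (f : X -> R) (u : nat -> X) (l : X) :
  is_dual X f -> cvg u l -> Un_cv (fun n => f (u n)) (f l).
Proof.
  intros Hf Hu e He. destruct (dual_bound X f Hf) as (B & HB & Hb).
  destruct (Hu (e / (B + 1))) as (N & HN); [apply Rdiv_lt_0_compat; lra|].
  exists N. intros n Hn. specialize (HN n Hn). unfold Rdist.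
  replace (f (u n) - f l) with (f (u n [-] l)) by (dsimp; ring).
  pose proof (vnorm_nonneg X (u n [-] l)).
  apply (Rmult_lt_compat_l (B + 1)) in HN; [|lra].
  replace ((B + 1) * (e / (B + 1))) with e in HN by (field; lra).
  specialize (Hb (u n [-] l)). lra.
Qed.

(** Relative to a closed set F, because it is applied in the closed subspace generated by co D_T -
    C. If no closure contained a relative ball, one could choose nested balls with centres in F and
    radii at least halved, the k-th step avoiding the closure of [A k]; the limit of the centres
    would be an uncovered point of F. *)
Lemma baire (F : X -> Prop) (A : nat -> X -> Prop) (a0 : X) :
  bclosed X F -> F a0 -> (forall v, F v -> exists n, bclosure X (A n) v) ->
  exists n v0 rho, F v0 /\ 0 < rho /\
    forall v, F v -> norm (v [-] v0) < rho -> bclosure X (A n) v.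
Proof.
  intros HF Ha0 Hcov. apply NNPP. intros Hn.
  destruct (dependent_choice (X * R) (fun p => F (fst p) /\ 0 < snd p)
    (fun k p q => norm (fst q [-] fst p) + snd q <= snd p /\ snd q <= snd p / 2 /\
                  forall u, norm (u [-] fst q) <= snd q -> ~ bclosure X (A k) u) (a0, 1))
    as (f & Hf0 & Hf).
  - simpl. split; [auto|lra].
  - intros k (v, r) (Hv & Hr). simpl in *.
    assert (Hex : exists v', F v' /\ norm (v' [-] v) < r /\ ~ bclosure X (A k) v').
    { apply NNPP. intros H. apply Hn. exists k, v, r. repeat split; auto.
      intros u Hu Hd. apply NNPP. intros Hc. apply H. eauto. }
    destruct Hex as (v' & Hv' & Hd & Hc).
    assert (He : exists e, 0 < e /\ forall a, A k a -> e <= norm (a [-] v')).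
    { apply NNPP. intros H. apply Hc. intros e He. apply NNPP. intros H2. apply H.
      exists e. split; auto. intros a Ha. apply Rnot_lt_le. intros H3. apply H2. eauto. }
    destruct He as (e & He & Hea).
    assert (Hm : 0 < Rmin (e / 2) ((r - norm (v' [-] v)) / 2)) by (apply Rmin_glb_lt; lra).
    pose proof (Rmin_l (e / 2) ((r - norm (v' [-] v)) / 2)).
    pose proof (Rmin_r (e / 2) ((r - norm (v' [-] v)) / 2)).
    pose proof (vnorm_nonneg X (v' [-] v)).
    exists (v', Rmin (e / 2) ((r - norm (v' [-] v)) / 2)). simpl.
    repeat split; auto; try lra.
    intros u Hu Hcl. destruct (Hcl _ Hm) as (a & Ha & Had). specialize (Hea a Ha).
    pose proof (norm_sub_triangle X a u v'). lra.
  - assert (Hball : forall n m, (n <= m)%nat -> norm (fst (f m) [-] fst (f n)) + snd (f m) <= snd (f n)).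
    { intros n m Hm. induction Hm as [|m Hm IH]; [rewrite norm_sub_diag; lra|].
      destruct (Hf m) as (_ & H1 & _).
      pose proof (norm_sub_triangle X (fst (f (S m))) (fst (f m)) (fst (f n))). lra. }
    assert (Hsm : forall n, snd (f n) <= (1 / 2) ^ n).
    { induction n as [|n IH]; [rewrite Hf0; simpl; lra|].
      destruct (Hf n) as (_ & _ & H1 & _). simpl. lra. }
    destruct (geometric_cvg (fun n => fst (f n)) 1) as (l & Hl).
    { intros n. destruct (Hf n) as (_ & H1 & _). specialize (Hsm n).
      destruct (Hf (S n)) as ((_ & H2) & _). lra. }
    assert (Fl : F l) by (apply (cvg_closed F (fun n => fst (f n))); auto; intros n; apply (Hf n)).
    destruct (Hcov l Fl) as (n & Hn').
    destruct (Hf n) as (_ & _ & _ & H1). apply (H1 l); auto.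
    apply (cvg_norm_le (fun n => fst (f n)) l _ _ (S n)); auto.
    intros m Hm. pose proof (Hball (S n) m Hm). destruct (Hf m) as ((_ & H2) & _). lra.
Qed.
End Convergence.

(** * Real series with geometric bounds *)

Fixpoint rsum (u : nat -> R) (n : nat) : R :=
  match n with O => 0 | S n => rsum u n + u n end.

Lemma rsum_cvg (u : nat -> R) (K : R) :
  (forall n, Rabs (u n) <= K * (1 / 2) ^ n) -> exists l, Un_cv (rsum u) l.
Proof.
  intros Hu. destruct (geometric_cvg R_banach (rsum u) K) as (l & Hl).
  - intros n. unfold vsub. simpl. replace (rsum u n + u n + - rsum u n) with (u n) by ring. auto.
  - exists l. exact Hl.
Qed.

Lemma rsum_bound (u : nat -> R) (K : R) :
  (forall n, Rabs (u n) <= K * (1 / 2) ^ n) ->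
  forall n, Rabs (rsum u n) <= 2 * K - 2 * K * (1 / 2) ^ n.
Proof.
  intros Hu. induction n as [|n IH]; simpl.
  - rewrite Rabs_R0. lra.
  - specialize (Hu n). pose proof (Rabs_triang (rsum u n) (u n)). lra.
Qed.

Lemma Un_cv_const (a : R) : Un_cv (fun _ => a) a.
Proof. intros e He. exists O. intros n _. unfold Rdist. rewrite Rminus_diag, Rabs_R0. auto. Qed.

Lemma Un_cv_le (u : nat -> R) (l a : R) : Un_cv u l -> (forall n, u n <= a) -> l <= a.
Proof.
  intros Hu Ha. eapply Rle_cv_lim; [exact Ha|exact Hu|apply Un_cv_const].
Qed.

(** * Monotone operators near interior points of the domain *)

Section Interior.
Variable X : Banach.
Variable S : operator X.
Hypothesis HS : maximal_monotone X S.

Lemma mono_dual (z : X) (s : X -> R) : S z s -> is_dual X s.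
Proof. apply HS. Qed.

Lemma mono_le (z z' : X) (s s' : X -> R) : S z s -> S z' s' -> s (z' [-] z) <= s' (z' [-] z).
Proof.
  intros H H'. pose proof (mono_dual _ _ H) as Hd. pose proof (mono_dual _ _ H') as Hd'.
  destruct HS as ((_ & Hm) & _). specialize (Hm _ _ _ _ H' H). lra.
Qed.

(** Local boundedness of monotone operators at interior points, by Baire. For each v some x1 + c v
    lies in the domain, so monotonicity bounds s(x1 + c v - z) uniformly over z near x1; hence the
    closed sets [A n] cover X and one of them contains a ball, which is then moved to the origin. *)
Lemma locally_bounded (x1 : X) :
  binterior X (dom X S) x1 ->
  exists rho N, 0 < rho /\ 0 <= N /\
    forall z s, S z s -> norm (z [-] x1) < rho -> forall v, Rabs (s v) <= N * norm v.
Proof.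
  intros (r & Hr & Hball).
  pose (A := fun n v => forall z s, S z s -> norm (z [-] x1) < 1 ->
                 s ((x1 [+] / INR (n + 1) [*] v) [-] z) <= INR (n + 1)).
  assert (Hpos : forall n, 0 < INR (n + 1)) by (intros; apply lt_0_INR; lia).
  assert (Acl : forall n v, bclosure X (A n) v -> A n v).
  { intros n v Hv z s Hz Hd. pose proof (mono_dual _ _ Hz) as Hs.
    destruct (dual_bound X s Hs) as (B & HB & Hb).
    apply Rnot_lt_le. intros Hlt. pose proof (Hpos n) as Hp.
    set (gap := s ((x1 [+] / INR (n + 1) [*] v) [-] z) - INR (n + 1)) in *.
    assert (Hg : 0 < gap) by (unfold gap; lra).
    destruct (Hv (INR (n + 1) * gap / (B + 1))) as (a & Ha & Had).
    { apply Rdiv_lt_0_compat; [nra|lra]. }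
    specialize (Ha z s Hz Hd). specialize (Hb (a [-] v)).
    pose proof (Rle_abs (- s (a [-] v))) as H1. rewrite Rabs_Ropp in H1.
    assert (H2 : (B + 1) * norm (a [-] v) < INR (n + 1) * gap).
    { apply (Rmult_lt_compat_l (B + 1)) in Had; [|lra].
      replace ((B + 1) * (INR (n + 1) * gap / (B + 1))) with (INR (n + 1) * gap) in Had
        by (field; lra). exact Had. }
    assert (H3 : gap <= / INR (n + 1) * - s (a [-] v)).
    { unfold gap. dsimp. dsimp in Ha. lra. }
    apply (Rmult_le_compat_l (INR (n + 1))) in H3; [|lra].
    rewrite <- Rmult_assoc, Rinv_r in H3 by lra.
    pose proof (vnorm_nonneg X (a [-] v)). lra. }
  assert (Hcov : forall v, exists n, A n v).
  { intros v. pose proof (vnorm_nonneg X v) as Hv.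
    set (c := r / (2 * (norm v + 1))).
    assert (Hc : 0 < c) by (apply Rdiv_lt_0_compat; lra).
    assert (Hcv : c * norm v < r).
    { unfold c. apply (Rmult_lt_reg_r (2 * (norm v + 1))); [lra|].
      replace (r / (2 * (norm v + 1)) * norm v * (2 * (norm v + 1))) with (r * norm v)
        by (field; lra). nra. }
    destruct (Hball (x1 [+] c [*] v)) as (s1 & Hs1).
    { unfold bball. replace ((x1 [+] c [*] v) [-] x1) with (c [*] v) by vec.
      rewrite norm_scal_pos; lra. }
    destruct (Hball x1) as (s0 & Hs0).
    { unfold bball. rewrite norm_sub_diag. auto. }
    destruct (dual_bound X s1 (mono_dual _ _ Hs1)) as (B1 & HB1 & Hb1).
    destruct (dual_bound X s0 (mono_dual _ _ Hs0)) as (B0 & HB0 & Hb0).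
    set (Q := B1 * (c * norm v + 1) + B0).
    destruct (archimed (Rmax (/ c) Q)) as (Har & _).
    set (n := Z.to_nat (up (Rmax (/ c) Q))).
    assert (Hn : Rmax (/ c) Q <= INR (n + 1)).
    { rewrite plus_INR, INR_IZR_INZ. unfold n.
      assert (Hup : (0 <= up (Rmax (/ c) Q))%Z).
      { apply le_IZR. pose proof (Rmax_l (/ c) Q). assert (0 < / c) by now apply Rinv_0_lt_compat. lra. }
      rewrite Z2Nat.id by auto. simpl. lra. }
    pose proof (Rmax_l (/ c) Q). pose proof (Rmax_r (/ c) Q).
    exists n. intros z s Hz Hd. pose proof (mono_dual _ _ Hz) as Hs.
    pose proof (mono_le _ _ _ _ Hz Hs1) as K1. pose proof (mono_le _ _ _ _ Hz Hs0) as K0.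
    pose proof (Hb1 ((x1 [+] c [*] v) [-] z)) as L1. pose proof (Hb0 (x1 [-] z)) as L0.
    pose proof (Rle_abs (s1 ((x1 [+] c [*] v) [-] z))). pose proof (Rle_abs (s0 (x1 [-] z))).
    rewrite (norm_sub_sym X x1 z) in L0.
    assert (N1 : norm ((x1 [+] c [*] v) [-] z) <= c * norm v + 1).
    { replace ((x1 [+] c [*] v) [-] z) with (c [*] v [+] (x1 [-] z)) by vec.
      apply norm_add_le; [rewrite norm_scal_pos; lra|]. rewrite norm_sub_sym. lra. }
    assert (M1 : s ((x1 [+] c [*] v) [-] z) <= Q).
    { assert (B1 * norm ((x1 [+] c [*] v) [-] z) <= B1 * (c * norm v + 1))
        by (apply Rmult_le_compat_l; auto). unfold Q. lra. }
    assert (M0 : s (x1 [-] z) <= Q).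
    { assert (B0 * norm (z [-] x1) <= B0 * 1) by (apply Rmult_le_compat_l; lra).
      assert (0 <= B1 * (c * norm v + 1)) by (apply Rmult_le_pos; nra). unfold Q. lra. }
    set (k := INR (n + 1)) in *.
    assert (Hk : 0 < k) by apply Hpos.
    assert (Hkc : 1 <= k * c).
    { apply (Rmult_le_reg_r (/ c)); [now apply Rinv_0_lt_compat|].
      rewrite Rmult_assoc, Rinv_r by lra. lra. }
    (* x1 + v/k is the convex combination of x1 + c v and x1 with weights t and 1 - t, so the bound
       Q <= k at both points is inherited. *)
    set (t := / (k * c)).
    assert (Ht : 0 < t <= 1).
    { split; [apply Rinv_0_lt_compat; lra|]. unfold t.
      rewrite <- Rinv_1. apply Rinv_le_contravar; lra. }
    replace ((x1 [+] / k [*] v) [-] z) with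
      (t [*] ((x1 [+] c [*] v) [-] z) [+] (1 - t) [*] (x1 [-] z)) by (unfold t; vecf; lra).
    rewrite (dual_add X s), (dual_scal X s t), (dual_scal X s (1 - t)) by auto. nra. }
  destruct (baire X (fun _ => True) A [0]) as (n & v0 & rho & _ & Hrho & Hb); auto.
  { intros x _. auto. }
  { intros v _. destruct (Hcov v) as (n & Hn). exists n. now apply bclosure_subset. }
  destruct (Hcov (vopp X v0)) as (m & Hm).
  pose proof (Hpos n) as Hpn. pose proof (Hpos m) as Hpm.
  set (a := INR (n + 1)) in *. set (b := INR (m + 1)) in *.
  set (N' := (a * a + b * b) / (a + b)). set (rho' := rho / (a + b)).
  assert (Hrho' : 0 < rho') by (apply Rdiv_lt_0_compat; lra).
  assert (HN' : 0 < N') by (apply Rdiv_lt_0_compat; nra).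
  assert (Hkey : forall z s e, S z s -> norm (z [-] x1) < 1 -> norm e < rho' ->
                   s ((x1 [+] e) [-] z) <= N').
  { intros z s e Hz Hd He. pose proof (mono_dual _ _ Hz) as Hs.
    assert (E1 : A n (v0 [+] (a + b) [*] e)).
    { apply Acl, Hb; auto. replace ((v0 [+] (a + b) [*] e) [-] v0) with ((a + b) [*] e) by vec.
      rewrite norm_scal_pos by lra. apply (Rmult_lt_compat_l (a + b)) in He; [|lra].
      unfold rho' in He. replace ((a + b) * (rho / (a + b))) with rho in He by (field; lra). auto. }
    specialize (E1 z s Hz Hd). specialize (Hm z s Hz Hd).
    fold a in E1. fold b in Hm.
    (* The centre v0 cancels: v0 + (a + b)e is used at scale 1/a and -v0 at scale 1/b, and the
       weights a/(a + b), b/(a + b) leave exactly x1 + e. *)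
    replace ((x1 [+] e) [-] z) with
      ((a / (a + b)) [*] ((x1 [+] / a [*] (v0 [+] (a + b) [*] e)) [-] z) [+]
       (b / (a + b)) [*] ((x1 [+] / b [*] vopp X v0) [-] z)) by (vecf; lra).
    rewrite (dual_add X s), (dual_scal X s (a / (a + b))), (dual_scal X s (b / (a + b))) by auto.
    replace N' with (a / (a + b) * a + b / (a + b) * b) by (unfold N'; field; lra).
    apply Rplus_le_compat; apply Rmult_le_compat_l; auto; left; apply Rdiv_lt_0_compat; lra. }
  (* Half of rho' is spent on z - x1 and a quarter on a multiple c v, so s(c v) <= N' with c =
     rho'/(4|v|). *)
  exists (Rmin 1 (rho' / 2)), (4 * N' / rho'). split; [apply Rmin_glb_lt; lra|].
  split; [apply Rlt_le, Rdiv_lt_0_compat; lra|].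
  intros z s Hz Hd v. pose proof (mono_dual _ _ Hz) as Hs.
  pose proof (Rmin_l 1 (rho' / 2)). pose proof (Rmin_r 1 (rho' / 2)).
  assert (Hup : forall v, s v <= 4 * N' / rho' * norm v).
  { clear v. intros v. destruct (Req_dec (norm v) 0) as [E|E].
    - rewrite E. apply vnorm_eq0 in E. subst v. dsimp. lra.
    - pose proof (vnorm_nonneg X v). set (c := rho' / (4 * norm v)).
      assert (Hc : 0 < c) by (apply Rdiv_lt_0_compat; lra).
      assert (K : s ((x1 [+] ((z [-] x1) [+] c [*] v)) [-] z) <= N').
      { apply Hkey; auto; [lra|].
        apply Rle_lt_trans with (norm (z [-] x1) + norm (c [*] v)); [apply vnorm_triangle|].
        rewrite norm_scal_pos by lra.
        replace (c * norm v) with (rho' / 4) by (unfold c; field; lra). lra. }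
      replace ((x1 [+] ((z [-] x1) [+] c [*] v)) [-] z) with (c [*] v) in K by vec.
      rewrite (dual_scal X s) in K by auto.
      apply (Rmult_le_reg_l c); auto. eapply Rle_trans; [apply K|].
      right. unfold c. field. split; lra. }
  pose proof (Hup v) as U1. pose proof (Hup (vopp X v)) as U2.
  rewrite norm_opp, (dual_opp X s) in U2 by auto.
  unfold Rabs. destruct (Rcase_abs (s v)); lra.
Qed.

(** Let z = (1 - t)y + t a with a near x1. Then a - z is the multiple 1 - t of a - y, and
    monotonicity between z and a transfers the local bound at a to s(a - y), hence to s(z - y), for
    any s in S(z). At t = 1 the division is impossible, but then z = a. *)
Lemma dir_inf_bounded_interior (x1 : X) :
  binterior X (dom X S) x1 -> dir_inf_bounded X S x1.
Proof.
  intros Hint. destruct (locally_bounded x1 Hint) as (rho & N & Hrho & HN & Hb).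
  destruct Hint as (r & Hr & Hball).
  assert (Hx1 : dom X S x1) by (apply Hball; unfold bball; rewrite norm_sub_diag; auto).
  split; auto. intros y. exists (Rmin rho r), (N + 1).
  split; [apply Rmin_glb_lt; auto|]. split; [lra|].
  pose proof (Rmin_l rho r). pose proof (Rmin_r rho r).
  intros z (t & a & Ht & Ha & Ez) (s & Hs). unfold bball in Ha.
  destruct (Hball a) as (sa & Hsa); [unfold bball; lra|].
  pose proof (mono_dual _ _ Hsa) as Hda.
  assert (Hba : Rabs (sa (a [-] y)) <= N * norm (a [-] y)) by (apply (Hb a sa); auto; lra).
  pose proof (Rle_abs (sa (a [-] y))). pose proof (vnorm_nonneg X (a [-] y)).
  assert (Ezy : z [-] y = t [*] (a [-] y)) by (rewrite Ez; vec).
  rewrite Ezy, norm_scal_pos by lra.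
  destruct (Req_dec t 1) as [E1|E1].
  - exists sa. split.
    + replace z with a; auto. rewrite Ez, E1. vec.
    + rewrite (dual_scal X sa) by auto. nra.
  - exists s. split; auto. pose proof (mono_dual _ _ Hs) as Hd.
    pose proof (mono_le _ _ _ _ Hs Hsa) as K.
    assert (Eaz : a [-] z = (1 - t) [*] (a [-] y)) by (rewrite Ez; vec).
    rewrite Eaz, (dual_scal X s), (dual_scal X sa) in K by auto.
    apply Rmult_le_reg_l in K; [|lra]. rewrite (dual_scal X s) by auto. nra.
Qed.

(** * Conic combinations of graph points and segments in the domain *)

(** Nonnegative combinations of graph points seen from p, recording the sums of l, l(z - p), l s and
    l s(z - p). A linear minorant q of the last as a function of the second satisfies q(z - p) <=
    s(z - p) on the graph, so (p, q) is monotonically related to S and p lies in the domain. *)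
Inductive comb (p : X) : R -> X -> (X -> R) -> R -> Prop :=
  | comb_nil : comb p 0 [0] (fun _ => 0) 0
  | comb_cons (l : R) (z : X) (s : X -> R) (m : R) (v : X) (vs : X -> R) (r : R) :
      0 <= l -> S z s -> comb p m v vs r ->
      comb p (l + m) (l [*] (z [-] p) [+] v) (fun x => l * s x + vs x) (l * s (z [-] p) + r).

Lemma comb_dual (p : X) (m : R) (v : X) (vs : X -> R) (r : R) :
  comb p m v vs r -> is_dual X vs /\ 0 <= m.
Proof.
  induction 1 as [|l z s m v vs r Hl Hz Hc [IH1 IH2]].
  - split; [apply is_dual_zero|lra].
  - split; [|lra]. pose proof (mono_dual _ _ Hz).
    apply (is_dual_ext X (fun x => l * s x + 1 * vs x)); [intros; ring|].
    now apply is_dual_comb.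
Qed.

Lemma comb_fitzpatrick (p : X) (m : R) (v : X) (vs : X -> R) (r : R) (z : X) (s : X -> R) :
  comb p m v vs r -> S z s -> vs (z [-] p) + s v - m * s (z [-] p) <= r.
Proof.
  intros Hc Hz. pose proof (mono_dual _ _ Hz) as Hs.
  induction Hc as [|l z' s' m v vs r Hl Hz' Hc IH].
  - dsimp. lra.
  - pose proof (mono_dual _ _ Hz') as Hs'. pose proof (mono_le _ _ _ _ Hz Hz') as K.
    dsimp. dsimp in IH. dsimp in K. apply (Rmult_le_compat_l l) in K; auto. lra.
Qed.

Lemma comb_pair (p : X) (m m' : R) (v v' : X) (vs vs' : X -> R) (r r' : R) :
  comb p m v vs r -> comb p m' v' vs' r' -> vs' v + vs v' <= m * r' + m' * r.
Proof.
  intros Hc Hc'. destruct (comb_dual _ _ _ _ _ Hc') as (Hd' & Hm').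
  induction Hc as [|l z s m v vs r Hl Hz Hc IH].
  - dsimp. lra.
  - pose proof (comb_fitzpatrick _ _ _ _ _ _ _ Hc' Hz) as K.
    apply (Rmult_le_compat_l l) in K; auto. dsimp. dsimp in K. pose proof (mono_dual _ _ Hz).
    dsimp in K. dsimp. lra.
Qed.

Lemma comb_add (p : X) (m m' : R) (v v' : X) (vs vs' : X -> R) (r r' : R) :
  comb p m v vs r -> comb p m' v' vs' r' ->
  exists m2 vs2, comb p m2 (v [+] v') vs2 (r + r').
Proof.
  intros Hc Hc'. induction Hc as [|l z s m v vs r Hl Hz Hc IH].
  - exists m', vs'. now rewrite vadd_0l, Rplus_0_l.
  - destruct IH as (m2 & vs2 & IH). eexists _, _.
    rewrite <- vadd_assoc, Rplus_assoc. apply comb_cons; eauto.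
Qed.

Lemma comb_scal (p : X) (a m : R) (v : X) (vs : X -> R) (r : R) :
  0 <= a -> comb p m v vs r -> exists m2 vs2, comb p m2 (a [*] v) vs2 (a * r).
Proof.
  intros Ha Hc. induction Hc as [|l z s m v vs r Hl Hz Hc IH].
  - rewrite vscal_0r, Rmult_0_r. eexists _, _. constructor.
  - destruct IH as (m2 & vs2 & IH). eexists _, _.
    rewrite vscal_addr, vscal_assoc, Rmult_plus_distr_l, <- Rmult_assoc.
    apply comb_cons; eauto. nra.
Qed.

(** Monotonicity summed over all pairs of the combination with itself gives 0 <= 2 m r. If m = 0,
    every coefficient is zero and so is r. *)
Lemma comb_zero (p : X) (m : R) (vs : X -> R) (r : R) : comb p m [0] vs r -> 0 <= r.
Proof.
  intros Hc. destruct (comb_dual _ _ _ _ _ Hc) as (Hd & Hm).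
  pose proof (comb_pair _ _ _ _ _ _ _ _ _ Hc Hc) as K. dsimp in K.
  destruct Hm as [Hm|Hm]; [nra|]. clear K Hd. symmetry in Hm.
  enough (r = 0) by lra.
  assert (Hgen : forall m v vs r, comb p m v vs r -> m = 0 -> r = 0).
  { clear - HS. induction 1 as [|l z s m v vs r Hl Hz Hc IH]; auto. intros E.
    destruct (comb_dual _ _ _ _ _ Hc) as (_ & Hm).
    rewrite IH by lra. replace l with 0 by lra. ring. }
  eapply Hgen; eauto.
Qed.

(** Hahn-Banach on the cone of combinations seen from p. Its lower bound comes from completing a
    combination over w to one over 0 with bounded cost, which [comb_zero] makes nonnegative. *)
Lemma dom_segment (x1 u v : X) (sg t : R) :
  binterior X (dom X S) x1 -> dom X S u -> dom X S v -> 0 <= sg <= 1 -> 0 <= t < 1 ->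
  dom X S ((1 - t) [*] x1 [+] t [*] ((1 - sg) [*] u [+] sg [*] v)).
Proof.
  intros Hint (su & Hu) (sv & Hv) Hsg Ht.
  destruct (locally_bounded x1 Hint) as (rho1 & N & Hrho1 & HN & Hb).
  destruct Hint as (r0 & Hr0 & Hball).
  set (rho := Rmin rho1 r0). assert (Hrho : 0 < rho) by (apply Rmin_glb_lt; auto).
  assert (R1 : rho <= rho1) by apply Rmin_l. assert (R2 : rho <= r0) by apply Rmin_r.
  set (p := (1 - t) [*] x1 [+] t [*] ((1 - sg) [*] u [+] sg [*] v)).
  set (c0 := N * (norm (x1 [-] p) + rho)).
  set (c1 := Rabs (su (u [-] p)) + Rabs (sv (v [-] p))).
  assert (Hc0 : 0 <= c0).
  { pose proof (vnorm_nonneg X (x1 [-] p)). apply Rmult_le_pos; lra. }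
  assert (Hc1 : 0 <= c1).
  { pose proof (Rabs_pos (su (u [-] p))). pose proof (Rabs_pos (sv (v [-] p))). unfold c1. lra. }
  destruct (hahn_banach_cone X (fun w r => exists m ws, comb p m w ws r)
              (2 / ((1 - t) * rho) * (c0 + c1))) as (q & Hq & Hqle).
  - apply Rmult_le_pos; [|lra]. apply Rlt_le, Rdiv_lt_0_compat; [lra|nra].
  - split.
    + intros w w' r r' (m & ws & H) (m' & ws' & H'). eapply comb_add; eauto.
    + intros a w r Ha (m & ws & H). eapply comb_scal; eauto. lra.
  - intros w r (m & ws & Hc). pose proof (vnorm_nonneg X w) as Hw.
    assert (Hdiv : 0 < 2 / ((1 - t) * rho)) by (apply Rdiv_lt_0_compat; [lra|nra]).
    (* Weight k(1 - t) at a point x2 at distance rho/2 from x1 cancels w, when w is nonzero; the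
       weights k t(1 - sg) at u and k t sg at v balance k(1 - t) at x1 about p. *)
    set (k := 2 / ((1 - t) * rho) * norm w).
    assert (Hk : 0 <= k) by (apply Rmult_le_pos; lra).
    assert (Hx : exists x2 s2, S x2 s2 /\ (k * (1 - t)) [*] (x2 [-] x1) = vopp X w /\
                   norm (x2 [-] x1) < rho).
    { destruct (Req_dec (norm w) 0) as [E|E].
      - apply vnorm_eq0 in E. destruct (Hball x1) as (s2 & Hs2).
        { unfold bball. rewrite norm_sub_diag. auto. }
        exists x1, s2. split; auto. split; [|rewrite norm_sub_diag; lra].
        rewrite E, sub_diag. vec.
      - assert (Hk' : 0 < k) by (apply Rmult_lt_0_compat; lra).
        assert (En : norm ((x1 [-] / (k * (1 - t)) [*] w) [-] x1) = rho / 2).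
        { replace ((x1 [-] / (k * (1 - t)) [*] w) [-] x1) with (vopp X (/ (k * (1 - t)) [*] w)) by vec.
          rewrite norm_opp, norm_scal_pos by (left; apply Rinv_0_lt_compat; nra).
          unfold k. field. repeat split; lra. }
        destruct (Hball (x1 [-] / (k * (1 - t)) [*] w)) as (s2 & Hs2).
        { unfold bball. lra. }
        exists (x1 [-] / (k * (1 - t)) [*] w), s2. split; auto. split; [|lra].
        vecf; split; lra. }
    destruct Hx as (x2 & s2 & Hs2 & E2 & N2).
    assert (P1 : 0 <= k * (1 - t)) by (apply Rmult_le_pos; lra).
    assert (P2 : 0 <= k * t * (1 - sg)) by (repeat apply Rmult_le_pos; lra).
    assert (P3 : 0 <= k * t * sg) by (repeat apply Rmult_le_pos; lra).
    pose proof (comb_cons p (k * (1 - t)) x2 s2 _ _ _ _ P1 Hs2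
      (comb_cons p (k * t * (1 - sg)) u su _ _ _ _ P2 Hu
        (comb_cons p (k * t * sg) v sv _ _ _ _ P3 Hv Hc))) as Hc2.
    match type of Hc2 with comb _ _ ?v _ _ => assert (Ez : v = [0]) end.
    { replace ((k * (1 - t)) [*] (x2 [-] p)) with
        ((k * (1 - t)) [*] (x2 [-] x1) [+] (k * (1 - t)) [*] (x1 [-] p)) by vec.
      rewrite E2. unfold p. vec. }
    rewrite Ez in Hc2. apply comb_zero in Hc2.
    assert (K2 : s2 (x2 [-] p) <= c0).
    { assert (N3 : norm (x2 [-] p) <= norm (x1 [-] p) + rho).
      { pose proof (norm_sub_triangle X x2 x1 p). lra. }
      pose proof (Hb x2 s2 Hs2 ltac:(lra) (x2 [-] p)). pose proof (Rle_abs (s2 (x2 [-] p))).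
      assert (N * norm (x2 [-] p) <= c0) by (apply Rmult_le_compat_l; auto). lra. }
    pose proof (Rle_abs (su (u [-] p))). pose proof (Rle_abs (sv (v [-] p))).
    pose proof (Rabs_pos (su (u [-] p))). pose proof (Rabs_pos (sv (v [-] p))).
    assert (k * (1 - t) * s2 (x2 [-] p) <= k * c0) by nra.
    assert (L1 : k * t * (1 - sg) * su (u [-] p) <= k * Rabs (su (u [-] p))).
    { assert (0 <= t * (1 - sg) <= 1) by nra.
      rewrite Rmult_assoc, Rmult_assoc. apply Rmult_le_compat_l; auto.
      rewrite <- Rmult_assoc. nra. }
    assert (L2 : k * t * sg * sv (v [-] p) <= k * Rabs (sv (v [-] p))).
    { assert (0 <= t * sg <= 1) by nra.
      rewrite Rmult_assoc, Rmult_assoc. apply Rmult_le_compat_l; auto.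
      rewrite <- Rmult_assoc. nra. }
    replace (2 / ((1 - t) * rho) * (c0 + c1) * norm w) with (k * (c0 + c1)) by (unfold k; ring).
    unfold c1. lra.
  - exists q. apply HS; auto. intros z s Hz.
    assert (K : q (z [-] p) <= s (z [-] p)).
    { apply Hqle. exists (1 + 0), (fun x => 1 * s x + 0).
      pose proof (comb_cons p 1 z s _ _ _ _ ltac:(lra) Hz (comb_nil p)) as Hc.
      replace (1 [*] (z [-] p) [+] [0]) with (z [-] p) in Hc by vec.
      now replace (1 * s (z [-] p) + 0) with (s (z [-] p)) in Hc by ring. }
    pose proof (mono_dual _ _ Hz). dsimp. dsimp in K. lra.
Qed.

(** A convex combination of approximating domain points need not be in the domain, but after a small
    push by d towards the interior point x1 it is. *)
Lemma closure_dom_convex (x1 : X) :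
  binterior X (dom X S) x1 -> bconvex X (bclosure X (dom X S)).
Proof.
  intros Hint a b sg Ha Hb Hsg e He.
  destruct (Ha (e / 2)) as (u & Hu & Hua); [lra|].
  destruct (Hb (e / 2)) as (v & Hv & Hvb); [lra|].
  set (p := (1 - sg) [*] u [+] sg [*] v).
  pose proof (vnorm_nonneg X (x1 [-] p)) as Hn.
  set (d := Rmin 1 (e / 2 / (norm (x1 [-] p) + 1))).
  assert (Hd : 0 < d).
  { apply Rmin_glb_lt; [lra|]. apply Rdiv_lt_0_compat; lra. }
  assert (Hd1 : d <= 1) by apply Rmin_l.
  assert (Hd2 : d * norm (x1 [-] p) < e / 2).
  { apply Rle_lt_trans with (e / 2 / (norm (x1 [-] p) + 1) * norm (x1 [-] p)).
    - apply Rmult_le_compat_r; auto. apply Rmin_r.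
    - apply (Rmult_lt_reg_r (norm (x1 [-] p) + 1)); [lra|].
      replace (e / 2 / (norm (x1 [-] p) + 1) * norm (x1 [-] p) * (norm (x1 [-] p) + 1))
        with (e / 2 * norm (x1 [-] p)) by (field; lra). nra. }
  exists ((1 - (1 - d)) [*] x1 [+] (1 - d) [*] p). split.
  - apply dom_segment; auto. lra.
  - replace (((1 - (1 - d)) [*] x1 [+] (1 - d) [*] p) [-] ((1 - sg) [*] a [+] sg [*] b)) with
      (d [*] (x1 [-] p) [+] ((1 - sg) [*] (u [-] a) [+] sg [*] (v [-] b))) by (unfold p; vec).
    pose proof (vnorm_triangle X (d [*] (x1 [-] p)) ((1 - sg) [*] (u [-] a) [+] sg [*] (v [-] b))) as T1.
    pose proof (vnorm_triangle X ((1 - sg) [*] (u [-] a)) (sg [*] (v [-] b))) as T2.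
    rewrite !norm_scal_pos in * by lra. nra.
Qed.
End Interior.

(** * A gliding hump *)

Section GlidingHump.
Variable X : Banach.
Variable S : operator X.
Hypothesis HS : maximal_monotone X S.

(** Point and weight are the sums of be(z - x) and of be over the chosen pairs. The loss bounds from
    above, for all j at once, how negative the accumulated be s(d_j - z) can be. The next index is
    chosen from [hump_idx] on, and the gap is a positive lower bound for b at the indices chosen so
    far. *)
Record hump_state : Type := {
  hump_pt : X; hump_weight : R; hump_loss : R; hump_idx : nat; hump_gap : R }.

Definition hump_step (x : X) (d : nat -> X) (b : nat -> R) (k : nat) (st st' : hump_state) : Prop :=
  exists z s i be, S z s /\ 0 <= be /\
    hump_pt st' = hump_pt st [+] be [*] (z [-] x) /\
    hump_weight st' = hump_weight st + be /\
    be <= (1 / 2) ^ (k + 1) /\ be * norm (z [-] x) <= (1 / 2) ^ k /\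
    (hump_idx st <= i)%nat /\ (i < hump_idx st')%nat /\
    (forall j, hump_loss st - hump_loss st' <= be * s (d j [-] z)) /\
    INR k + 1 + hump_loss st <= be * s (d i [-] z) /\
    (forall j, (j < hump_idx st)%nat -> hump_gap st <= b j ->
       - (1 / 2) ^ (k + 1) <= be * s (d j [-] z)) /\
    hump_gap st' <= hump_gap st /\ hump_gap st' <= b i.

(* The pairs (z, s) have s(d_i - z) huge at a late index i, but only mildly negative at the
   earlier ones; a fast convergent combination of the z is a zb with s(d_i - zb) unbounded. *)
Lemma gliding_hump (x : X) (b0 : X -> R) (d : nat -> X) (b rho : nat -> R) (D K0 sg Ny : R) :
  S x b0 -> (forall i, norm (d i [-] x) <= D) -> 0 <= K0 -> 0 < sg -> 0 <= Ny ->
  (forall n, 0 < rho n) -> (forall n, 0 < b n) ->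
  (forall e, 0 < e -> exists N, forall n, (N <= n)%nat -> rho n < e) ->
  (forall n, exists z s i t, S z s /\ sg / 2 <= t /\ (n <= i)%nat /\
     t <= 2 * rho n * s (d i [-] z) /\
     (forall k, (k < n)%nat -> - (K0 * t) <= b k * s (d k [-] z)) /\
     norm (z [-] x) <= Ny + t) ->
  exists zb, forall B N, exists i, (N <= i)%nat /\ forall s, S (d i) s -> B <= s (d i [-] zb).
Proof.
  intros Hx HD HK0 Hsg HNy Hrho Hb Hrho0 Hstage.
  destruct (dependent_choice hump_state (fun st => 0 <= hump_loss st /\ 0 < hump_gap st)
    (hump_step x d b) {| hump_pt := [0]; hump_weight := 0; hump_loss := 0; hump_idx := 0; hump_gap := 1 |})
    as (f & Hf0 & Hf).
  - simpl. lra.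
  - intros k (p, W, c, N, eta) (Hc & Heta). simpl in Hc, Heta.
    (* The new hump has to outweigh the loss c of all earlier pairs and leave k + 1; the extra 1
       pays for the losses of later pairs, at most 2^-(l+1) at step l. *)
    set (Kk := INR k + 1 + c).
    assert (HKk : 0 < Kk) by (pose proof (pos_INR k); unfold Kk; lra).
    set (u0 := 2 / sg). assert (Hu0 : 0 < u0) by (apply Rdiv_lt_0_compat; lra).
    (* The three summands, multiplied by rho n, bound be, be|z - x| and the negative part of be
       s(d_j - z) at earlier indices, using 1/t <= 2/sg; n is taken so late that rho n times L is at
       most 2^-(k+1). *)
    set (L := 2 * Kk * u0 + 2 * Kk * (Ny * u0 + 1) + 2 * Kk * (K0 / eta)).
    assert (HNu : 0 <= Ny * u0) by (apply Rmult_le_pos; lra).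
    assert (HKe : 0 <= K0 / eta) by (apply Rmult_le_pos; auto; left; now apply Rinv_0_lt_compat).
    assert (L1 : 0 <= 2 * Kk * u0) by (apply Rmult_le_pos; lra).
    assert (L2 : 0 <= 2 * Kk * (Ny * u0 + 1)) by (apply Rmult_le_pos; lra).
    assert (L3 : 0 <= 2 * Kk * (K0 / eta)) by (apply Rmult_le_pos; lra).
    assert (HL : 0 <= L) by (unfold L; lra).
    set (hk := (1 / 2) ^ (k + 1)). assert (Hhk : 0 < hk) by apply half_pow_pos.
    destruct (Hrho0 (hk / (L + 1))) as (N1 & HN1); [apply Rdiv_lt_0_compat; lra|].
    set (n := max N N1). specialize (HN1 n (Nat.le_max_r _ _)).
    destruct (Hstage n) as (z & s & i & t & Hz & Ht & Hi & Hti & Hcross & Hzx).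
    specialize (Hrho n). set (r := rho n) in *.
    assert (HrL : r * L <= hk).
    { apply (Rmult_lt_compat_r (L + 1)) in HN1; [|lra].
      replace (hk / (L + 1) * (L + 1)) with hk in HN1 by (field; lra). nra. }
    assert (HrP : forall q, q <= L -> r * q <= hk).
    { intros q Hq. apply (Rmult_le_compat_l r) in Hq; lra. }
    assert (Ht0 : 0 < t) by lra.
    assert (Hu : 0 < / t) by now apply Rinv_0_lt_compat.
    assert (Htu : t * / t = 1) by (apply Rinv_r; lra).
    assert (Huu : / t <= u0).
    { replace u0 with (/ (sg / 2)) by (unfold u0; field; lra). apply Rinv_le_contravar; lra. }
    set (u := / t) in *.
    (* Since t <= 2 r s(d_i - z), this weight gives be s(d_i - z) >= Kk. *)
    set (be := 2 * r * Kk * u).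
    assert (HrK : 0 < 2 * r * Kk) by (apply Rmult_lt_0_compat; lra).
    assert (Hbe : 0 < be) by (apply Rmult_lt_0_compat; auto).
    pose proof (mono_dual X S HS _ _ Hz) as Hs.
    destruct (dual_bound X s Hs) as (Bs & HBs & Hbs).
    assert (Hnz : 0 <= norm (z [-] x)) by apply vnorm_nonneg.
    assert (HD0 : 0 <= D) by (pose proof (HD O); pose proof (vnorm_nonneg X (d O [-] x)); lra).
    exists {| hump_pt := p [+] be [*] (z [-] x); hump_weight := W + be;
              hump_loss := c + be * (Bs * (D + norm (z [-] x)));
              hump_idx := i + 1; hump_gap := Rmin eta (b i) |}.
    simpl. split; [split|].
    + assert (0 <= be * (Bs * (D + norm (z [-] x)))).
      { apply Rmult_le_pos; [lra|]. apply Rmult_le_pos; lra. }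
      lra.
    + apply Rmin_glb_lt; auto.
    + exists z, s, i, be. simpl. fold hk.
      assert (M1 : be <= hk).
      { apply Rle_trans with (r * (2 * Kk * u0)); [|apply HrP; unfold L; lra].
        replace (r * (2 * Kk * u0)) with (2 * r * Kk * u0) by ring.
        apply Rmult_le_compat_l; lra. }
      assert (M2 : be * norm (z [-] x) <= hk).
      { apply Rle_trans with (be * (Ny + t)); [apply Rmult_le_compat_l; lra|].
        replace (be * (Ny + t)) with (2 * r * Kk * (Ny * u + t * u)) by (unfold be; ring).
        rewrite Htu. apply Rle_trans with (r * (2 * Kk * (Ny * u0 + 1))); 
          [|apply HrP; unfold L; lra].
        replace (r * (2 * Kk * (Ny * u0 + 1))) with (2 * r * Kk * (Ny * u0 + 1)) by ring.
        apply Rmult_le_compat_l; [lra|]. nra. }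
      repeat split; auto; try lra.
      * apply Rle_trans with hk; auto. unfold hk. apply half_pow_antitone. lia.
      * unfold n in Hi. lia.
      * lia.
      * intros j. pose proof (Hbs (d j [-] z)) as K1.
        pose proof (Rle_abs (- s (d j [-] z))) as K2. rewrite Rabs_Ropp in K2.
        assert (K3 : norm (d j [-] z) <= D + norm (z [-] x)).
        { pose proof (norm_sub_triangle X (d j) x z). pose proof (HD j).
          rewrite (norm_sub_sym X x z) in H. lra. }
        apply (Rmult_le_compat_l Bs) in K3; auto.
        assert (be * - s (d j [-] z) <= be * (Bs * (D + norm (z [-] x))))
          by (apply Rmult_le_compat_l; lra).
        lra.
      * fold Kk. apply (Rmult_le_compat_l (Kk * u)) in Hti; [|apply Rmult_le_pos; lra].
        replace (Kk * u * t) with (Kk * (t * u)) in Hti by ring. rewrite Htu in Hti.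
        unfold be. lra.
      * intros j Hj Hbj. assert (Hjn : (j < n)%nat) by (unfold n; lia).
        specialize (Hcross j Hjn). specialize (Hb j).
        assert (K1 : - (K0 * t) <= eta * s (d j [-] z) \/ 0 <= s (d j [-] z)).
        { destruct (Rle_lt_dec 0 (s (d j [-] z))) as [H|H]; auto. left. nra. }
        destruct K1 as [K1|K1]; [|assert (0 <= be * s (d j [-] z)) by (apply Rmult_le_pos; lra); lra].
        assert (K2 : - (K0 / eta * t) <= s (d j [-] z)).
        { apply (Rmult_le_reg_l eta); auto.
          replace (eta * - (K0 / eta * t)) with (- (K0 * t)) by (field; lra). lra. }
        apply (Rmult_le_compat_l be) in K2; [|lra].
        replace (be * - (K0 / eta * t)) with (- (2 * r * Kk * (K0 / eta) * (t * u))) in K2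
          by (unfold be; ring).
        rewrite Htu in K2. pose proof (HrP (2 * Kk * (K0 / eta))) as K3.
        unfold L in K3. specialize (K3 ltac:(lra)). lra.
      * apply Rmin_l.
      * apply Rmin_r.
  - assert (HW : forall k, hump_weight (f k) <= 1 - (1 / 2) ^ k).
    { induction k as [|k IH]; [rewrite Hf0; simpl; lra|].
      destruct (Hf k) as (_ & z & s & i & be & _ & _ & _ & E & L & _).
      rewrite E. rewrite Nat.add_1_r in L. simpl in *. lra. }
    assert (HN : forall k, (k <= hump_idx (f k))%nat).
    { induction k as [|k IH]; [lia|].
      destruct (Hf k) as (_ & z & s & i & be & _ & _ & _ & _ & _ & _ & L1 & L2 & _). lia. }
    destruct (geometric_cvg X (fun k => hump_pt (f k)) 1) as (pb & Hpb).
    { intros k. destruct (Hf k) as (_ & z & s & i & be & _ & Hbe & E & _ & _ & L & _).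
      rewrite E. replace ((hump_pt (f k) [+] be [*] (z [-] x)) [-] hump_pt (f k))
        with (be [*] (z [-] x)) by vec.
      rewrite norm_scal_pos; lra. }
    destruct (dual_bound X b0 (mono_dual X S HS _ _ Hx)) as (B0 & HB0 & Hb0).
    exists (x [+] pb). intros B N.
    assert (HD0 : 0 <= D) by (pose proof (HD O); pose proof (vnorm_nonneg X (d O [-] x)); lra).
    assert (HBD : 0 <= B0 * D) by (apply Rmult_le_pos; auto).
    (* The total weight W is at most 1, not equal to it. Replacing W s(d_i - x) by s(d_i - x) costs
       at most B0 D, because s(d_i - x) >= b0(d_i - x) >= -B0 D. *)
    destruct (INR_unbounded (B + B0 * D)) as (j0 & Hj0).
    set (j := max N j0).
    assert (Hj : B + B0 * D <= INR j).
    { apply Rle_trans with (INR j0); [lra|]. apply le_INR. apply Nat.le_max_r. }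
    destruct (Hf j) as (_ & zj & sj & i & bj & Hzj & Hbj & Ep & EW & _ & _ & Li & Lj & _ & Hgain & _ & Lg1 & Lg2).
    exists i. split; [specialize (HN j); unfold j in *; lia|].
    intros s Hs. pose proof (mono_dual X S HS _ _ Hs) as Hds.
    assert (Hinc : forall z s' be, S z s' -> 0 <= be ->
               be * s' (d i [-] z) <= be * s (d i [-] x) - s (be [*] (z [-] x))).
    { intros z s' be Hz Hbe. pose proof (mono_le X S HS _ _ _ _ Hz Hs) as K.
      apply (Rmult_le_compat_l be) in K; auto. dsimp. dsimp in K. lra. }
    (* This is the sum of be s(d_i - z) over the first k pairs for an arbitrary s in S(d_i); by
       monotonicity it dominates the corresponding sum with the functionals of the pairs. *)
    set (Psi := fun k => hump_weight (f k) * s (d i [-] x) - s (hump_pt (f k))).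
    assert (HA : forall k, - hump_loss (f k) <= Psi k).
    { induction k as [|k IH].
      - unfold Psi. rewrite Hf0. simpl. dsimp. lra.
      - destruct (Hf k) as (_ & z & s' & i' & be & Hz & Hbe & E1 & E2 & _ & _ & _ & _ & Hl & _).
        unfold Psi in *. rewrite E1, E2, (dual_add X s) by auto.
        specialize (Hl i). pose proof (Hinc z s' be Hz Hbe). lra. }
    (* The bound telescopes the later losses. Index and gap are carried along because the mild-loss
       clause of a later step applies to i only while i is below its starting index and b i is at
       least its gap. *)
    assert (HB : forall k, (j + 1 <= k)%nat -> INR j + 1 - (1 / 2) ^ (j + 1) + (1 / 2) ^ k <= Psi k /\
               (i < hump_idx (f k))%nat /\ hump_gap (f k) <= b i).
    { intros k Hk. induction Hk as [|k Hk (IH1 & IH2 & IH3)].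
      - rewrite Nat.add_1_r. split; [|auto].
        unfold Psi. rewrite Ep, EW, (dual_add X s) by auto.
        pose proof (Hinc zj sj bj Hzj Hbj). specialize (HA j). unfold Psi in HA. lra.
      - destruct (Hf k) as (_ & z & s' & i' & be & Hz & Hbe & E1 & E2 & _ & _ & I1 & I2 & _ & _ & Hl & G1 & _).
        split; [|split; [lia|lra]].
        unfold Psi in *. rewrite E1, E2, (dual_add X s) by auto.
        specialize (Hl i IH2 IH3). pose proof (Hinc z s' be Hz Hbe).
        rewrite Nat.add_1_r in Hl. simpl in *. lra. }
    assert (HWp : forall k, 0 <= hump_weight (f k)).
    { induction k as [|k IH]; [rewrite Hf0; simpl; lra|].
      destruct (Hf k) as (_ & z & s' & i' & be & _ & Hbe & _ & E & _). rewrite E. lra. }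
    assert (Hlim : s pb <= s (d i [-] x) - B).
    { apply (cvg_dual_le X s (fun k => hump_pt (f k)) pb _ (j + 1)); auto.
      intros k Hk. destruct (HB k Hk) as (K1 & _). unfold Psi in K1.
      pose proof (half_pow_pos k). specialize (HW k). specialize (HWp k).
      assert (Hlow : - (B0 * D) <= s (d i [-] x)).
      { pose proof (mono_le X S HS _ _ _ _ Hx Hs). pose proof (Hb0 (d i [-] x)).
        pose proof (Rle_abs (- b0 (d i [-] x))) as K3. rewrite Rabs_Ropp in K3.
        assert (B0 * norm (d i [-] x) <= B0 * D) by (apply Rmult_le_compat_l; auto). lra. }
      assert ((1 / 2) ^ (j + 1) <= 1).
      { apply (half_pow_antitone (j + 1) 0). lia. }
      assert ((1 - hump_weight (f k)) * (s (d i [-] x) + B0 * D) >= 0) by nra.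
      nra. }
    dsimp. dsimp in Hlim. lra.
Qed.
End GlidingHump.

(** * Points monotonically related to the sum *)

Section Core.
Variable X : Banach.
Variables T S : operator X.
Variables x0 x : X.
Variable xh : X -> R.
Let C := bclosure X (dom X S).
Hypothesis HT : maximal_monotone X T.
Hypothesis HS : maximal_monotone X S.
Hypothesis HC : bconvex X C.
Hypothesis Hdom : forall z, dom X T z -> C z -> dom X S z.
Hypothesis HTx0 : dom X T x0.
Hypothesis Hdir : dir_inf_bounded X S x0.
Hypothesis Hmax : restriction_maximal X T C x0.
Hypothesis Hxh : is_dual X xh.
Hypothesis Hmr : forall z t s, T z t -> S z s -> 0 <= t (z [-] x) + s (z [-] x) - xh (z [-] x).

Lemma dom_S_closure (z : X) : dom X S z -> C z.
Proof. apply bclosure_subset. Qed.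

(** All of D_S lies in C, so normals to C keep the monotone relation and maximality of S absorbs
    them, with arbitrarily large factors. *)
Lemma add_normal (z : X) (s m : X -> R) (a : R) :
  S z s -> normal_cone X C z m -> 0 <= a -> S z (fun v => 1 * s v + a * m v).
Proof.
  intros Hz (Cz & Hm & Hmle) Ha. pose proof (mono_dual X S HS _ _ Hz) as Hs.
  apply HS.
  - now apply is_dual_comb.
  - intros z' s' Hz'. pose proof (mono_le X S HS _ _ _ _ Hz' Hz) as K.
    pose proof (mono_dual X S HS _ _ Hz') as Hs'.
    assert (Hc : m (z' [-] z) <= 0) by (apply Hmle, dom_S_closure; now exists s').
    dsimp. dsimp in K. dsimp in Hc. nra.
Qed.

(** [domain_criterion] with apex x. The growth estimate is directional inf boundedness in the
    direction x; a normal that is negative on z - x would, added to s with a large factor, violate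
    the monotone relation. *)
Lemma related_point_dom : dom X T x /\ dom X S x.
Proof.
  destruct Hdir as (HSx0 & Hy). destruct (Hy x) as (eps & M & Heps & HM & Hz).
  destruct (domain_criterion X T C x0 x xh M eps) as (HTx & HCx); auto; try lra.
  - now apply dom_S_closure.
  - intros z t Ht Cz Kz. assert (HSz : dom X S z) by (apply Hdom; auto; now exists t).
    destruct (Hz z Kz HSz) as (s & Hs & Hle). specialize (Hmr z t s Ht Hs). lra.
  - intros z m (t & Ht) Hm.
    assert (HSz : dom X S z) by (apply Hdom; [now exists t|apply Hm]).
    destruct HSz as (s & Hs).
    apply Rnot_lt_le. intros Hneg.
    set (k := t (z [-] x) + s (z [-] x) - xh (z [-] x)).
    assert (Hk : 0 <= k) by now apply Hmr.
    (* With this factor the left side of [Hmr] becomes k - (k + 1) = -1. *)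
    set (a := (k + 1) / - m (z [-] x)).
    assert (Ha : 0 < a) by (apply Rdiv_lt_0_compat; lra).
    pose proof (Hmr z t _ Ht (add_normal z s m a Hs Hm (Rlt_le _ _ Ha))) as K. simpl in K.
    assert (a * m (z [-] x) = - (k + 1)) by (unfold a; field; lra).
    unfold k in *. lra.
Qed.

(** Weight 1 - tau on the monotone relation at x, weight tau on the two Fitzpatrick bounds. The last
    term is the defect left because the S-side has reached W with weight m instead of y with weight
    1. *)
Lemma test_inequality (y W z : X) (ys om t s : X -> R) (r1 R2 m tau : R) :
  is_dual X ys -> is_dual X om -> T z t -> S z s -> 0 <= tau <= 1 ->
  ys (z [-] x) + (t y - xh y) - (t (z [-] x) - xh (z [-] x)) <= r1 ->
  om (z [-] x) + s W - m * s (z [-] x) <= R2 ->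
  tau * (ys (z [-] x) + om (z [-] x)) - tau * (r1 + R2) <=
  t (z [-] (x [+] tau [*] y)) - xh (z [-] (x [+] tau [*] y)) + s (z [-] (x [+] tau [*] y)) +
  tau * (s (y [-] W) - (1 - m) * s (z [-] x)).
Proof.
  intros Hys Hom Ht Hs Htau H1 H2. pose proof (Hmr z t s Ht Hs) as H0.
  assert (Hdt : is_dual X t) by (apply (proj1 HT) in Ht; auto).
  pose proof (mono_dual X S HS _ _ Hs) as Hds.
  dsimp. dsimp in H0. dsimp in H1. dsimp in H2.
  apply (Rmult_le_compat_l (1 - tau)) in H0; [|lra].
  apply (Rmult_le_compat_l tau) in H1; [|lra].
  apply (Rmult_le_compat_l tau) in H2; [|lra].
  lra.
Qed.

(* Were there no such (z, s), the hypotheses of domain_criterion would hold at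
   x + tau y; but then z = x + tau y itself is such a point. *)
Lemma test_point (y W : X) (ys om : X -> R) (r1 R2 m sg lam : R) :
  is_dual X ys -> is_dual X om ->
  (forall z t, T z t -> ys (z [-] x) + (t y - xh y) - (t (z [-] x) - xh (z [-] x)) <= r1) ->
  (forall z s, S z s -> om (z [-] x) + s W - m * s (z [-] x) <= R2) ->
  C (x [+] y) -> 0 < sg -> r1 + R2 <= - sg -> 1 <= lam ->
  exists tau z s, 0 < tau <= 1 /\ tau * lam <= 1 /\ S z s /\
    sg / 2 <= s (y [-] W) - (1 - m) * s (z [-] x) /\
    lam * norm (z [-] (x [+] tau [*] y)) <= tau * (s (y [-] W) - (1 - m) * s (z [-] x)) /\
    s (z [-] (x [+] tau [*] y)) <= tau * (s (y [-] W) - (1 - m) * s (z [-] x)).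
Proof.
  intros Hys Hom HTC HSC Cy Hsg Hr Hlam.
  destruct related_point_dom as (HTx & HSx).
  set (A := Rabs (ys y + om y)).
  assert (HA : 0 <= A) by apply Rabs_pos.
  (* The second bound makes the second-order term tau(ys y + om y) at least -sg/2, so half of the
     gain sg survives. *)
  set (tau := Rmin (/ lam) (sg / (2 * (A + 1)))).
  assert (Hil : 0 < / lam) by (apply Rinv_0_lt_compat; lra).
  assert (Htau : 0 < tau) by (apply Rmin_glb_lt; auto; apply Rdiv_lt_0_compat; lra).
  assert (Htl : tau * lam <= 1).
  { apply Rle_trans with (/ lam * lam); [|rewrite Rinv_l; lra].
    apply Rmult_le_compat_r; [lra|apply Rmin_l]. }
  assert (HtA : tau * A <= sg / 2).
  { apply Rle_trans with (sg / (2 * (A + 1)) * A).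
    - apply Rmult_le_compat_r; [lra|apply Rmin_r].
    - apply (Rmult_le_reg_r (A + 1)); [lra|].
      replace (sg / (2 * (A + 1)) * A * (A + 1)) with (sg / 2 * A) by (field; lra). nra. }
  assert (Ht1 : tau <= 1) by nra.
  assert (Haa : - (sg / 2) <= tau * (ys y + om y)).
  { pose proof (Rle_abs (- (ys y + om y))) as K. rewrite Rabs_Ropp in K. fold A in K. nra. }
  exists tau. set (p := x [+] tau [*] y).
  assert (Cp : C p).
  { unfold p. replace (x [+] tau [*] y) with ((1 - tau) [*] x [+] tau [*] (x [+] y)) by vec.
    apply HC; auto; [now apply dom_S_closure|lra]. }
  pose proof (vnorm_nonneg X) as Hnn.
  destruct (proj2 Hdir p) as (eps & M & Heps & HM & Hz).
  apply NNPP. intros Hno.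
  (* For such s, a defect above this bound would satisfy all three requirements of a test point
     together. *)
  assert (Hno' : forall z s, S z s -> s (z [-] p) <= M * norm (z [-] p) ->
            tau * (s (y [-] W) - (1 - m) * s (z [-] x)) <
            tau * (sg / 2) + (M + lam) * norm (z [-] p)).
  { intros z s Hs Hle. apply Rnot_le_lt. intros Hge. apply Hno. exists z, s.
    specialize (Hnn (z [-] p)).
    assert (0 <= M * norm (z [-] p)) by (apply Rmult_le_pos; lra).
    assert (0 <= lam * norm (z [-] p)) by (apply Rmult_le_pos; lra).
    assert (0 <= tau * (sg / 2)) by (apply Rmult_le_pos; lra).
    repeat split; auto; try lra.
    apply (Rmult_le_reg_l tau); auto. lra. }
  (* This functional absorbs the terms ys(z - p) and om(z - p) of [test_inequality]. One M bounds
     s(z - p) and M + lam bounds the defect, whence the radius. *)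
  destruct (domain_criterion X T C x0 p (fun v => 1 * xh v + tau * (1 * ys v + 1 * om v))
              (M + (M + lam)) eps) as ((t & Ht) & _); auto; try lra.
  - apply dom_S_closure, Hdir.
  - apply is_dual_comb; auto. now apply is_dual_comb.
  - intros z t Ht Cz Kz. assert (HSz : dom X S z) by (apply Hdom; auto; now exists t).
    destruct (Hz z Kz HSz) as (s & Hs & Hle). pose proof (Hno' z s Hs Hle) as K.
    pose proof (test_inequality y W z ys om t s r1 R2 m tau Hys Hom Ht Hs ltac:(lra)
                  (HTC z t Ht) (HSC z s Hs)) as K2.
    fold p in K2.
    assert (E : forall f, is_dual X f -> f (z [-] x) = f (z [-] p) + tau * f y).
    { intros f Hf. unfold p. dsimp. ring. }
    rewrite (E ys Hys), (E om Hom) in K2.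
    assert (tau * (- sg) >= tau * (r1 + R2)) by nra.
    assert (tau * - (sg / 2) <= tau * (tau * (ys y + om y))) by (apply Rmult_le_compat_l; lra).
    lra.
  - intros z n _ (Cz & Hn & Hnle). specialize (Hnle p Cp). dsimp. dsimp in Hnle. lra.
  - destruct (Hdom p) as (s & Hs); auto; [now exists t|].
    pose proof (test_inequality y W p ys om t s r1 R2 m tau Hys Hom Ht Hs ltac:(lra)
                  (HTC p t Ht) (HSC p s Hs)) as K2.
    fold p in K2.
    assert (Ez : forall f, is_dual X f -> f (p [-] p) = 0) by (intros; dsimp; ring).
    assert (Hdt : is_dual X t) by (apply (proj1 HT) in Ht; auto).
    pose proof (mono_dual X S HS _ _ Hs) as Hds.
    rewrite (Ez t), (Ez xh), (Ez s) in K2 by auto.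
    assert (E : forall f, is_dual X f -> f (p [-] x) = tau * f y).
    { intros f Hf. unfold p. dsimp. ring. }
    rewrite (E ys Hys), (E om Hom) in K2.
    specialize (Hno' p s Hs). rewrite norm_sub_diag, (Ez s Hds) in Hno'.
    specialize (Hno' ltac:(lra)).
    assert (tau * (- sg) >= tau * (r1 + R2)) by nra.
    assert (tau * - (sg / 2) <= tau * (tau * (ys y + om y))) by (apply Rmult_le_compat_l; lra).
    lra.
Qed.

(* Here y is an infinite combination of points of dom S that converge to x0: stage n splits
   it as W = w n plus a tail of weight 1 - mu n, and test_point yields a pair (z, s) on which
   the tail is bounded below, hence s(d_i - z) is large for some i >= n. *)
Lemma stage_point (y : X) (ys : X -> R) (r1 : R) (w : nat -> X) (mu b : nat -> R)
    (d : nat -> X) (sd : nat -> X -> R) (ws : X -> R) (r2 M sg : R) :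
  is_dual X ys -> is_dual X ws ->
  (forall z t, T z t -> ys (z [-] x) + (t y - xh y) - (t (z [-] x) - xh (z [-] x)) <= r1) ->
  (forall z s, S z s -> ws (z [-] x) + s (w O) - mu O * s (z [-] x) <= r2) ->
  (forall n, w (Datatypes.S n) = w n [+] b n [*] (d n [-] x)) ->
  (forall n, mu (Datatypes.S n) = mu n + b n) ->
  (forall n, 0 < b n) -> (forall n, mu n <= 1) ->
  (forall e, 0 < e -> exists N, forall n, (N <= n)%nat -> 1 - mu n < e) ->
  cvg X w y -> (forall n, S (d n) (sd n)) -> (forall n, sd n (d n [-] x) <= M) -> 0 <= M ->
  C (x [+] y) -> 0 < sg -> r1 + r2 + M * (1 - mu O) <= - sg ->
  exists K0, 0 <= K0 /\ forall n, exists z s i t, S z s /\ sg / 2 <= t /\ (n <= i)%nat /\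
     t <= 2 * (1 - mu n) * s (d i [-] z) /\
     (forall k, (k < n)%nat -> - (K0 * t) <= b k * s (d k [-] z)) /\
     norm (z [-] x) <= norm y + t.
Proof.
  intros Hys Hws HTC HSC Hw Hmu Hb Hmu1 Hmulim Hcw HSd HsdM HM Cy Hsg Hcost.
  destruct related_point_dom as (_ & (b0 & Hb0)).
  destruct (dual_bound X b0 (mono_dual X S HS _ _ Hb0)) as (B0 & HB0 & Hbd0).
  pose proof (vnorm_nonneg X y) as Hny.
  set (R2 := r2 + M * (1 - mu O)).
  pose proof (Rabs_pos R2) as HR2. pose proof (Rle_abs R2) as HR2'.
  set (K1 := B0 * norm y + Rabs R2 + 1).
  assert (HK1 : 0 <= K1).
  { assert (0 <= B0 * norm y) by (apply Rmult_le_pos; auto). unfold K1. lra. }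
  assert (HK2 : 0 <= K1 * (2 / sg)).
  { apply Rmult_le_pos; auto. apply Rlt_le, Rdiv_lt_0_compat; lra. }
  (* The constant part K1 of the estimate is turned into a multiple of t through t >= sg/2. This
     value is independent of n, as the gliding hump requires. *)
  exists (K1 * (2 / sg) + B0 + 3). split; [lra|]. intros n.
  (* The functional belonging to the finite combination w n; no limit of these is available. *)
  set (om := fix om n := match n with
                         | O => ws
                         | Datatypes.S n => fun v => 1 * om n v + b n * sd n v
                         end).
  assert (Hom : forall n, is_dual X (om n)).
  { induction n0 as [|k IH]; simpl; auto. apply is_dual_comb; auto.
    eapply mono_dual; eauto. }
  assert (HL : exists L, 0 <= L /\ forall v, Rabs (om n v) <= L * norm v /\
             forall i, (i < n)%nat -> Rabs (b i * sd i v) <= L * norm v).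
  { clear -HS HSd Hom. induction n as [|n (L & HL & IH)].
    - destruct (dual_bound X (om O) (Hom O)) as (L & HL & H). exists L. split; auto.
      intros v. split; auto. intros; lia.
    - destruct (dual_bound X (om (Datatypes.S n)) (Hom _)) as (L1 & HL1 & H1).
      assert (Hd : is_dual X (fun v => b n * sd n v + 0 * sd n v)).
      { apply is_dual_comb; eapply mono_dual; eauto. }
      destruct (dual_bound X _ Hd) as (L2 & HL2 & H2).
      exists (L + L1 + L2). split; [lra|]. intros v. pose proof (vnorm_nonneg X v).
      assert (0 <= L * norm v) by (apply Rmult_le_pos; auto).
      assert (0 <= L1 * norm v) by (apply Rmult_le_pos; auto).
      assert (0 <= L2 * norm v) by (apply Rmult_le_pos; auto).
      specialize (H1 v). specialize (H2 v). destruct (IH v) as (_ & IH').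
      rewrite Rmult_0_l, Rplus_0_r in H2. split; [lra|].
      intros i Hi. destruct (Nat.eq_dec i n) as [->|Hne]; [lra|].
      specialize (IH' i ltac:(lia)). lra. }
  destruct HL as (L & HL & HLb).
  assert (Hmono : forall k l, (k <= l)%nat -> mu k <= mu l).
  { intros k l Hkl. induction Hkl as [|l Hkl IH]; [lra|]. rewrite Hmu. specialize (Hb l). lra. }
  assert (Hterm : forall k z s, S z s -> sd k (z [-] x) + s (d k [-] z) <= M).
  { intros k z s Hz. pose proof (mono_le X S HS _ _ _ _ Hz (HSd k)) as K.
    pose proof (mono_dual X S HS _ _ (HSd k)) as Hdk. specialize (HsdM k).
    dsimp in HsdM. dsimp in K. dsimp. lra. }
  assert (Hstep : forall k z s, S z s ->
            om (Datatypes.S k) (z [-] x) + s (w (Datatypes.S k)) - mu (Datatypes.S k) * s (z [-] x) =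
            om k (z [-] x) + s (w k) - mu k * s (z [-] x) + b k * (sd k (z [-] x) + s (d k [-] z))).
  { intros k z s Hz. pose proof (mono_dual X S HS _ _ Hz) as Hs.
    rewrite Hw, Hmu. simpl. dsimp. ring. }
  assert (HQ : forall k z s, S z s ->
            om k (z [-] x) + s (w k) - mu k * s (z [-] x) <= r2 + M * (mu k - mu O)).
  { intros k z s Hz. induction k as [|k IH].
    - specialize (HSC z s Hz). simpl. lra.
    - rewrite Hstep, Hmu by auto. specialize (Hterm k z s Hz). specialize (Hb k).
      apply (Rmult_le_compat_l (b k)) in Hterm; lra. }
  (* As in [HQ], but the i-th term is kept instead of being bounded by M b_i; this is the source of
     the lower bound for b_i s(d_i - z) at old indices. *)
  assert (HQ' : forall k i z s, S z s -> (i < k)%nat ->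
            om k (z [-] x) + s (w k) - mu k * s (z [-] x) <=
            r2 + M * (mu k - mu O) + b i * (sd i (z [-] x) + s (d i [-] z))).
  { intros k i z s Hz Hi. induction Hi as [|k Hi IH].
    - rewrite Hstep by auto. pose proof (HQ i z s Hz) as K.
      assert (M * mu i <= M * mu (Datatypes.S i)) by (apply Rmult_le_compat_l; auto).
      lra.
    - rewrite Hstep, Hmu by auto. pose proof (Hterm k z s Hz) as K. specialize (Hb k).
      apply (Rmult_le_compat_l (b k)) in K; lra. }
  assert (HR : forall k, r2 + M * (mu k - mu O) <= R2).
  { intros k. specialize (Hmu1 k). apply (Rmult_le_compat_l M) in Hmu1; auto. unfold R2. lra. }
  (* L may grow with n. The factor lam is matched to it so that 2 L |z - x| <= 1 + t, which removes
     L from the final constant. *)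
  destruct (test_point y (w n) ys (om n) r1 R2 (mu n) sg (1 + 2 * L * (norm y + 1)))
    as (tau & z & s & Htau & Htl & Hz & Ht & Hp1 & Hp2); auto.
  { intros z s Hz. specialize (HQ n z s Hz). specialize (HR n). lra. }
  { unfold R2. lra. }
  { assert (0 <= 2 * L * (norm y + 1)) by (apply Rmult_le_pos; lra). lra. }
  pose proof (mono_dual X S HS _ _ Hz) as Hs.
  set (t := s (y [-] w n) - (1 - mu n) * s (z [-] x)) in *.
  set (p := x [+] tau [*] y) in *.
  pose proof (vnorm_nonneg X (z [-] p)) as Hnp. pose proof (vnorm_nonneg X (z [-] x)) as Hnx.
  assert (Hzx : norm (z [-] x) <= tau * norm y + norm (z [-] p)).
  { replace (z [-] x) with (tau [*] y [+] (z [-] p)) by (unfold p; vec).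
    pose proof (vnorm_triangle X (tau [*] y) (z [-] p)). rewrite norm_scal_pos in H by lra. auto. }
  assert (HLy : 0 <= 2 * L * (norm y + 1)) by (apply Rmult_le_pos; lra).
  assert (Hzp : norm (z [-] p) <= tau * t) by nra.
  assert (Hzp' : 2 * L * norm (z [-] p) <= tau * t).
  { assert (2 * L * norm (z [-] p) <= 2 * L * (norm y + 1) * norm (z [-] p)).
    { apply Rmult_le_compat_r; auto. nra. }
    lra. }
  assert (Ht0 : 0 < t) by lra.
  assert (Htt : tau * t <= t) by nra.
  assert (HLt : 2 * L * (tau * norm y) <= 1).
  { assert (0 <= tau * (1 + 2 * L)) by (apply Rmult_le_pos; lra). nra. }
  assert (HLz : 2 * L * norm (z [-] x) <= 1 + t).
  { apply Rle_trans with (2 * L * (tau * norm y + norm (z [-] p))); [|lra].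
    apply Rmult_le_compat_l; lra. }
  assert (Hrho : 0 < 1 - mu n).
  { specialize (Hmu1 (Datatypes.S n)). rewrite Hmu in Hmu1. specialize (Hb n). lra. }
  assert (Hex : exists i, (n <= i)%nat /\ t <= 2 * (1 - mu n) * s (d i [-] z)).
  { apply NNPP. intros Hno.
    (* If s(d_k - z) <= t/(2 rho) on the whole tail, then s(d_k - x) <= kap there. Summing the tail
       of weight rho gives at most t/2 for its defect, and t/4 more for passing to the limit, while
       the defect equals t. *)
    set (rho := 1 - mu n) in *. set (kap := s (z [-] x) + t / (2 * rho)).
    assert (Hcl : forall k, (n <= k)%nat -> s (w k) - s (w n) <= (mu k - mu n) * kap).
    { intros k Hk. induction Hk as [|k Hk IH]; [lra|].
      assert (K : 2 * rho * s (d k [-] z) <= t).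
      { apply Rnot_lt_le. intros Hlt. apply Hno. exists k. split; auto. lra. }
      assert (K' : s (d k [-] z) <= t / (2 * rho)).
      { apply (Rmult_le_reg_l (2 * rho)); [lra|].
        replace (2 * rho * (t / (2 * rho))) with t by (field; lra). auto. }
      rewrite Hw, Hmu. dsimp. specialize (Hb k).
      apply (Rmult_le_compat_l (b k)) in K'; [|lra]. dsimp in K'.
      unfold kap in *. dsimp in IH. dsimp. lra. }
    pose proof (Rabs_pos kap) as Hkap.
    destruct (Hmulim (t / 4 / (Rabs kap + 1))) as (N & HN).
    { apply Rdiv_lt_0_compat; lra. }
    assert (Hlim : s y <= s (w n) + rho * kap + t / 4).
    { apply (cvg_dual_le X s w y _ (max n N)); auto. intros k Hk.
      specialize (Hcl k ltac:(lia)). specialize (HN k ltac:(lia)). specialize (Hmu1 k).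
      assert (K : (1 - mu k) * Rabs kap <= t / 4).
      { apply (Rmult_lt_compat_r (Rabs kap + 1)) in HN; [|lra].
        replace (t / 4 / (Rabs kap + 1) * (Rabs kap + 1)) with (t / 4) in HN by (field; lra).
        nra. }
      pose proof (Rle_abs (- kap)) as K2. rewrite Rabs_Ropp in K2.
      apply (Rmult_le_compat_l (1 - mu k)) in K2; [|lra]. unfold rho. lra. }
    assert (E : rho * kap = rho * s (z [-] x) + t / 2) by (unfold kap; field; lra).
    assert (Et : t = s y - s (w n) - rho * s (z [-] x)) by (unfold t; dsimp; ring).
    lra. }
  destruct Hex as (i & Hi & Hti).
  exists z, s, i, t. repeat split; auto.
  - intros k Hk. apply (Rmult_le_reg_l tau); [lra|].
    pose proof (HQ' n k z s Hz Hk) as Q. specialize (HR n).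
    destruct (HLb (z [-] x)) as (O1 & O2). specialize (O2 k Hk).
    pose proof (Rle_abs (- om n (z [-] x))) as A1. rewrite Rabs_Ropp in A1.
    pose proof (Rle_abs (b k * sd k (z [-] x))) as A2.
    assert (Q2 : s (w n) - mu n * s (z [-] x) <= Rabs R2 + (1 + t) + b k * s (d k [-] z)) by lra.
    assert (Es : s (z [-] p) = s (z [-] x) - tau * s y) by (unfold p; dsimp; ring).
    assert (Et : s y = s (w n) + t + (1 - mu n) * s (z [-] x)) by (unfold t; dsimp; ring).
    assert (Hlow : - (B0 * (tau * norm y + tau * t)) <= (1 - tau) * s (z [-] x)).
    { pose proof (mono_le X S HS _ _ _ _ Hb0 Hz) as K. pose proof (Hbd0 (z [-] x)) as K3.
      pose proof (Rle_abs (- b0 (z [-] x))) as K4. rewrite Rabs_Ropp in K4.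
      assert (K5 : B0 * norm (z [-] x) <= B0 * (tau * norm y + tau * t))
        by (apply Rmult_le_compat_l; lra).
      assert (K6 : 0 <= B0 * norm (z [-] x)) by (apply Rmult_le_pos; auto).
      assert (- (B0 * norm (z [-] x)) <= s (z [-] x)) by lra. nra. }
    rewrite Es, Et in Hp2.
    apply (Rmult_le_compat_l tau) in Q2; [|lra].
    assert (Hfin : - tau * (B0 * norm y + B0 * t + Rabs R2 + 1 + 3 * t) <= tau * (b k * s (d k [-] z)))
      by lra.
    eapply Rle_trans; [|apply Hfin].
    assert (K1 <= K1 * (2 / sg) * t).
    { replace K1 with (K1 * (2 / sg) * (sg / 2)) at 1 by (field; lra).
      apply Rmult_le_compat_l; auto. }
    assert (tau * (B0 * norm y + B0 * t + Rabs R2 + 1 + 3 * t) <=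
            tau * ((K1 * (2 / sg) + B0 + 3) * t)).
    { apply Rmult_le_compat_l; [lra|]. unfold K1 in *. lra. }
    lra.
  - assert (tau * norm y <= norm y) by nra. lra.
Qed.

(** With a negative total cost the gliding hump yields zb. The constants of directional inf
    boundedness in the direction zb hold at every d_i close to x0, as d_i is the endpoint t = 1 of
    its segment, and some late d_i exceeds them. *)
Lemma series_contradiction (y : X) (ys : X -> R) (r1 : R) (w : nat -> X) (mu b : nat -> R)
    (d : nat -> X) (ws : X -> R) (r2 M D : R) :
  is_dual X ys -> is_dual X ws ->
  (forall z t, T z t -> ys (z [-] x) + (t y - xh y) - (t (z [-] x) - xh (z [-] x)) <= r1) ->
  (forall z s, S z s -> ws (z [-] x) + s (w O) - mu O * s (z [-] x) <= r2) ->
  (forall n, w (Datatypes.S n) = w n [+] b n [*] (d n [-] x)) ->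
  (forall n, mu (Datatypes.S n) = mu n + b n) ->
  (forall n, 0 < b n) -> (forall n, mu n <= 1) ->
  (forall e, 0 < e -> exists N, forall n, (N <= n)%nat -> 1 - mu n < e) ->
  cvg X w y -> (forall n, exists s, S (d n) s /\ s (d n [-] x) <= M) -> 0 <= M ->
  cvg X d x0 -> (forall n, norm (d n [-] x) <= D) -> C (x [+] y) ->
  0 <= r1 + r2 + M * (1 - mu O).
Proof.
  intros Hys Hws HTC HSC Hw Hmu Hb Hmu1 Hmulim Hcw HSd HM Hcd HD Cy.
  apply Rnot_lt_le. intros Hneg.
  set (sd := fun n => proj1_sig (constructive_indefinite_description _ (HSd n))).
  assert (Hsd : forall n, S (d n) (sd n) /\ sd n (d n [-] x) <= M).
  { intros n. exact (proj2_sig (constructive_indefinite_description _ (HSd n))). }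
  set (sg := - (r1 + r2 + M * (1 - mu O))).
  assert (Hsg : 0 < sg) by (unfold sg; lra).
  destruct (stage_point y ys r1 w mu b d sd ws r2 M sg) as (K0 & HK0 & Hst); auto;
    try (intros n; apply Hsd); [unfold sg; lra|].
  destruct related_point_dom as (_ & (b0 & Hb0)).
  destruct (gliding_hump X S HS x b0 d b (fun n => 1 - mu n) D K0 sg (norm y))
    as (zb & Hzb); auto; [apply vnorm_nonneg| |].
  { intros n. specialize (Hmu1 (Datatypes.S n)). rewrite Hmu in Hmu1. specialize (Hb n). lra. }
  destruct (proj2 Hdir zb) as (eps & M' & Heps & HM' & Hz).
  destruct (Hcd eps Heps) as (N & HN).
  destruct (Hzb (M' * (norm (x0 [-] zb) + eps) + 1) N) as (i & Hi & Hbig).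
  specialize (HN i Hi).
  destruct (Hz (d i)) as (s & Hs & Hle).
  - exists 1, (d i). split; [lra|]. split; [exact HN|]. vec.
  - destruct (Hsd i) as (H & _). now exists (sd i).
  - specialize (Hbig s Hs). pose proof (norm_sub_triangle X (d i) x0 zb).
    assert (M' * norm (d i [-] zb) <= M' * (norm (x0 [-] zb) + eps))
      by (apply Rmult_le_compat_l; lra).
    lra.
Qed.

(** * Fitzpatrick cones and the choice of the splitting *)

Hypothesis HF : closed_subspace X (cone_diff X T C).
Let F := cone_diff X T C.

(* TC l y ys r says that phi_T(y/l, ys/l) <= r/l for the Fitzpatrick function phi_T of T
   translated by (x, xh); SC does the same for S translated by (x, 0). *)
Definition TC (l : R) (y : X) (ys : X -> R) (r : R) : Prop :=
  0 <= l /\ F y /\ is_dual X ys /\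
  forall z t, T z t -> ys (z [-] x) + (t y - xh y) - l * (t (z [-] x) - xh (z [-] x)) <= r.

(** The clause on c keeps w in the cone of C - x with the same weight m; this puts differences of
    the two sides into [F] and the limit point x + y into C. *)
Definition SC (m : R) (w : X) (ws : X -> R) (r : R) : Prop :=
  0 <= m /\ (exists c, C c /\ w = m [*] (c [-] x)) /\ is_dual X ws /\
  forall z s, S z s -> ws (z [-] x) + s w - m * s (z [-] x) <= r.

Lemma T_dual (z : X) (t : X -> R) : T z t -> is_dual X t.
Proof. apply HT. Qed.

Lemma F_zero : F [0].
Proof. apply (proj1 HF). Qed.

Lemma F_closed : bclosed X F.
Proof. apply HF. Qed.

Lemma F_add (u v : X) : F u -> F v -> F (u [+] v).
Proof. apply HF. Qed.

Lemma F_scal (a : R) (v : X) : F v -> F (a [*] v).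
Proof. destruct HF as (_ & _ & Hs & _). apply Hs. Qed.

Lemma F_sub (a c : X) : co X (dom X T) a -> C c -> F (a [-] c).
Proof. intros Ha Hc. exists 1, a, c. repeat split; auto; [lra|vec]. Qed.

Lemma co_dom (a : X) : dom X T a -> co X (dom X T) a.
Proof. intros Ha D _ HD. auto. Qed.

Lemma co_convex (A : X -> Prop) : bconvex X (co X A).
Proof. intros a b t Ha Hb Ht D HD HDA. apply HD; auto; [apply Ha|apply Hb]; auto. Qed.

Lemma C_x : C x.
Proof. apply dom_S_closure, related_point_dom. Qed.

Lemma F_point (c : X) : C c -> F (c [-] x).
Proof.
  intros Hc. replace (c [-] x) with ((-1) [*] (x [-] c)) by vec.
  apply F_scal, F_sub; auto.
  apply co_dom, related_point_dom.
Qed.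

Lemma TC_add (l l' : R) (y y' : X) (ys ys' : X -> R) (r r' : R) :
  TC l y ys r -> TC l' y' ys' r' ->
  TC (l + l') (y [+] y') (fun v => 1 * ys v + 1 * ys' v) (r + r').
Proof.
  intros (H1 & H2 & H3 & H4) (H1' & H2' & H3' & H4'). split; [lra|]. split; [now apply F_add|].
  split; [now apply is_dual_comb|]. intros z t Ht. specialize (H4 z t Ht). specialize (H4' z t Ht).
  pose proof (T_dual _ _ Ht). rewrite (dual_add X t), (dual_add X xh) by auto. lra.
Qed.

Lemma TC_scal (a l : R) (y : X) (ys : X -> R) (r : R) :
  0 <= a -> TC l y ys r -> TC (a * l) (a [*] y) (fun v => a * ys v + 0 * ys v) (a * r).
Proof.
  intros Ha (H1 & H2 & H3 & H4). split; [now apply Rmult_le_pos|]. split; [now apply F_scal|].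
  split; [now apply is_dual_comb|]. intros z t Ht. specialize (H4 z t Ht).
  pose proof (T_dual _ _ Ht). rewrite (dual_scal X t), (dual_scal X xh) by auto.
  apply (Rmult_le_compat_l a) in H4; auto. lra.
Qed.

Lemma TC_graph (z : X) (t : X -> R) :
  T z t -> TC 1 (z [-] x) (fun v => 1 * t v + (-1) * xh v) (t (z [-] x) - xh (z [-] x)).
Proof.
  intros Ht. pose proof (T_dual _ _ Ht) as Hd. split; [lra|].
  split; [apply F_sub; [apply co_dom; now exists t|apply C_x]|].
  split; [now apply is_dual_comb|]. intros z' t' Ht'. pose proof (T_dual _ _ Ht') as Hd'.
  pose proof (mono_le X T HT _ _ _ _ Ht' Ht) as K. dsimp. dsimp in K. lra.
Qed.

(** Graph points over x itself contribute the zero vector at zero cost, so weights can be raised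
    freely. This is where x in D_T pays off. *)
Lemma TC_pad (l l' : R) (y : X) (ys : X -> R) (r : R) :
  TC l y ys r -> l <= l' -> exists ys', TC l' y ys' r.
Proof.
  intros H Hl. destruct related_point_dom as ((a0 & Ha0) & _).
  pose proof (TC_add _ _ _ _ _ _ _ _ H
    (TC_scal (l' - l) _ _ _ _ ltac:(lra) (TC_graph x a0 Ha0))) as K.
  replace (l + (l' - l) * 1) with l' in K by ring.
  pose proof (T_dual _ _ Ha0).
  replace (y [+] (l' - l) [*] (x [-] x)) with y in K by vec.
  replace (r + (l' - l) * (a0 (x [-] x) - xh (x [-] x))) with r in K by (dsimp; ring).
  eexists. exact K.
Qed.

Lemma SC_add (l l' : R) (y y' : X) (ys ys' : X -> R) (r r' : R) :
  SC l y ys r -> SC l' y' ys' r' ->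
  SC (l + l') (y [+] y') (fun v => 1 * ys v + 1 * ys' v) (r + r').
Proof.
  intros (H1 & (c & Hc & ->) & H3 & H4) (H1' & (c' & Hc' & ->) & H3' & H4'). split; [lra|].
  split.
  { destruct (convex_cone_add X C x c c' l l' HC) as (c2 & Hc2 & E); auto. now exists c2. }
  split; [now apply is_dual_comb|]. intros z t Ht. specialize (H4 z t Ht). specialize (H4' z t Ht).
  pose proof (mono_dual X S HS _ _ Ht). rewrite (dual_add X t) by auto. lra.
Qed.

Lemma SC_scal (a l : R) (y : X) (ys : X -> R) (r : R) :
  0 <= a -> SC l y ys r -> SC (a * l) (a [*] y) (fun v => a * ys v + 0 * ys v) (a * r).
Proof.
  intros Ha (H1 & (c & Hc & ->) & H3 & H4). split; [now apply Rmult_le_pos|].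
  split; [exists c; split; auto; vec|].
  split; [now apply is_dual_comb|]. intros z t Ht. specialize (H4 z t Ht).
  pose proof (mono_dual X S HS _ _ Ht). rewrite (dual_scal X t) by auto.
  apply (Rmult_le_compat_l a) in H4; auto. lra.
Qed.

Lemma SC_graph (z : X) (s : X -> R) : S z s -> SC 1 (z [-] x) s (s (z [-] x)).
Proof.
  intros Hz. pose proof (mono_dual X S HS _ _ Hz) as Hd. split; [lra|].
  split; [exists z; split; [apply dom_S_closure; now exists s|vec]|].
  split; auto. intros z' s' Hs'. pose proof (mono_dual X S HS _ _ Hs') as Hd'.
  pose proof (mono_le X S HS _ _ _ _ Hs' Hz) as K. dsimp. dsimp in K. lra.
Qed.

Lemma SC_pad (l l' : R) (y : X) (ys : X -> R) (r : R) :
  SC l y ys r -> l <= l' -> exists ys', SC l' y ys' r.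
Proof.
  intros H Hl. destruct related_point_dom as (_ & (b0 & Hb0)).
  pose proof (SC_add _ _ _ _ _ _ _ _ H
    (SC_scal (l' - l) _ _ _ _ ltac:(lra) (SC_graph x b0 Hb0))) as K.
  replace (l + (l' - l) * 1) with l' in K by ring.
  pose proof (mono_dual X S HS _ _ Hb0).
  replace (y [+] (l' - l) [*] (x [-] x)) with y in K by vec.
  replace (r + (l' - l) * b0 (x [-] x)) with r in K by (dsimp; ring).
  eexists. exact K.
Qed.

(** The points admitting some Fitzpatrick bound form a convex set that contains D_T. *)
Lemma TC_co (a : X) : co X (dom X T) a -> exists ys r, TC 1 (a [-] x) ys r.
Proof.
  intros Ha.
  assert (K : exists ys r, is_dual X ys /\ forall z t, T z t ->
     ys (z [-] x) + (t (a [-] x) - xh (a [-] x)) - (t (z [-] x) - xh (z [-] x)) <= r).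
  { apply Ha.
    - intros u v tau (ys & r & Hd & H) (ys' & r' & Hd' & H') Htau.
      exists (fun p => (1 - tau) * ys p + tau * ys' p), ((1 - tau) * r + tau * r').
      split; [now apply is_dual_comb|]. intros z t Ht. specialize (H z t Ht). specialize (H' z t Ht).
      pose proof (T_dual _ _ Ht).
      apply (Rmult_le_compat_l (1 - tau)) in H; [|lra].
      apply (Rmult_le_compat_l tau) in H'; [|lra].
      dsimp. dsimp in H. dsimp in H'. lra.
    - intros z (t & Ht). exists (fun v => 1 * t v + (-1) * xh v), (t (z [-] x) - xh (z [-] x)).
      pose proof (T_dual _ _ Ht) as Hd.
      split; [now apply is_dual_comb|]. intros z' t' Ht'. pose proof (T_dual _ _ Ht') as Hd'.
      pose proof (mono_le X T HT _ _ _ _ Ht' Ht) as K. dsimp. dsimp in K. lra. }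
  destruct K as (ys & r & Hd & K). exists ys, r. split; [lra|].
  split; [apply F_sub; auto; apply C_x|]. split; auto. intros z t Ht. specialize (K z t Ht). lra.
Qed.

(** * The open mapping argument in the generated subspace *)

(** N bounds the cost and the functional of the T-side; of the S-side only the closeness of d to x0
    is recorded. *)
Definition bounded_diff (eps N : R) (v : X) : Prop :=
  exists y ys r d, TC 1 y ys r /\ r <= N /\ (forall u, Rabs (ys u) <= N * norm u) /\
    dom X S d /\ norm (d [-] x0) < eps /\ v = y [-] (d [-] x).

Lemma bounded_diff_point (eps N : R) (y c : X) (ys : X -> R) (r : R) :
  TC 1 y ys r -> r <= N -> (forall u, Rabs (ys u) <= N * norm u) -> C c -> norm (c [-] x0) < eps ->
  bclosure X (bounded_diff eps N) (y [-] (c [-] x)).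
Proof.
  intros Hy Hr Hb Hc Hn e He.
  destruct (Hc (Rmin e (eps - norm (c [-] x0)))) as (d & Hd & Hdc); [apply Rmin_glb_lt; lra|].
  pose proof (Rmin_l e (eps - norm (c [-] x0))). pose proof (Rmin_r e (eps - norm (c [-] x0))).
  exists (y [-] (d [-] x)). split.
  - exists y, ys, r, d. repeat (split; auto). pose proof (norm_sub_triangle X d c x0). lra.
  - replace ((y [-] (d [-] x)) [-] (y [-] (c [-] x))) with (c [-] d) by vec.
    rewrite norm_sub_sym. lra.
Qed.

Lemma Rabs_comb_le (a b p q N n : R) :
  0 <= a -> 0 <= b -> a + b = 1 -> Rabs p <= N * n -> Rabs q <= N * n ->
  Rabs (a * p + b * q) <= N * n.
Proof.
  intros Ha Hb Hab Hp Hq. eapply Rle_trans; [apply Rabs_triang|].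
  rewrite !Rabs_mult, (Rabs_pos_eq a), (Rabs_pos_eq b) by auto.
  replace (N * n) with (a * (N * n) + b * (N * n)) by (rewrite <- Rmult_plus_distr_r, Hab; ring).
  apply Rplus_le_compat; apply Rmult_le_compat_l; auto.
Qed.

(** Contracting a and c towards the common point x0 by t = lam/k multiplies a - c by t and brings
    the contracted c within eps of x0. So v = lam(a - c) is k times such a difference, and one large
    k dominates all the bounds. *)
Lemma bounded_diff_cover (eps : R) (v : X) :
  0 < eps -> F v ->
  exists n, bclosure X (fun u => exists v1, bounded_diff eps (INR (n + 1)) v1 /\
                                  u = INR (n + 1) [*] v1) v.
Proof.
  intros Heps (lam & a & c & Hlam & Ha & Hc & Ev).
  destruct (TC_co a Ha) as (ys & r & Hys).
  destruct (TC_co x0 (co_dom x0 HTx0)) as (ys0 & r0 & Hys0).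
  destruct (dual_bound X ys) as (B & HB & Hb); [apply Hys|].
  destruct (dual_bound X ys0) as (B0 & HB0 & Hb0); [apply Hys0|].
  pose proof (vnorm_nonneg X (c [-] x0)) as Hnc.
  pose proof (Rabs_pos r). pose proof (Rabs_pos r0).
  pose proof (Rle_abs r). pose proof (Rle_abs r0).
  assert (Hq : 0 <= lam * norm (c [-] x0) / eps).
  { apply Rmult_le_pos; [nra|]. left. now apply Rinv_0_lt_compat. }
  destruct (INR_unbounded (lam + lam * norm (c [-] x0) / eps + B + B0 + Rabs r + Rabs r0))
    as (n & Hn).
  exists n. rewrite plus_INR. simpl (INR 1). set (k := INR n + 1) in *.
  assert (Hk : 0 < k) by (unfold k; lra).
  set (t := lam / k).
  assert (Ht : 0 <= t <= 1).
  { split; [apply Rlt_le, Rdiv_lt_0_compat; lra|].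
    apply (Rmult_le_reg_r k); auto. unfold t. replace (lam / k * k) with lam by (field; lra).
    unfold k. lra. }
  assert (Htk : k * t = lam) by (unfold t; field; lra).
  assert (Htc : t * norm (c [-] x0) < eps).
  { apply (Rmult_lt_reg_l k); auto.
    replace (k * (t * norm (c [-] x0))) with (k * t * norm (c [-] x0)) by ring. rewrite Htk.
    assert (E : eps * (lam * norm (c [-] x0) / eps) = lam * norm (c [-] x0)) by (field; lra).
    rewrite <- E, (Rmult_comm k). apply Rmult_lt_compat_l; auto. unfold k. lra. }
  set (ct := (1 - t) [*] x0 [+] t [*] c).
  assert (HTC : TC 1 ((1 - t) [*] (x0 [-] x) [+] t [*] (a [-] x))
             (fun v => 1 * ((1 - t) * ys0 v + 0 * ys0 v) + 1 * (t * ys v + 0 * ys v))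
             ((1 - t) * r0 + t * r)).
  { replace 1 with ((1 - t) * 1 + t * 1) at 1 by ring.
    apply TC_add; apply TC_scal; auto; lra. }
  assert (Hcl := bounded_diff_point eps k _ ct _ _ HTC). intros e He.
  destruct Hcl with (eps := e / k) as (v1 & Hv1 & Hd).
  - apply Rle_trans with ((1 - t) * Rabs r0 + t * Rabs r); [nra|]. unfold k. nra.
  - intros u. replace (1 * ((1 - t) * ys0 u + 0 * ys0 u) + 1 * (t * ys u + 0 * ys u))
      with ((1 - t) * ys0 u + t * ys u) by ring.
    pose proof (vnorm_nonneg X u).
    apply Rabs_comb_le; try lra.
    + eapply Rle_trans; [apply Hb0|]. apply Rmult_le_compat_r; auto. unfold k. lra.
    + eapply Rle_trans; [apply Hb|]. apply Rmult_le_compat_r; auto. unfold k. lra.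
  - apply HC; auto. apply dom_S_closure, Hdir.
  - unfold ct. replace (((1 - t) [*] x0 [+] t [*] c) [-] x0) with (t [*] (c [-] x0)) by vec.
    rewrite norm_scal_pos; lra.
  - apply Rdiv_lt_0_compat; auto.
  - exists (k [*] v1). split; [now exists v1|].
    replace (k [*] v1 [-] v) with
      (k [*] (v1 [-] (((1 - t) [*] (x0 [-] x) [+] t [*] (a [-] x)) [-] (ct [-] x)))).
    + rewrite norm_scal_pos by lra. apply (Rmult_lt_compat_l k) in Hd; auto.
      replace (k * (e / k)) with e in Hd by (field; lra). exact Hd.
    + rewrite Ev. unfold ct. rewrite <- Htk. vec.
Qed.

(** Baire gives density near some v0; averaging with a point near -v0, with weights k/(k + l) and
    l/(k + l), moves the ball to the origin. *)
Lemma bounded_diff_dense (eps : R) :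
  0 < eps -> exists r N, 0 < r /\ 1 <= N /\
    forall v, F v -> norm v < r -> bclosure X (bounded_diff eps N) v.
Proof.
  intros Heps. destruct HF as (F0 & Fadd & Fscal & Fcl).
  destruct (baire X F (fun n u => exists v1, bounded_diff eps (INR (n + 1)) v1 /\
              u = INR (n + 1) [*] v1) [0]) as (n & v0 & rho & Hv0 & Hrho & Hball); auto.
  { intros v Hv. now apply bounded_diff_cover. }
  destruct (bounded_diff_cover eps ((-1) [*] v0)) as (m & Hm); auto.
  { now apply Fscal. }
  assert (Hpos : forall n, 1 <= INR (n + 1)).
  { intros i. rewrite plus_INR. pose proof (pos_INR i). simpl. lra. }
  pose proof (Hpos n) as Hk. pose proof (Hpos m) as Hl.
  set (k := INR (n + 1)) in *. set (l := INR (m + 1)) in *.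
  exists (rho / (k + l)), (k + l).
  split; [apply Rdiv_lt_0_compat; lra|]. split; [lra|].
  intros v Hv Hvr e He.
  assert (Hnear : bclosure X (fun u => exists v1, bounded_diff eps k v1 /\ u = k [*] v1)
                    (v0 [+] (k + l) [*] v)).
  { apply Hball; [apply F_add; auto; now apply F_scal|]. replace ((v0 [+] (k + l) [*] v) [-] v0) with ((k + l) [*] v) by vec.
    rewrite norm_scal_pos by lra. apply (Rmult_lt_compat_l (k + l)) in Hvr; [|lra].
    replace ((k + l) * (rho / (k + l))) with rho in Hvr by (field; lra). exact Hvr. }
  destruct (Hnear (e / 4)) as (u1 & (v1 & Hv1 & ->) & D1); [lra|].
  destruct (Hm (e / 4)) as (u2 & (v2 & Hv2 & ->) & D2); [lra|].
  destruct Hv1 as (y1 & ys1 & r1 & d1 & Hy1 & Hr1 & Hb1 & Hd1 & Hn1 & ->).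
  destruct Hv2 as (y2 & ys2 & r2 & d2 & Hy2 & Hr2 & Hb2 & Hd2 & Hn2 & ->).
  set (p := k / (k + l)). set (q := l / (k + l)).
  assert (Hp : 0 <= p) by (apply Rlt_le, Rdiv_lt_0_compat; lra).
  assert (Hq : 0 <= q) by (apply Rlt_le, Rdiv_lt_0_compat; lra).
  assert (Hpq : p + q = 1) by (unfold p, q; field; lra).
  assert (HTC : TC 1 (p [*] y1 [+] q [*] y2)
             (fun v => 1 * (p * ys1 v + 0 * ys1 v) + 1 * (q * ys2 v + 0 * ys2 v)) (p * r1 + q * r2)).
  { replace 1 with (p * 1 + q * 1) at 1 by lra. apply TC_add; now apply TC_scal. }
  set (c3 := (1 - q) [*] d1 [+] q [*] d2).
  destruct (bounded_diff_point eps (k + l) _ c3 _ _ HTC) with (eps := e / 2) as (v3 & Hv3 & D3).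
  - nra.
  - intros u. replace (1 * (p * ys1 u + 0 * ys1 u) + 1 * (q * ys2 u + 0 * ys2 u))
      with (p * ys1 u + q * ys2 u) by ring.
    pose proof (vnorm_nonneg X u). apply Rabs_comb_le; auto.
    + eapply Rle_trans; [apply Hb1|]. apply Rmult_le_compat_r; auto. lra.
    + eapply Rle_trans; [apply Hb2|]. apply Rmult_le_compat_r; auto. lra.
  - apply HC; try lra; now apply dom_S_closure.
  - replace (c3 [-] x0) with (p [*] (d1 [-] x0) [+] q [*] (d2 [-] x0)).
    + pose proof (vnorm_triangle X (p [*] (d1 [-] x0)) (q [*] (d2 [-] x0))) as K.
      rewrite !norm_scal_pos in K by auto.
      assert (p * norm (d1 [-] x0) + q * norm (d2 [-] x0) < eps); [|lra].
      destruct Hp as [Hp|Hp]; nra.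
    + unfold c3. replace p with (1 - q) by lra. vec.
  - lra.
  - exists v3. split; auto.
    set (base := (p [*] y1 [+] q [*] y2) [-] (c3 [-] x)) in *.
    assert (E : base [-] v = / (k + l) [*] ((k [*] (y1 [-] (d1 [-] x)) [-] (v0 [+] (k + l) [*] v)) [+]
                 (l [*] (y2 [-] (d2 [-] x)) [-] (-1) [*] v0))).
    { unfold base, c3. replace (1 - q) with p by lra. unfold p, q. vecf; lra. }
    assert (Hbv : norm (base [-] v) <= e / 2).
    { rewrite E, norm_scal_pos by (left; apply Rinv_0_lt_compat; lra).
      pose proof (vnorm_triangle X (k [*] (y1 [-] (d1 [-] x)) [-] (v0 [+] (k + l) [*] v))
                    (l [*] (y2 [-] (d2 [-] x)) [-] (-1) [*] v0)) as K.
      assert (Hinv : 0 < / (k + l) <= 1).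
      { split; [apply Rinv_0_lt_compat; lra|]. rewrite <- Rinv_1. apply Rinv_le_contravar; lra. }
      set (h := / (k + l)) in *.
      pose proof (vnorm_nonneg X ((k [*] (y1 [-] (d1 [-] x)) [-] (v0 [+] (k + l) [*] v)) [+]
                    (l [*] (y2 [-] (d2 [-] x)) [-] (-1) [*] v0))) as K2.
      apply Rle_trans with (1 * norm ((k [*] (y1 [-] (d1 [-] x)) [-] (v0 [+] (k + l) [*] v)) [+]
                    (l [*] (y2 [-] (d2 [-] x)) [-] (-1) [*] v0))); [|lra].
      apply Rmult_le_compat_r; lra. }
    pose proof (norm_sub_triangle X v3 base v). lra.
Qed.

Record series_state : Type := {
  st_idx : nat; st_err : X; st_y : X; st_ys : X -> R; st_r : R; st_d : X }.

(* The successive-approximation argument of the open mapping theorem, with the n-th correction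
   taken from points of dom S within (1/2)^n of x0. *)
Lemma series_expansion (epsx : R) :
  0 < epsx -> exists rho0, 0 < rho0 /\ forall v, F v -> norm v < rho0 ->
  exists mu Y ys b d Y',
    TC mu Y ys 2 /\ mu <= 2 /\ (forall n, 0 < b n) /\
    (forall n, dom X S (d n) /\ norm (d n [-] x0) < epsx) /\ cvg X d x0 /\
    cvg X (psum X (fun n => b n [*] (d n [-] x))) Y' /\ v = Y [-] Y' /\
    (forall n, rsum b n <= mu) /\ Un_cv (rsum b) mu.
Proof.
  intros Hepsx.
  (* The second bound forces the d_i to converge to x0, at the price of N i that may grow
     arbitrarily. *)
  set (eps := fun i => Rmin epsx ((1 / 2) ^ i)).
  assert (Heps : forall i, 0 < eps i) by (intros i; apply Rmin_glb_lt; auto; apply half_pow_pos).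
  set (rN := fun i => constructive_indefinite_description
    (fun p => 0 < fst p /\ 1 <= snd p /\
       forall v, F v -> norm v < fst p -> bclosure X (bounded_diff (eps i) (snd p)) v)
    (let (r, H) := bounded_diff_dense (eps i) (Heps i) in
     let (N, H) := H in ex_intro _ (r, N) H)).
  set (r := fun i => fst (proj1_sig (rN i))). set (N := fun i => snd (proj1_sig (rN i))).
  assert (Hr : forall i, 0 < r i) by (intros i; apply (proj2_sig (rN i))).
  assert (HN : forall i, 1 <= N i) by (intros i; apply (proj2_sig (rN i))).
  assert (Hden : forall i v, F v -> norm v < r i -> bclosure X (bounded_diff (eps i) (N i)) v).
  { intros i. apply (proj2_sig (rN i)). }
  clearbody r N. clear rN.
  (* The invariant |e_k| < b_k rr_k puts e_k / b_k into the ball of stage k, and with rr_k <= 1 it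
     also makes the errors tend to zero. *)
  set (rr := fun i => Rmin 1 (r i)).
  assert (Hrr : forall i, 0 < rr i) by (intros i; apply Rmin_glb_lt; auto; lra).
  (* Since b_i N_i = 2^-i, costs and functionals of the T-side are summable however fast N_i grows;
     both sums are at most 2. *)
  set (b := fun i => (1 / 2) ^ i / N i).
  assert (Hb : forall i, 0 < b i).
  { intros i. apply Rdiv_lt_0_compat; [apply half_pow_pos|]. specialize (HN i). lra. }
  assert (HbN : forall i, b i * N i = (1 / 2) ^ i).
  { intros i. unfold b. specialize (HN i). field. lra. }
  assert (Hb1 : forall i, b i <= (1 / 2) ^ i).
  { intros i. rewrite <- HbN. specialize (HN i). specialize (Hb i). nra. }
  exists (b O * rr O). split; [apply Rmult_lt_0_compat; auto|].
  intros v Hv Hvn.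
  destruct (dependent_choice series_state
    (fun st => F (st_err st) /\ norm (st_err st) < b (st_idx st) * rr (st_idx st))
    (fun _ st st' => let k := st_idx st in
       st_idx st' = Datatypes.S k /\ TC 1 (st_y st') (st_ys st') (st_r st') /\
       st_r st' <= N k /\ (forall u, Rabs (st_ys st' u) <= N k * norm u) /\
       dom X S (st_d st') /\ norm (st_d st' [-] x0) < eps k /\
       st_err st' = st_err st [-] b k [*] (st_y st' [-] (st_d st' [-] x)))
    (* The zero entries are dummies: the k-th correction is stored in state k + 1, which explains
       the shifts below. *)
    {| st_idx := 0; st_err := v; st_y := [0]; st_ys := fun _ => 0; st_r := 0; st_d := [0] |})
    as (f & Hf0 & Hf).
  - simpl. auto.
  - intros _ st (He & Hen). set (k := st_idx st) in *.
    set (e := st_err st) in *. specialize (Hb k) as Hbk. specialize (Hb (Datatypes.S k)) as Hbk'.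
    specialize (Hrr (Datatypes.S k)) as Hrk.
    assert (Hi : 0 < / b k) by now apply Rinv_0_lt_compat.
    destruct (Hden k (/ b k [*] e) (F_scal _ _ He)) with
      (eps := b (Datatypes.S k) * rr (Datatypes.S k) / b k) as (v1 & Hv1 & Hd).
    + rewrite norm_scal_pos by lra. apply (Rmult_lt_reg_l (b k)); auto.
      rewrite <- Rmult_assoc, Rinv_r, Rmult_1_l by lra.
      apply Rlt_le_trans with (b k * rr k); auto. apply Rmult_le_compat_l; [lra|]. apply Rmin_r.
    + apply Rdiv_lt_0_compat; auto. now apply Rmult_lt_0_compat.
    + destruct Hv1 as (y & ys & r1 & d & Hy & Hr1 & Hys & Hdd & Hdn & ->).
      exists {| st_idx := Datatypes.S k; st_err := e [-] b k [*] (y [-] (d [-] x));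
                st_y := y; st_ys := ys; st_r := r1; st_d := d |}.
      simpl. split; [split|repeat split; auto; apply Hy].
      * unfold vsub at 1. apply F_add; auto. rewrite vopp_scal. apply F_scal, F_scal.
        unfold vsub at 1. apply F_add; [apply Hy|]. rewrite vopp_scal.
        apply F_scal, F_point. now apply dom_S_closure.
      * replace (e [-] b k [*] (y [-] (d [-] x))) with
          (vopp X (b k [*] ((y [-] (d [-] x)) [-] / b k [*] e))) by (vecf; lra).
        rewrite norm_opp, norm_scal_pos by lra.
        apply (Rmult_lt_compat_l (b k)) in Hd; auto.
        replace (b k * (b (Datatypes.S k) * rr (Datatypes.S k) / b k)) with
          (b (Datatypes.S k) * rr (Datatypes.S k)) in Hd by (field; lra). exact Hd.
  - assert (Hidx : forall k, st_idx (f k) = k).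
    { induction k as [|k IH]; [now rewrite Hf0|]. destruct (Hf k) as (_ & E & _). now rewrite E, IH. }
    set (e := fun k => st_err (f k)). set (y := fun k => st_y (f (Datatypes.S k))).
    set (ysq := fun k => st_ys (f (Datatypes.S k))). set (r1 := fun k => st_r (f (Datatypes.S k))).
    set (d := fun k => st_d (f (Datatypes.S k))).
    assert (Hst : forall k, TC 1 (y k) (ysq k) (r1 k) /\ r1 k <= N k /\
        (forall u, Rabs (ysq k u) <= N k * norm u) /\ dom X S (d k) /\
        norm (d k [-] x0) < eps k /\ e (Datatypes.S k) = e k [-] b k [*] (y k [-] (d k [-] x))).
    { intros k. destruct (Hf k) as (_ & _ & H). rewrite (Hidx k) in H. exact H. }
    assert (He0 : e O = v) by (unfold e; now rewrite Hf0).
    assert (Hen : forall k, norm (e k) <= (1 / 2) ^ k).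
    { intros k. destruct (Hf k) as ((_ & H) & _). rewrite (Hidx k) in H. fold (e k) in H.
      assert (rr k <= 1) by apply Rmin_l. specialize (Hb1 k). specialize (Hb k).
      specialize (Hrr k). nra. }
    clearbody e y ysq r1 d. clear f Hf0 Hf Hidx.
    set (D := norm (x0 [-] x) + epsx).
    assert (HdD : forall k, norm (d k [-] x) <= D).
    { intros k. destruct (Hst k) as (_ & _ & _ & _ & H & _).
      assert (eps k <= epsx) by apply Rmin_l. pose proof (norm_sub_triangle X (d k) x0 x).
      unfold D. lra. }
    set (U := psum X (fun n => b n [*] (d n [-] x))).
    set (V := psum X (fun n => b n [*] y n)).
    assert (HVU : forall n, e n = v [-] (V n [-] U n)).
    { induction n as [|n IH]; [rewrite He0; unfold V, U; simpl; vec|].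
      destruct (Hst n) as (_ & _ & _ & _ & _ & E). rewrite E, IH. unfold V, U. simpl. vec. }
    destruct (geometric_cvg X U D) as (Y' & HY').
    { intros n. unfold U. simpl.
      match goal with |- norm ?a <= _ => replace a with (b n [*] (d n [-] x)) by vec end.
      specialize (Hb n). specialize (Hb1 n). specialize (HdD n).
      rewrite norm_scal_pos by lra. pose proof (vnorm_nonneg X (d n [-] x)).
      pose proof (half_pow_pos n). rewrite Rmult_comm. apply Rmult_le_compat; lra. }
    assert (HV : cvg X V (v [+] Y')).
    { intros h Hh. destruct (HY' (h / 2)) as (N1 & HN1); [lra|].
      destruct (half_pow_small (h / 2)) as (N2 & HN2); [lra|].
      exists (max N1 N2). intros n Hn. specialize (HN1 n ltac:(lia)).
      pose proof (half_pow_antitone n N2 ltac:(lia)). specialize (Hen n).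
      replace (V n [-] (v [+] Y')) with ((U n [-] Y') [-] e n) by (rewrite HVU; vec).
      pose proof (norm_sub_le X (U n [-] Y') (e n)). lra. }
    destruct (rsum_cvg b 1) as (mu & Hmu).
    { intros n. rewrite Rabs_pos_eq by (left; auto). rewrite Rmult_1_l. auto. }
    assert (Hmule : forall n, rsum b n <= mu).
    { intros n. apply growing_ineq; auto. intros k. simpl. specialize (Hb k). lra. }
    assert (Hmu2 : mu <= 2).
    { apply (Un_cv_le (rsum b)); auto. intros n.
      assert (K : forall k, Rabs (b k) <= 1 * (1 / 2) ^ k).
      { intros k. rewrite Rabs_pos_eq by (left; auto). rewrite Rmult_1_l. auto. }
      pose proof (rsum_bound b 1 K n). pose proof (Rle_abs (rsum b n)).
      pose proof (half_pow_pos n). lra. }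
    assert (Hpart : forall n, exists ws, TC (rsum b n) (V n) ws (2 - 2 * (1 / 2) ^ n) /\
              forall u, ws u = rsum (fun k => b k * ysq k u) n).
    { induction n as [|n (ws & IH1 & IH2)].
      - exists (fun _ => 0). split; [|reflexivity]. unfold V. simpl. split; [lra|].
        split; [apply F_zero|]. split; [apply is_dual_zero|].
        intros z t Ht. pose proof (T_dual _ _ Ht). dsimp. lra.
      - destruct (Hst n) as (H1 & H2 & _).
        pose proof (TC_add _ _ _ _ _ _ _ _ IH1 (TC_scal (b n) _ _ _ _ (Rlt_le _ _ (Hb n)) H1)) as K.
        rewrite Rmult_1_r in K.
        exists (fun u => 1 * ws u + 1 * (b n * ysq n u + 0 * ysq n u)). split.
        + destruct K as (K1 & K2 & K3 & K4).
          change (rsum b (Datatypes.S n)) with (rsum b n + b n).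
          change (V (Datatypes.S n)) with (V n [+] b n [*] y n).
          change ((1 / 2) ^ Datatypes.S n) with (1 / 2 * (1 / 2) ^ n).
          split; [exact K1|]. split; [exact K2|]. split; [exact K3|]. intros z t Ht. specialize (K4 z t Ht).
          apply (Rmult_le_compat_l (b n)) in H2; [|left; auto]. rewrite HbN in H2. lra.
        + intros u. rewrite IH2. simpl. ring. }
    assert (Hysb : forall u n, Rabs (b n * ysq n u) <= norm u * (1 / 2) ^ n).
    { intros u n. destruct (Hst n) as (_ & _ & H & _). specialize (H u).
      rewrite Rabs_mult, Rabs_pos_eq by (left; auto).
      apply (Rmult_le_compat_l (b n)) in H; [|left; auto].
      rewrite <- Rmult_assoc, HbN in H. lra. }
    set (lim := fun u => constructive_indefinite_description _ (rsum_cvg _ _ (Hysb u))).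
    set (yl := fun u => proj1_sig (lim u)).
    assert (Hyl : forall u, Un_cv (rsum (fun k => b k * ysq k u)) (yl u)).
    { intros u. exact (proj2_sig (lim u)). }
    clearbody yl. clear lim.
    assert (Hydual : forall n, is_dual X (fun u => rsum (fun k => b k * ysq k u) n)).
    { intros n. destruct (Hpart n) as (ws & (_ & _ & Hd & _) & E).
      apply (is_dual_ext X ws); auto. }
    assert (Hyld : is_dual X yl).
    { apply (linear_bound X yl 2).
      - intros u w. apply (UL_sequence (rsum (fun k => b k * ysq k (u [+] w)))); auto.
        intros h Hh. destruct (CV_plus _ _ _ _ (Hyl u) (Hyl w) h Hh) as (N1 & HN1).
        exists N1. intros n Hn. rewrite (dual_add X _ u w (Hydual n)). now apply HN1.
      - intros a u. apply (UL_sequence (rsum (fun k => b k * ysq k (a [*] u)))); auto.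
        intros h Hh. destruct (CV_mult _ _ _ _ (Un_cv_const a) (Hyl u) h Hh) as (N1 & HN1).
        exists N1. intros n Hn. rewrite (dual_scal X _ a u (Hydual n)). now apply HN1.
      - intros u. apply (Un_cv_le _ _ _ (Hyl u)). intros n.
        pose proof (rsum_bound _ _ (Hysb u) n). pose proof (vnorm_nonneg X u).
        pose proof (half_pow_pos n). pose proof (Rle_abs (rsum (fun k => b k * ysq k u) n)). nra. }
    assert (Hmu0 : 0 <= mu) by apply (Hmule O).
    exists mu, (v [+] Y'), yl, b, d, Y'. split; [|split; [|split; [|split; [|split; [|split; [|split]]]]]]; auto.
    + split; auto. split.
      { apply (cvg_closed X F V); auto; [apply F_closed|]. intros n. destruct (Hpart n) as (ws & H & _).
        apply H. }
      split; auto. intros z t Ht. pose proof (T_dual _ _ Ht) as Hdt.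
      pose proof (CV_minus _ _ _ _
        (CV_plus _ _ _ _ (Hyl (z [-] x))
          (CV_minus _ _ _ _ (dual_cvg X t _ _ Hdt HV) (dual_cvg X xh _ _ Hxh HV)))
        (CV_mult _ _ _ _ Hmu (Un_cv_const (t (z [-] x) - xh (z [-] x))))) as Hc.
      apply (Un_cv_le _ _ _ Hc). intros n. destruct (Hpart n) as (ws & (_ & _ & _ & K) & E).
      specialize (K z t Ht). rewrite E in K. pose proof (half_pow_pos n). lra.
    + intros n. destruct (Hst n) as (_ & _ & _ & H1 & H2 & _). split; auto.
      assert (eps n <= epsx) by apply Rmin_l. lra.
    + intros h Hh. destruct (half_pow_small h Hh) as (N1 & HN1). exists N1. intros n Hn.
      destruct (Hst n) as (_ & _ & _ & _ & H & _).
      assert (eps n <= (1 / 2) ^ n) by apply Rmin_r.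
      pose proof (half_pow_antitone n N1 ltac:(lia)). lra.
    + vec.
Qed.

(** * The lower bound and the splitting *)

(** A pair violating the bound is corrected by g times the expansion of -v/g, after which the T-side
    point is the limit of the S-side combinations. The correction costs at most g A, too little to
    make the total nonnegative, against [series_contradiction]. *)
Lemma splitting_lower_bound :
  exists N, 0 <= N /\ forall l y ys r1 m w ws r2,
    TC l y ys r1 -> SC m w ws r2 -> - (N * norm (y [-] w)) <= r1 + r2.
Proof.
  destruct related_point_dom as (HTx & HSx).
  destruct (proj2 Hdir x) as (epsx & Mx & Hepsx & HMx & Hz).
  set (D := epsx + norm (x0 [-] x)).
  assert (HD : 0 < D) by (pose proof (vnorm_nonneg X (x0 [-] x)); unfold D; lra).
  assert (HdD : forall d, norm (d [-] x0) < epsx -> norm (d [-] x) <= D).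
  { intros d Hd. pose proof (norm_sub_triangle X d x0 x). unfold D. lra. }
  set (M := Mx * D). assert (HM : 0 <= M) by (apply Rmult_le_pos; lra).
  assert (HSM : forall d, dom X S d -> norm (d [-] x0) < epsx -> exists s, S d s /\ s (d [-] x) <= M).
  { intros d Hd Hdn. destruct (Hz d) as (s & Hs & Hle); auto.
    - exists 1, d. split; [lra|]. split; [exact Hdn|vec].
    - exists s. split; auto. eapply Rle_trans; [apply Hle|].
      apply Rmult_le_compat_l; [lra|auto]. }
  destruct (series_expansion epsx Hepsx) as (rho0 & Hrho0 & Hser).
  (* Cost of a unit expansion: 2 on the T-side, and M per unit of weight on the S-side, whose weight
     is at most 2. *)
  set (A := 2 + 2 * M). assert (HA : 0 < A) by (unfold A; lra).
  assert (HN : 0 <= A * (2 / rho0)).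
  { apply Rmult_le_pos; [lra|]. apply Rlt_le, Rdiv_lt_0_compat; lra. }
  exists (A * (2 / rho0)). split; auto.
  intros l y ys r1 m w ws r2 Hy Hw. apply Rnot_lt_le. intros Hlt.
  set (v := y [-] w) in *. pose proof (vnorm_nonneg X v) as Hnv.
  set (dl := - (r1 + r2) - A * (2 / rho0) * norm v).
  assert (Hdl : 0 < dl) by (unfold dl; lra).
  (* Large enough for v/g to be in the ball of radius rho0, even if v = 0, and small enough to
     consume only half of the margin dl. *)
  set (g := 2 / rho0 * norm v + dl / (2 * A)).
  assert (Hdl2 : 0 < dl / (2 * A)) by (apply Rdiv_lt_0_compat; lra).
  assert (Hg0 : 0 <= 2 / rho0 * norm v).
  { apply Rmult_le_pos; auto. apply Rlt_le, Rdiv_lt_0_compat; lra. }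
  assert (Hg : 0 < g) by (unfold g; lra).
  assert (HgA : r1 + r2 + g * A < 0).
  { assert (E : g * A = A * (2 / rho0) * norm v + dl / 2) by (unfold g; field; lra).
    rewrite E. unfold dl in *. lra. }
  assert (Hvg : norm v < g * rho0).
  { assert (E : g * rho0 = 2 * norm v + dl / (2 * A) * rho0) by (unfold g; field; lra).
    assert (0 < dl / (2 * A) * rho0) by now apply Rmult_lt_0_compat. lra. }
  assert (Hig : 0 < / g) by now apply Rinv_0_lt_compat.
  destruct Hw as (Hm & (c & Hc & Ew) & Hws & HwS).
  destruct (Hser ((- / g) [*] v)) as (muE & Y & ysE & b & d & Y' & HTE & HmuE & Hb & Hd & Hdc & HU & Ev & Hble & Hbc).
  { apply F_scal. unfold v, vsub. apply F_add; [apply Hy|]. rewrite vopp_scal, Ew.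
    now apply F_scal, F_scal, F_point. }
  { rewrite vnorm_scal, Rabs_Ropp, Rabs_pos_eq by lra. apply (Rmult_lt_reg_l g); auto.
    rewrite <- Rmult_assoc, Rinv_r by lra. lra. }
  assert (HmuE0 : 0 <= muE) by apply (Hble O).
  assert (Hl : 0 <= l) by apply Hy.
  (* Scales the corrected weights l + g muE and m + g muE to at most 1, so that both sides can be
     padded. *)
  set (h := / (1 + l + m + 2 * g)).
  assert (Hh : 0 < h) by (apply Rinv_0_lt_compat; lra).
  assert (Hh1 : h * (1 + l + m + 2 * g) = 1) by (unfold h; field; lra).
  assert (HgE : g * muE <= 2 * g) by nra.
  assert (HgE0 : 0 <= g * muE) by (apply Rmult_le_pos; lra).
  assert (HhE : h * (l + g * muE) <= 1 /\ h * (m + g * muE) <= 1 /\ 0 <= h * (g * muE)).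
  { split; [|split]; [| |apply Rmult_le_pos; lra];
      rewrite <- Hh1; apply Rmult_le_compat_l; lra. }
  destruct HhE as (E1 & E2 & E3).
  assert (Hhg : 0 < h * g) by now apply Rmult_lt_0_compat.
  destruct (TC_pad _ 1 _ _ _ (TC_add _ _ _ _ _ _ _ _ (TC_scal h _ _ _ _ (Rlt_le _ _ Hh) Hy)
     (TC_scal (h * g) _ _ _ _ (Rlt_le _ _ Hhg) HTE))) as (ysf & HTf); [lra|].
  (* Padding to this weight leaves exactly h g muE for the series, so the weights [mn n] increase to
     1. *)
  set (m0 := 1 - h * g * muE).
  assert (HSCw : SC m w ws r2) by (split; auto; split; [now exists c|auto]).
  destruct (SC_pad _ m0 _ _ _ (SC_scal h _ _ _ _ (Rlt_le _ _ Hh) HSCw)) as (wsf & HSf);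
    [unfold m0; lra|].
  set (yf := h [*] y [+] (h * g) [*] Y) in *.
  set (wn := fun n => h [*] w [+] (h * g) [*] psum X (fun n => b n [*] (d n [-] x)) n).
  set (mn := fun n => m0 + h * g * rsum b n).
  assert (Hmn : forall n, mn n <= 1).
  { intros n. unfold mn, m0. specialize (Hble n). apply (Rmult_le_compat_l (h * g)) in Hble; lra. }
  assert (Hwn : forall n, wn (Datatypes.S n) = wn n [+] (h * g * b n) [*] (d n [-] x)).
  { intros n. unfold wn. simpl. vec. }
  assert (Hcw : cvg X wn yf).
  { intros e He. destruct (HU (e / (h * g))) as (N1 & HN1); [now apply Rdiv_lt_0_compat|].
    exists N1. intros n Hn. specialize (HN1 n Hn).
    assert (EY : Y = Y' [+] (- / g) [*] v) by (rewrite Ev; vec).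
    replace (wn n [-] yf) with ((h * g) [*] (psum X (fun n => b n [*] (d n [-] x)) n [-] Y')).
    - rewrite norm_scal_pos by lra. apply (Rmult_lt_compat_l (h * g)) in HN1; auto.
      replace (h * g * (e / (h * g))) with e in HN1 by (field; lra). exact HN1.
    - unfold wn, yf. rewrite EY. unfold v. vecf; lra. }
  assert (Hcone : forall n, 0 <= mn n /\ exists c, C c /\ wn n = mn n [*] (c [-] x)).
  { induction n as [|n (IH1 & c1 & Hc1 & IH2)].
    - destruct HSf as (Hm0 & (c2 & Hc2 & E) & _). unfold mn, wn. simpl.
      rewrite Rmult_0_r, Rplus_0_r, vscal_0r, vadd_0. split; auto. now exists c2.
    - destruct (convex_cone_add X C x c1 (d n) (mn n) (h * g * b n) HC) as (c2 & Hc2 & E); auto.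
      + now apply dom_S_closure, Hd.
      + apply Rmult_le_pos; [lra|]. left; auto.
      + assert (Em : mn (Datatypes.S n) = mn n + h * g * b n) by (unfold mn; simpl; ring).
        rewrite Em. split.
        * specialize (Hb n). assert (0 < h * g * b n) by now apply Rmult_lt_0_compat. lra.
        * exists c2. split; auto. rewrite Hwn, IH2. exact E. }
  assert (Hfin := series_contradiction yf ysf (h * r1 + h * g * 2) wn mn (fun n => h * g * b n) d wsf
            (h * r2) M D).
  assert (K : 0 <= h * r1 + h * g * 2 + h * r2 + M * (1 - mn O)).
  { apply Hfin; auto.
    - apply HTf.
    - apply HSf.
    - destruct HTf as (_ & _ & _ & K). intros z t Ht. specialize (K z t Ht). lra.
    - destruct HSf as (_ & _ & _ & K). intros z s Hs. specialize (K z s Hs).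
      unfold wn, mn. simpl. rewrite vscal_0r, vadd_0. lra.
    - intros n. unfold mn. simpl. ring.
    - intros n. now apply Rmult_lt_0_compat.
    - intros e He. destruct (Hbc (e / (h * g))) as (N1 & HN1); [now apply Rdiv_lt_0_compat|].
      exists N1. intros n Hn. specialize (HN1 n Hn). unfold Rdist in HN1.
      pose proof (Rle_abs (- (rsum b n - muE))) as K2. rewrite Rabs_Ropp in K2.
      assert (K3 : muE - rsum b n < e / (h * g)) by lra.
      apply (Rmult_lt_compat_l (h * g)) in K3; auto.
      replace (h * g * (e / (h * g))) with e in K3 by (field; lra). unfold mn, m0. lra.
    - intros n. destruct (Hd n). auto.
    - intros n. apply HdD, Hd.
    - apply (cvg_closed X C (fun n => x [+] wn n)); [apply bclosure_closed| |].
      + intros e He. destruct (Hcw e He) as (N1 & HN1). exists N1. intros n Hn.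
        replace ((x [+] wn n) [-] (x [+] yf)) with (wn n [-] yf) by vec. auto.
      + intros n. destruct (Hcone n) as (Hp & c1 & Hc1 & E). rewrite E.
        replace (x [+] mn n [*] (c1 [-] x)) with ((1 - mn n) [*] x [+] mn n [*] c1) by vec.
        apply HC; auto. apply C_x. }
  assert (Em : mn O = m0) by (unfold mn; simpl; ring). rewrite Em in K.
  assert (K2 : h * (r1 + r2 + g * A) < 0) by nra.
  assert (h * (M * (g * muE)) <= h * (M * (2 * g))).
  { apply Rmult_le_compat_l; [lra|]. now apply Rmult_le_compat_l. }
  unfold m0, A in *. lra.
Qed.

Lemma related_point_in_sum : op_add X T S x xh.
Proof.
  destruct splitting_lower_bound as (N & HN & Hlow).
  destruct (hahn_banach_cone X (fun v r => exists l y ys r1 m w ws r2,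
              TC l y ys r1 /\ SC m w ws r2 /\ v = y [-] w /\ r = r1 + r2) N) as (u & Hu & Hle); auto.
  - split.
    + intros v v' r r' (l & y & ys & r1 & m & w & ws & r2 & H1 & H2 & -> & ->)
        (l' & y' & ys' & r1' & m' & w' & ws' & r2' & H1' & H2' & -> & ->).
      eexists _, _, _, _, _, _, _, _.
      split; [apply (TC_add _ _ _ _ _ _ _ _ H1 H1')|].
      split; [apply (SC_add _ _ _ _ _ _ _ _ H2 H2')|]. split; [vec|ring].
    + intros a v r Ha (l & y & ys & r1 & m & w & ws & r2 & H1 & H2 & -> & ->).
      eexists _, _, _, _, _, _, _, _.
      split; [apply (TC_scal a _ _ _ _ (Rlt_le _ _ Ha) H1)|].
      split; [apply (SC_scal a _ _ _ _ (Rlt_le _ _ Ha) H2)|]. split; [vec|ring].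
  - intros v r (l & y & ys & r1 & m & w & ws & r2 & H1 & H2 & -> & ->). eauto.
  (* Pairing a graph point of one operator with the zero element of the other cone isolates each
     operator: xh + u is related to T at x and -u to S at x. *)
  - assert (Hzero : SC 0 [0] (fun _ => 0) 0).
    { split; [lra|]. split; [exists x; split; [apply C_x|vec]|]. split; [apply is_dual_zero|].
      intros z s Hs. pose proof (mono_dual X S HS _ _ Hs). dsimp. lra. }
    assert (HT0 : TC 0 [0] (fun _ => 0) 0).
    { split; [lra|]. split; [apply F_zero|]. split; [apply is_dual_zero|].
      intros z t Ht. pose proof (T_dual _ _ Ht). dsimp. lra. }
    exists (fun v => 1 * xh v + 1 * u v), (fun v => (-1) * u v + 0 * u v).
    split; [|split; [|intros; ring]].
    + apply HT; [now apply is_dual_comb|]. intros z t Ht. pose proof (T_dual _ _ Ht).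
      assert (K : u ((z [-] x) [-] [0]) <= t (z [-] x) - xh (z [-] x) + 0).
      { apply Hle. eexists _, _, _, _, _, _, _, _.
        split; [apply (TC_graph z t Ht)|]. split; [apply Hzero|auto]. }
      dsimp in K. dsimp. lra.
    + apply HS; [now apply is_dual_comb|]. intros z s Hs. pose proof (mono_dual X S HS _ _ Hs).
      assert (K : u ([0] [-] (z [-] x)) <= 0 + s (z [-] x)).
      { apply Hle. eexists _, _, _, _, _, _, _, _.
        split; [apply HT0|]. split; [apply (SC_graph z s Hs)|auto]. }
      dsimp in K. dsimp. lra.
Qed.
End Core.

(** * The sum theorem *)

Section Sum.
Variable X : Banach.
Variables T S : operator X.
Hypothesis HT : maximal_monotone X T.
Hypothesis HS : maximal_monotone X S.

Lemma op_add_monotone : monotone X (op_add X T S).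
Proof.
  split.
  - intros z h (t & s & Ht & Hs & E). apply (is_dual_ext X (fun v => 1 * t v + 1 * s v)).
    + intros v. rewrite E. ring.
    + apply is_dual_comb; [apply (proj1 HT) in Ht|apply (proj1 HS) in Hs]; auto.
  - intros z z' h h' (t & s & Ht & Hs & E) (t' & s' & Ht' & Hs' & E').
    pose proof (proj2 (proj1 HT) _ _ _ _ Ht Ht').
    pose proof (proj2 (proj1 HS) _ _ _ _ Hs Hs').
    rewrite E, E'. lra.
Qed.

Lemma sum_maximal (x0 : X) :
  bconvex X (bclosure X (dom X S)) ->
  (forall z, dom X T z -> bclosure X (dom X S) z -> dom X S z) ->
  dom X T x0 -> dir_inf_bounded X S x0 ->
  restriction_maximal X T (bclosure X (dom X S)) x0 ->
  closed_subspace X (cone_diff X T (bclosure X (dom X S))) ->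
  maximal_monotone X (op_add X T S).
Proof.
  intros HC Hdom HTx0 Hdir Hmax HF. split; [apply op_add_monotone|].
  intros x xh Hxh Hrel. apply (related_point_in_sum X T S x0 x xh); auto.
  intros z t s Ht Hs.
  assert (Hh : op_add X T S z (fun v => t v + s v)) by (exists t, s; auto).
  pose proof (proj1 op_add_monotone _ _ Hh) as Hd.
  specialize (Hrel z _ Hh). simpl in Hrel.
  pose proof (dual_opp X _ (z [-] x) Hd) as E. simpl in E.
  replace (vopp X (z [-] x)) with (x [-] z) in E by vec.
  replace (x [-] z) with (vopp X (z [-] x)) in Hrel at 1 by vec.
  rewrite (dual_opp X xh) in Hrel by auto. lra.
Qed.

(** Contracting a and c towards x0 by the same t scales their difference by t, which lam/t undoes,
    and for small t the contracted c lies in K. *)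
Lemma cone_diff_restrict (C K : X -> Prop) (x0 z : X) :
  bconvex X C -> bconvex X K -> dom X T x0 -> C x0 -> binterior X K x0 ->
  cone_diff X T C z <-> cone_diff X T (fun v => C v /\ K v) z.
Proof.
  intros HC HK HTx0 HCx0 (rho & Hrho & Hball). split.
  - intros (lam & a & c & Hlam & Ha & Hc & ->).
    pose proof (vnorm_nonneg X (c [-] x0)) as Hn.
    set (t := Rmin 1 (rho / (2 * (norm (c [-] x0) + 1)))).
    assert (Ht : 0 < t) by (apply Rmin_glb_lt; [lra|apply Rdiv_lt_0_compat; lra]).
    assert (Ht1 : t <= 1) by apply Rmin_l.
    assert (Htn : t * norm (c [-] x0) < rho).
    { apply Rle_lt_trans with (rho / (2 * (norm (c [-] x0) + 1)) * norm (c [-] x0)).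
      - apply Rmult_le_compat_r; auto. apply Rmin_r.
      - apply (Rmult_lt_reg_r (norm (c [-] x0) + 1)); [lra|].
        replace (rho / (2 * (norm (c [-] x0) + 1)) * norm (c [-] x0) * (norm (c [-] x0) + 1))
          with (rho / 2 * norm (c [-] x0)) by (field; lra). nra. }
    exists (lam / t), ((1 - t) [*] x0 [+] t [*] a), ((1 - t) [*] x0 [+] t [*] c).
    split; [now apply Rdiv_lt_0_compat|]. split; [|split; [split|]].
    + apply co_convex; auto; [now apply co_dom|lra].
    + apply HC; auto. lra.
    + apply Hball. unfold bball.
      replace (((1 - t) [*] x0 [+] t [*] c) [-] x0) with (t [*] (c [-] x0)) by vec.
      rewrite norm_scal_pos; lra.
    + vecf; lra.
  - intros (lam & a & c & Hlam & Ha & (Hc & _) & E). now exists lam, a, c.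
Qed.

Lemma closed_subspace_ext (V W : X -> Prop) :
  (forall z, V z <-> W z) -> closed_subspace X V -> closed_subspace X W.
Proof.
  intros E (H0 & Ha & Hs & Hc). split; [now apply E|]. split; [|split].
  - intros u v Hu Hv. apply E, Ha; now apply E.
  - intros a v Hv. apply E, Hs. now apply E.
  - intros v Hv. apply E, Hc. intros e He. destruct (Hv e He) as (a & Haw & Hd).
    exists a. split; auto. now apply E.
Qed.

Lemma C1_restriction_maximal (C : X -> Prop) (x0 : X) :
  C1_maximal X T -> calC1 X T C -> dom X T x0 -> C x0 -> restriction_maximal X T C x0.
Proof.
  intros H1 (Ccl & Ccv & Csub) HTx0 HCx0 K Kcl Kcv Kint. apply H1.
  split; [now apply bclosed_and|]. split; [now apply bconvex_and|].
  eapply closed_subspace_ext; [|exact Csub].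
  intros z. now apply (cone_diff_restrict C K x0).
Qed.

Lemma C0_restriction_maximal (C : X -> Prop) (x0 : X) :
  C0_maximal X T -> bclosed X C -> bconvex X C -> dom X T x0 -> binterior X C x0 ->
  restriction_maximal X T C x0.
Proof.
  intros H0 Ccl Ccv HTx0 (r & Hr & Hb) K Kcl Kcv (r' & Hr' & Hb'). apply H0.
  split; [now apply bclosed_and|]. split; [now apply bconvex_and|].
  exists x0. split; auto. exists (Rmin r r'). split; [now apply Rmin_glb_lt|].
  pose proof (Rmin_l r r'). pose proof (Rmin_r r r').
  intros y Hy. unfold bball in Hy. split; [apply Hb|apply Hb']; unfold bball; lra.
Qed.

(** v = lam(x0 - (x0 - v/lam)), where lam exceeds |v|/r so that x0 - v/lam stays in the ball inside
    C. *)
Lemma cone_diff_interior (C : X -> Prop) (x0 v : X) :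
  dom X T x0 -> binterior X C x0 -> cone_diff X T C v.
Proof.
  intros HTx0 (r & Hr & Hb). pose proof (vnorm_nonneg X v) as Hv.
  set (lam := 2 / r * norm v + 1).
  assert (H2r : 0 < 2 / r) by (apply Rdiv_lt_0_compat; lra).
  assert (Hlam : 0 < lam) by (unfold lam; pose proof (Rmult_le_pos (2 / r) (norm v)); lra).
  exists lam, x0, (x0 [-] / lam [*] v). split; auto. split; [now apply co_dom|]. split.
  - apply Hb. unfold bball.
    replace ((x0 [-] / lam [*] v) [-] x0) with (vopp X (/ lam [*] v)) by vec.
    rewrite norm_opp, norm_scal_pos by (left; now apply Rinv_0_lt_compat).
    apply (Rmult_lt_reg_l lam); auto. rewrite <- Rmult_assoc, Rinv_r, Rmult_1_l by lra.
    unfold lam. rewrite Rmult_plus_distr_r.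
    replace (2 / r * norm v * r) with (2 * norm v) by (field; lra). lra.
  - vecf; lra.
Qed.

Lemma closed_subspace_full (V : X -> Prop) : (forall v, V v) -> closed_subspace X V.
Proof. intros H. split; auto. split; auto. split; auto. intros v _. auto. Qed.
End Sum.

Theorem theorem2p14 (X : Banach) (T S : operator X) :
  maximal_monotone X T -> maximal_monotone X S ->
  (forall x, dom X T x -> bclosure X (dom X S) x -> dom X S x) ->
  ((C1_maximal X T -> calC1 X T (bclosure X (dom X S)) ->
    (exists x0, dom X T x0 /\ dom X S x0 /\ dir_inf_bounded X S x0) ->
    maximal_monotone X (op_add X T S)) /\
   (C0_maximal X T ->
    (exists x, dom X T x /\ binterior X (dom X S) x) ->
    maximal_monotone X (op_add X T S))).
Proof.
  intros HT HS Hdom. split.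
  - intros H1 HC (x0 & HTx0 & HSx0 & Hdir).
    apply (sum_maximal X T S HT HS x0); auto; try apply HC.
    apply C1_restriction_maximal; auto. now apply bclosure_subset.
  - intros H0 (x1 & HTx1 & Hint).
    assert (HC : bconvex X (bclosure X (dom X S))) by (eapply closure_dom_convex; eauto).
    assert (HintC : binterior X (bclosure X (dom X S)) x1).
    { destruct Hint as (r & Hr & Hb). exists r. split; auto.
      intros y Hy. now apply bclosure_subset, Hb. }
    apply (sum_maximal X T S HT HS x1); auto.
    + now apply dir_inf_bounded_interior.
    + apply C0_restriction_maximal; auto. apply bclosure_closed.
    + apply closed_subspace_full. intros v. now apply (cone_diff_interior X T _ x1).
Qed.
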